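(* Consider the two-armed Lévy bandit problem described in the context, under Assumptions A1–A3. Let $\alpha$ be the unique solution in $(0,\infty)$ of $$f(\eta):=\int \Big(\frac{\nu_2(dh)}{\nu_1(dh)}\Big)^{\eta}\nu_2(dh)+\eta(\bar\nu_1-\bar\nu_2)-\bar\nu_2+\frac12(\eta+1)\eta\Big(\frac{\mu_1-\mu_2}{\sigma}\Big)^2-r=0 .$$ For every true prior $p_0\in[0,1]$, the expected discounted payoff $U(p_0,q_0)$ of a DM who holds the (possibly incorrect) prior belief $q_0\in[0,1]$ and uses the cut-off strategy with cut-off point $p'$ is as follows. If $q_0\ge p'$ (with $q_0>0$ and $p'<1$), then $$U(p_0,q_0)=(s-g_1)p_0\left(\frac{1-q_0}{q_0}\right)^{\alpha+1}\left(\frac{p'}{1-p'}\right)^{\alpha+1}+(s-g_2)(1-p_0)\left(\frac{1-q_0}{q_0}\right)^{\alpha}\left(\frac{p'}{1-p'}\right)^{\alpha}+g_1p_0+g_2(1-p_0),$$ while $U(p_0,q_0)=s$ if $q_0<p'$.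
   Context: Model. A decision maker (DM) operates in continuous time a safe arm, yielding the constant payoff rate $s\in\mathbb R$, and a risky arm of type $\theta\in\{\theta_1,\theta_2\}$ ($\theta_1$ = High, $\theta_2$ = Low). The true probability of $\theta=\theta_1$ is $p_0$. If $\theta=\theta_i$, the risky arm yields the Lévy process $X_i(t)=\mu_i t+\sigma_i Z(t)+L_{\nu_i}(t)$, where $Z$ is a standard Brownian motion and $L_{\nu_i}$ is a compound Poisson process, independent of $Z$, with finite Lévy measure $\nu_i$ on $\mathbb R\setminus\{0\}$. All integrals in $h$ are over $\mathbb R\setminus\{0\}$. Write $\bar\nu_i=\nu_i(\mathbb R\setminus\{0\})$; $H_i=\int h\,\nu_i(dh)/\bar\nu_i$ is assumed finite, and $\bar\nu_iH_i=\int h\,\nu_i(dh)$; $g_i:=E[X_i(1)]=\bar\nu_iH_i+\mu_i$. The discount rate is $r>0$. Assumptions. A1: $-\infty<g_2<s<g_1<\infty$. A2: $\sigma_1=\sigma_2=:\sigma$. A3: $\nu_2(A)\le\nu_1(A)<\infty$ for every Borel $A\subseteq\mathbb R\setminus\{0\}$. By A3 the Radon–Nikodym derivative $\frac{\nu_2(dh)}{\nu_1(dh)}$ exists. If there is no Brownian component ($\sigma=0$), it is understood that $\mu_1=\mu_2$ and the term $\big(\frac{\mu_1-\mu_2}{\sigma}\big)^2$ is read as $0$. Beliefs and cut-off strategies. The DM's belief $q_t$ is the Bayesian posterior probability of $\theta_1$ given the payoff history strictly before $t$, computed as if the prior probability of $\theta_1$ were $q_0$. Explicitly, if the risky arm has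 been used exclusively up to time $t$, the continuous part (drift plus Brownian motion) of the risky payoff is $Y(t)$, and the observed jumps before $t$ are $h_1,\dots,h_n$, then $$\frac{q_t}{1-q_t}=\frac{q_0}{1-q_0}\,\frac{e^{\mu_1Y(t)/\sigma^2-\mu_1^2t/2\sigma^2-\bar\nu_1t}}{e^{\mu_2Y(t)/\sigma^2-\mu_2^2t/2\sigma^2-\bar\nu_2t}}\prod_{j=1}^n\frac{\nu_1(dh_j)}{\nu_2(dh_j)}$$ (the terms involving $\mu_i$ being omitted if $\sigma=0$; the ratio is $+\infty$, i.e. $q_t=1$, if $\frac{\nu_2(dh)}{\nu_1(dh)}$ vanishes at some $h_j$). The cut-off strategy with cut-off point $p'$ plays only the safe arm at time $t$ if $q_t\le p'$ and only the risky arm if $q_t>p'$. The expected discounted payoff is $E\big[\int_0^\infty re^{-rt}dY^{\kappa}(t)\big]$, where $Y^\kappa$ is the payoff process under this strategy ($dY^\kappa=s\,dt$ while the safe arm is played, and $dY^\kappa$ equal to the increment of the risky Lévy process while the risky arm is played) and the expectation is taken with the true probability $p_0$ of $\theta_1$. *)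

(* Defs.v *)
From HB Require Import structures.
From mathcomp Require Import all_boot all_order all_algebra.
From mathcomp Require Import all_classical all_reals all_analysis.

Set Implicit Arguments.
Unset Strict Implicit.
Unset Printing Implicit Defensive.

Import Order.TTheory GRing.Theory Num.Theory.
Import numFieldNormedType.Exports.

Local Open Scope classical_set_scope.
Local Open Scope ring_scope.
Local Open Scope charge_scope.

(* Types of the risky arm are booleans: true = High, false = Low.             *)

(* A finite Levy measure on R \ {0} is represented by its extension to R that *)
(* does not charge 0 (see [admissible_levy]), so that integrals over R and    *)
(* over R \ {0} agree.                                                        *)
Record levy_arm (R : realType) := LevyArm {
  drift : R ;
  volatility : R ;
  levy : {finite_measure set (measurableTypeR R) -> \bar R} }.

Section parameters.
Context {R : realType}.

Definition levy_mass (a : levy_arm R) : R := fine (levy a setT).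

Definition admissible_levy (a : levy_arm R) : Prop :=
  levy a [set 0] = 0%E /\ (levy a).-integrable setT (fun h : R => h%:E).

Definition payoff_rate (a : levy_arm R) : R :=
  (\int[levy a]_h h) + drift a.

Definition density (arm : bool -> levy_arm R) (h : R) : R :=
  fine (('d (charge_of_finite_measure (levy (arm false)))
         '/d (levy (arm true))) h).

(* If the volatility is 0, the squared quotient is 0 since 0^-1 = 0.          *)
Definition characteristic (arm : bool -> levy_arm R) (r eta : R) : R :=
  (\int[levy (arm false)]_h (density arm h `^ eta))
  + eta * (levy_mass (arm true) - levy_mass (arm false))
  - levy_mass (arm false)
  + 2^-1 * (eta + 1) * eta
    * ((drift (arm true) - drift (arm false)) / volatility (arm true)) ^+ 2
  - r.

End parameters.

Section probability.
Context {R : realType} {d : measure_display} {T : measurableType d}.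
Variable P : probability T R.

Definition mutually_independent (F : nat -> set_system T) : Prop :=
  forall (I : seq nat) (E : nat -> set T), uniq I ->
    (forall i, i \in I -> F i (E i)) ->
    P (\bigcap_(i in [set` I]) E i) = (\prod_(i <- I) P (E i))%E.

Definition sigma_rv {d' : measure_display} {T' : measurableType d'}
    (X : T -> T') : set_system T :=
  preimage_set_system setT X measurable.

Definition sigma_process {d' : measure_display} {T' : measurableType d'}
    (X : R -> T -> T') : set_system T :=
  <<s \bigcup_(t in [set t : R | 0 <= t]) sigma_rv (X t) >>.

Definition brownian_motion (Z : R -> {RV P >-> R}) : Prop :=
  [/\ {ae P, forall w, Z 0 w = 0},
      {ae P, forall w, {within [set t : R | 0 <= t],
                          continuous (fun t => Z t w)}},
      (forall t : nat -> R, 0 <= t 0%N -> {homo t : m n / (m <= n)%N >-> m <= n} ->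
         mutually_independent
           (fun k => sigma_rv (fun w => Z (t k.+1) w - Z (t k) w))) &
      (forall (u t : R) (A : set R), 0 <= u -> u < t -> measurable A ->
         P [set w | A (Z t w - Z u w)] = normal_prob 0 (Num.sqrt (t - u)) A)].

(* The second argument of [poisson_prob] is a dummy; a Poisson law of rate 0  *)
(* is the Dirac mass at 0.                                                    *)
Definition poisson_process (rate : R) (N : R -> {RV P >-> nat}) : Prop :=
  [/\ {ae P, forall w, N 0 w = 0%N},
      {ae P, forall w, forall u t : R, 0 <= u -> u <= t -> (N u w <= N t w)%N},
      {ae P, forall w, forall t : R, 0 <= t ->
         \forall u \near t^'+, N u w = N t w},
      (forall t : nat -> R, 0 <= t 0%N -> {homo t : m n / (m <= n)%N >-> m <= n} ->
         mutually_independent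
           (fun k => sigma_rv (fun w => (N (t k.+1) w - N (t k) w)%N))) &
      (forall (u t : R) (A : set nat), 0 <= u -> u <= t ->
         P [set w | A (N t w - N u w)%N]
         = poisson_prob (rate * (t - u)) 0 A)].

(* N counts the jumps and [J k] is the size of the (k+1)-th one. The marks    *)
(* have law nu / nu(R); nothing is required of their law when nu = 0. The     *)
(* independence of N and J is part of [bandit_model].                         *)
Definition compound_poisson_data
    (nu : {finite_measure set (measurableTypeR R) -> \bar R})
    (N : R -> {RV P >-> nat}) (J : nat -> {RV P >-> R}) : Prop :=
  poisson_process (fine (nu setT)) N /\
  forall (k : nat) (A : set (measurableTypeR R)), measurable A ->
    (nu setT * P (J k @^-1` A) = nu A)%E.

Definition bandit_model (arm : bool -> levy_arm R) (p0 : R)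
    (theta : {RV P >-> bool}) (Z : R -> {RV P >-> R})
    (N : bool -> R -> {RV P >-> nat}) (J : bool -> nat -> {RV P >-> R}) : Prop :=
  [/\ P [set w | theta w = true] = p0%:E,
      brownian_motion Z,
      (forall i, compound_poisson_data (levy (arm i)) (N i) (J i)) &
      (forall i, mutually_independent (fun m : nat =>
         match m with
         | 0 => sigma_rv theta
         | 1 => sigma_process (fun t => Z t : T -> R)
         | 2 => sigma_process (fun t => N i t : T -> nat)
         | m'.+3 => sigma_rv (J i m')
         end))].

End probability.

(* The risky arm along one path: [i] is the realized type, [z] the Brownian   *)
(* path, [n] the jump counting path and [j] the sequence of jump sizes.       *)
Section paths.
Context {R : realType}.
Variables (arm : bool -> levy_arm R) (i : bool).
Variables (z : R -> R) (n : R -> nat) (j : nat -> R).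

Definition continuous_part (t : R) : R :=
  drift (arm i) * t + volatility (arm i) * z t.

Definition risky_payoff (t : R) : R :=
  continuous_part t + \sum_(k < n t) j k.

(* [k] belongs to this set when the (k+1)-th jump occurs strictly before t.   *)
Definition jumps_before (t : R) : set nat :=
  [set k | exists2 u, 0 <= u < t & (k < n u)%N].

(* If the volatility is 0, the drift terms vanish since 0^-1 = 0.             *)
Definition likelihood (a : levy_arm R) (t : R) : R :=
  expR (drift a * continuous_part t / volatility a ^+ 2
        - drift a ^+ 2 * t / (2 * volatility a ^+ 2)
        - levy_mass a * t).

Definition odds (q0 t : R) : R :=
  q0 / (1 - q0) * (likelihood (arm true) t / likelihood (arm false) t)
  * \big[*%R/1]_(k \in jumps_before t) (density arm (j k))^-1.

(* The posterior when the risky arm has been used exclusively on [0, t[; the  *)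
(* first case is the one of infinite odds.                                    *)
Definition belief (q0 t : R) : R :=
  if `[< q0 = 1 \/ exists2 k, jumps_before t k & density arm (j k) = 0 >]
  then 1 else odds q0 t / (1 + odds q0 t).

Definition switch_time (q0 p' : R) : \bar R :=
  ereal_inf [set t%:E | t in [set t : R | 0 <= t /\ belief q0 t <= p']].

(* Time spent on the risky arm up to time t under the cut-off strategy: the   *)
(* safe arm reveals nothing, so the belief stays put once it is played, and   *)
(* the belief at time t under the strategy is [belief q0 (risky_time q0 p' t)] *)
(* (see [cutoff_playP]).                                                      *)
Definition risky_time (q0 p' t : R) : R :=
  fine (mine t%:E (switch_time q0 p')).

Definition cutoff_payoff (s q0 p' t : R) : R :=
  risky_payoff (risky_time q0 p' t) + s * (t - risky_time q0 p' t).

Lemma switch_time_ge0 q0 p' : (0 <= switch_time q0 p')%E.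
Proof. by apply: le_ereal_inf_tmp => _ [t [t0 _] <-]; rewrite lee_fin. Qed.

Lemma risky_timeE q0 p' t :
  (risky_time q0 p' t)%:E = mine t%:E (switch_time q0 p').
Proof.
rewrite /risky_time; have := switch_time_ge0 q0 p'.
case: (switch_time q0 p') => [x|_|//].
  by move=> _; rewrite -EFin_min.
by rewrite min_l ?leey.
Qed.

(* Hypothesis: the infimum in [switch_time] is attained.                      *)
Lemma cutoff_playP q0 p' t :
  (forall x : R, switch_time q0 p' = x%:E -> belief q0 x <= p') -> 0 <= t ->
  (p' < belief q0 (risky_time q0 p' t)) = (t%:E < switch_time q0 p')%E.
Proof.
move=> att t0; case: (ltP t%:E (switch_time q0 p')) => [tlt|tge].
  have -> : risky_time q0 p' t = t.
    by apply: EFin_inj; rewrite risky_timeE min_l// ltW.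
  rewrite ltNge; apply/negP => bt.
  move: tlt; rewrite ltNge => /negP; apply.
  by apply: ereal_inf_lbound; exists t.
have rt : (risky_time q0 p' t)%:E = switch_time q0 p'.
  by rewrite risky_timeE min_r.
by apply/negbTE; rewrite -leNgt; apply: att; rewrite rt.
Qed.

End paths.

Section stieltjes.
Context {R : realType}.

(* Riemann-Stieltjes integral of f against Y over [a, b].                     *)
Definition is_stieltjes_integral (f Y : R -> R) (a b v : R) : Prop :=
  forall e : R, 0 < e -> exists2 delta : R, 0 < delta &
    forall (m : nat) (t c : nat -> R), t 0%N = a -> t m = b ->
      (forall k, (k < m)%N ->
         [/\ t k <= c k, c k <= t k.+1 & t k.+1 - t k < delta]) ->
      `| \sum_(k < m) f (c k) * (Y (t k.+1) - Y (t k)) - v | < e.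

Definition is_discounted_payoff (r : R) (Y : R -> R) (v : R) : Prop :=
  exists2 I : R -> R,
    (forall b, 0 <= b ->
       is_stieltjes_integral (fun t => r * expR (- r * t)) Y 0 b (I b)) &
    I b @[b --> +oo] --> v.

End stieltjes.

(* U is the expected discounted payoff: almost surely the discounted payoff   *)
(* is well defined, and it is integrable with mean U.                         *)
Definition is_expected_discounted_payoff {R : realType} {d : measure_display}
    {T : measurableType d} (P : probability T R)
    (r : R) (Y : T -> R -> R) (U : R) : Prop :=
  exists G : T -> R,
    [/\ {ae P, forall w, is_discounted_payoff r (Y w) (G w)},
        P.-integrable setT (EFin \o G) &
        ('E_P[G])%E = U%:E].

(* The payoff process of a decision maker with prior q0 and cut-off p'.       *)
Definition cutoff_process {R : realType} {d : measure_display}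
    {T : measurableType d} (P : probability T R) (arm : bool -> levy_arm R)
    (theta : {RV P >-> bool}) (Z : R -> {RV P >-> R})
    (N : bool -> R -> {RV P >-> nat}) (J : bool -> nat -> {RV P >-> R})
    (s q0 p' : R) (w : T) (t : R) : R :=
  cutoff_payoff arm (theta w) (fun u => Z u w) (fun u => N (theta w) u w)
    (fun k => J (theta w) k w) s q0 p' t.

(* Main.v *)
(* Fix the realized type i and put x = (1 - q0)/q0 * p'/(1 - p'). In terms of *)
(* the likelihood, the belief is at most p' when the left limit of x * ratio  *)
(* is at least 1, where ratio is the likelihood ratio of Low to High. With    *)
(* eta = alpha + 1 for High and eta = alpha for Low, the equation of alpha    *)
(* says that exp(-r t) ratio_t^eta is a martingale. The jumps of the ratio    *)
(* are downward by A3, so it crosses 1 / x continuously and optional stopping *)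
(* gives E[exp(-r tau); theta = i] = x^eta P(theta = i) for the switching     *)
(* time tau. The payoff compensated by its mean rate g_i t is a martingale,   *)
(* so the discounted payoff has mean g_i + (s - g_i) E[exp(-r tau)] given     *)
(* theta = i. Everything is done along dyadic grids: optional stopping holds  *)
(* on each grid, where only independence of the increments is used, and the   *)
(* limits are taken by dominated convergence; the domination comes from the   *)
(* exponential moments of the running maximum of the Brownian motion. The     *)
(* function of the exponent is convex, equals -r at 0 and grows without bound *)
(* because A1 excludes that both arms have the same law; hence alpha.         *)

From HB Require Import structures.
Require Import Defs.
From mathcomp Require Import all_boot all_order all_algebra.
From mathcomp Require Import all_classical all_reals all_analysis.
From mathcomp Require Import measurable_realfun.
From mathcomp Require Import ring lra.

Set Implicit Arguments.
Unset Strict Implicit.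
Unset Printing Implicit Defensive.

Import Order.TTheory GRing.Theory Num.Theory.
Import numFieldNormedType.Exports.

Local Open Scope classical_set_scope.
Local Open Scope ring_scope.

(** Fix the type [i] and work under [P] restricted to the event [theta] = [i]. The posterior odds
    are the prior odds divided by the likelihood ratio of Low to High, so the belief is at most p'
    exactly when x times the left limit of this ratio is at least 1, where x ([crossing_level]) is
    the odds of p' over the odds of q0 ([belief_le]). The switching time tau is therefore a first
    passage time of the ratio ([switch_timeE]).

    The ratio is the exponential of a Brownian motion with drift times a product of jump factors in
    [0, 1]. The equation for alpha says that exp(-r t) ratio^eta has constant mean, with eta = alpha
    under Low and eta = alpha + 1 under High ([martingale_exponent]). One alpha serves both types
    because the ratio is the density of the Low law with respect to the High law, so that one extra
    power of it turns a High mean into a Low mean ([integral_jump_ratio_powR] for the jumps). Since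
    all jumps are downward, the ratio reaches 1 / x without overshoot, and optional stopping gives
    the Laplace transform E[exp(-r tau); i] = x^eta P(i) ([crossing_discount]).

    The risky payoff minus its mean rate g_i t is a martingale, so its discounted integral up to tau
    has mean zero ([stopped_payoff_mean]). What remains is g_i (1 - exp(-r tau)) + s exp(-r tau),
    whose mean is given by the Laplace transform; summing over the two types yields the formula
    ([cutoff_expected_payoff]). If q0 < p', the switch happens at time 0 ([immediate_switch]).

    The model only supplies independence of increments and marks, so all stochastic arguments take
    place on dyadic grids. There the data are independent blocks ([grid_block_model]), and
    [optional_stopping] and [increment_mean] are discrete martingale statements. Continuous time is
    reached by dominated convergence, with dominating functions from a maximal inequality for the
    Brownian motion ([brownian_envelope], [payoff_envelope]). The path arguments are deterministic:
    they concern a [good_path], and the discounted payoff is a Riemann-Stieltjes integral obtained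
    through integration by parts ([by_parts_primitive]).

    Existence and uniqueness of alpha ([characteristic_root]) come from convexity: f is -r at 0, so
    it has at most one positive root, and A1 excludes two identical arms, so it becomes positive. *)

Section transfer.
Context d d' (T : measurableType d) (S : measurableType d') (R : realType).
Variables (mu : {measure set T -> \bar R}) (nu : {measure set S -> \bar R}).
Local Open Scope ereal_scope.
Import HBNNSimple.

(** From events to simple functions, then monotone convergence. The weight [h] lets one lemma cover
    laws of random variables ([h] = 1), densities ([X] the identity) and independence ([h] a product
    of the other factors). *)
Lemma ge0_integral_transfer (X : T -> S) (h : T -> R) (c : R) :
  measurable_fun setT X -> measurable_fun setT h -> (forall x, 0 <= h x)%R ->
  (0 <= c)%R ->
  (forall E : set S, measurable E ->
     \int[mu]_x (\1_E (X x) * h x)%:E = c%:E * nu E) ->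
  forall f : S -> R, measurable_fun setT f -> (forall y, 0 <= f y)%R ->
  \int[mu]_x (f (X x) * h x)%:E = c%:E * \int[nu]_y (f y)%:E.
Proof.
move=> mX mh h0 c0 H f mf f0.
have simple (g : {nnsfun S >-> R}) :
    \int[mu]_x (g (X x) * h x)%:E = c%:E * \int[nu]_y (g y)%:E.
  transitivity (\sum_(y \in range g) y%:E * (c%:E * nu (g @^-1` [set y]))).
    transitivity (\int[mu]_x (\sum_(y \in range g)
        (y%:E * (\1_(g @^-1` [set y]) (X x) * h x)%:E))).
      apply: eq_integral => x _; rewrite {1}fimfunE fsbig_finite//=.
      rewrite mulr_suml -sumEFin.
      rewrite fsbig_finite//=; apply: eq_bigr => i _.
      by rewrite -EFinM mulrA.
    have mI y : measurable_fun setT (fun x => \1_(g @^-1` [set y]) (X x) * h x : R)%R.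
      apply: measurable_funM => //.
      have mA : measurable (g @^-1` [set y]) by exact: measurable_funPTI.
      exact: (measurableT_comp (@measurable_indic _ _ R setT _ mA) mX).
    rewrite ge0_integral_fsum//; first last.
    - move=> y x _; have [y0|y0] := leP 0%R y.
        by rewrite mule_ge0 ?lee_fin// mulr_ge0.
      rewrite indicE memNset ?mul0r ?mule0//= => gy; move: y0.
      by rewrite -gy ltNge fun_ge0.
    - move=> y; apply: emeasurable_funM => //; exact/measurable_EFinP.
    rewrite !fsbig_finite//=; apply: eq_big_seq => y.
    rewrite in_fset_set// inE => -[z _ <-].
    rewrite ge0_integralZl_EFin//; last 2 first.
    - by move=> x _; rewrite lee_fin mulr_ge0.
    - exact/measurable_EFinP.
    by rewrite H//; exact: measurable_funPTI.
  rewrite integralT_nnsfun sintegralE !fsbig_finite//= ge0_sume_distrr//.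
    by apply: eq_bigr => y _; rewrite muleCA.
  by move=> y _; exact: nnsfun_mulemu_ge0.
have mf' : measurable_fun setT (EFin \o f) by exact/measurable_EFinP.
pose g := nnsfun_approx measurableT mf'.
have ndg y : {homo (g ^~ y) : m n / (m <= n)%N >-> (m <= n)%R}.
  by move=> m n mn; move/lefP: (nd_nnsfun_approx measurableT mf' mn); exact.
have gf y : (g n y)%:E @[n --> \oo] --> (f y)%:E.
  by apply: (cvg_nnsfun_approx measurableT mf') => //= z _; rewrite lee_fin.
have cL : \int[mu]_x (g n (X x) * h x)%:E @[n --> \oo] -->
          \int[mu]_x (f (X x) * h x)%:E.
  rewrite [X in _ --> X](_ : _ =
      \int[mu]_x (limn (fun n => (g n (X x) * h x)%:E))); last first.
    apply: eq_integral => x _; apply/esym/cvg_lim => //.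
    rewrite mulrC EFinM; under eq_fun do rewrite mulrC EFinM.
    exact: cvgeZl.
  apply: cvg_monotone_convergence => //.
  - move=> n; apply/measurable_EFinP; apply: measurable_funM => //.
    exact: measurableT_comp.
  - by move=> n x _; rewrite lee_fin mulr_ge0.
  - by move=> x _ m n mn; rewrite lee_fin ler_wpM2r//; exact: ndg.
have cR : c%:E * \int[nu]_y (g n y)%:E @[n --> \oo] --> c%:E * \int[nu]_y (f y)%:E.
  apply: cvgeZl => //; rewrite [X in _ --> X](_ : _ =
      \int[nu]_y (limn (fun n => (g n y)%:E))); last first.
    by apply: eq_integral => x _; apply/esym/cvg_lim.
  apply: cvg_monotone_convergence => //.
  - by move=> n; apply/measurable_EFinP.
  - by move=> n x _; rewrite lee_fin.
  - by move=> x _ m n mn; rewrite lee_fin; exact: ndg.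
move: cL; rewrite (_ : (fun n => _) = fun n => c%:E * \int[nu]_y (g n y)%:E).
  by move=> cL; exact: cvg_unique cL cR.
by apply/funext => n; exact: simple.
Qed.
End transfer.

(** * Independent increments and marks *)

Section independence.
Context d (T : measurableType d) (R : realType) (P : probability T R).
Local Open Scope ereal_scope.

Lemma prod_indic (A : nat -> set T) (J : seq nat) (w : T) :
  (\prod_(j <- J) \1_(A j) w = \1_(\bigcap_(j in [set` J]) A j) w :> R)%R.
Proof.
elim: J => [|j J IH].
  by rewrite big_nil indicE mem_set//= => i.
have -> : \bigcap_(i in [set` j :: J]) A i = A j `&` \bigcap_(i in [set` J]) A i.
  rewrite -bigcap_setU1; congr (bigcap _ _); apply/seteqP.
  by split=> i /=; rewrite inE => /predU1P.
by rewrite big_cons IH indicI.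
Qed.

Variable F : nat -> set_system T.
Hypotheses (indepF : mutually_independent P F)
  (mF : forall i, F i `<=` measurable).

(** Independence is assumed for events only. By induction on [I] the functions are treated one at a
    time: the factor [f i] is reduced by transfer to an indicator, which moves the index i from [I]
    to the list of events [J]. *)
Let mixed_indep (f : nat -> T -> R) (I J : seq nat) (A : nat -> set T) :
  (forall i w, 0 <= f i w)%R ->
  (forall i (E : set R), measurable E -> F i (f i @^-1` E)) ->
  (forall i, \int[P]_w (f i w)%:E < +oo) ->
  uniq (I ++ J) -> (forall j, j \in J -> F j (A j)) ->
  \int[P]_w (\prod_(i <- I) f i w * \prod_(j <- J) \1_(A j) w)%:E =
  \prod_(i <- I) \int[P]_w (f i w)%:E * \prod_(j <- J) P (A j).
Proof.
move=> f0 Ff foo.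
have mf i : measurable_fun setT (f i).
  by move=> _ E mE; rewrite setTI; apply/mF/Ff.
elim: I J A => [|i I IH] J A uIJ FJ.
  under eq_integral do rewrite big_nil mul1r prod_indic.
  rewrite integral_indic//; last first.
    by apply: fin_bigcap_measurable => // j /FJ/mF.
  by rewrite setIT big_nil mul1e; exact: (indepF uIJ FJ).
have [uiI iN] : uniq (I ++ J) /\ i \notin I ++ J by case/andP: uIJ.
have uI' : uniq (I ++ i :: J).
  by rewrite uniq_catC /= mem_cat orbC -mem_cat iN uniq_catC uiI.
pose c := fine (\prod_(i <- I) \int[P]_w (f i w)%:E * \prod_(j <- J) P (A j)).
have fin_c : (\prod_(i <- I) \int[P]_w (f i w)%:E * \prod_(j <- J) P (A j))
    \is a fin_num.
  rewrite fin_numM//.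
    apply: (big_ind (fun x => x \is a fin_num)) => //; [exact: fin_numM|move=> k _]; rewrite ge0_fin_numE//.
    by apply: integral_ge0 => w _; rewrite lee_fin.
  rewrite big_seq; apply: (big_ind (fun x => x \is a fin_num)) => //; [exact: fin_numM|move=> k kJ].
  by rewrite fin_num_measure//; exact/mF/FJ.
have mJ : measurable_fun setT (fun w => \prod_(j <- J) \1_(A j) w : R)%R.
  rewrite (_ : (fun w => _) = \1_(\bigcap_(j in [set` J]) A j)); last first.
    by apply/funext => w; rewrite prod_indic.
  by apply: measurable_indic; apply: fin_bigcap_measurable => // j /FJ/mF.
have mI : measurable_fun setT (fun w => \prod_(i <- I) f i w : R)%R.
  by apply: measurable_prod => // i _; exact: mf.
have c0 : (0 <= c)%R.
  apply: fine_ge0; apply: mule_ge0; apply: (big_ind (fun x => 0 <= x)) => //.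
  - exact: mule_ge0.
  - by move=> j _; apply: integral_ge0 => w _; rewrite lee_fin.
  - exact: mule_ge0.
(* Transfer needs a function that is nonnegative on all of R, hence the absolute value in place of
   the identity. *)
transitivity (\int[P]_w (`|f i w| *
    (\prod_(i <- I) f i w * \prod_(j <- J) \1_(A j) w))%:E).
  by apply: eq_integral => w _; rewrite big_cons mulrA ger0_norm.
rewrite (@ge0_integral_transfer _ _ _ _ _ P (pushforward P (f i)) (f i)
  (fun w => \prod_(i <- I) f i w * \prod_(j <- J) \1_(A j) w)%R c (mf i) _ _ _ _
  (fun y => `|y|)%R)//.
- rewrite fineK// ge0_integral_pushforward//; last first.
    by apply/measurable_EFinP; exact: normr_measurable.
  rewrite big_cons muleC -muleA; congr *%E.
  by apply: eq_integral => w _ /=; rewrite ger0_norm.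
- exact: measurable_funM.
- by move=> w; rewrite mulr_ge0// prodr_ge0.
- move=> E mE; rewrite /pushforward.
  pose A' j := if j == i then f i @^-1` E else A j.
  have A'E : {in J, A' =1 A}.
    move=> j jJ; rewrite /A' ifN//; apply: contra iN => /eqP <-.
    by rewrite mem_cat jJ orbT.
  have A'i : A' i = f i @^-1` E by rewrite /A' eqxx.
  have EJ : \prod_(j <- J) P (A' j) = \prod_(j <- J) P (A j).
    by apply: eq_big_seq => j jJ; rewrite A'E.
  have EJ' w : (\prod_(j <- J) \1_(A' j) w = \prod_(j <- J) \1_(A j) w :> R)%R.
    by apply: eq_big_seq => j jJ; rewrite A'E.
  have := IH (i :: J) A' uI' _.
  rewrite big_cons A'i EJ muleCA muleC fineK// => <-.
    by apply: eq_integral => w _; rewrite big_cons A'i EJ' mulrCA !indicE.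
  move=> j; rewrite inE => /predU1P[->|jJ]; first by rewrite /A' eqxx; exact: Ff.
  by rewrite A'E//; exact: FJ.
Qed.

Lemma indep_prod (f : nat -> T -> R) (I : seq nat) :
  (forall i w, 0 <= f i w)%R ->
  (forall i (E : set R), measurable E -> F i (f i @^-1` E)) ->
  (forall i, \int[P]_w (f i w)%:E < +oo) -> uniq I ->
  \int[P]_w (\prod_(i <- I) f i w)%:E = \prod_(i <- I) \int[P]_w (f i w)%:E.
Proof.
move=> f0 Ff foo uI.
have := @mixed_indep f I [::] (fun=> setT) f0 Ff foo.
rewrite cats0 big_nil mule1 => <-//.
by apply: eq_integral => w _; rewrite big_nil mulr1.
Qed.

End independence.

(** * Integrals determined on a pi-system *)

Section pi_lambda.
Context d (T : measurableType d) (R : realType).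
Variable Q : {finite_measure set T -> \bar R}.
Local Open Scope ereal_scope.

(** The proofs [mF] and [F0] are arguments so that a measure instance can be attached to this set
    function. *)
Definition density_measure (F : T -> R) (mF : measurable_fun setT F)
  (F0 : forall w, (0 <= F w)%R) (A : set T) : \bar R := \int[Q]_(w in A) (F w)%:E.

Section density_measure.
Variables (F : T -> R) (mF : measurable_fun setT F) (F0 : forall w, (0 <= F w)%R).
Let dm0 : density_measure mF F0 set0 = 0.
Proof. by rewrite /density_measure integral_set0. Qed.
Let dm_ge0 A : 0 <= density_measure mF F0 A.
Proof. by apply: integral_ge0 => w _; rewrite lee_fin. Qed.
Let dm_add : semi_sigma_additive (density_measure mF F0).
Proof.
by apply: semi_sigma_additive_nng_induced => //; exact/measurable_EFinP.
Qed.
HB.instance Definition _ := isMeasure.Build _ _ _ (density_measure mF F0)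
  dm0 dm_ge0 dm_add.
End density_measure.

(** Uniqueness of measures, applied to the measures of densities [F] and [F'] with respect to
    [Q]. *)
Lemma pi_lambda_integral (G : set (set T)) (g : (set T)^nat) (F F' : T -> R) :
  G `<=` measurable -> setI_closed G -> (forall i, G (g i)) ->
  \bigcup_k (g k) = setT ->
  measurable_fun setT F -> measurable_fun setT F' ->
  (forall w, 0 <= F w)%R -> (forall w, 0 <= F' w)%R ->
  \int[Q]_w (F w)%:E < +oo ->
  (forall A, G A -> \int[Q]_(w in A) (F w)%:E = \int[Q]_(w in A) (F' w)%:E) ->
  forall A, <<s G >> A -> \int[Q]_(w in A) (F w)%:E = \int[Q]_(w in A) (F' w)%:E.
Proof.
move=> mG IG Gg cov mF mF' F0 F0' foo H A sA.
apply: (@g_sigma_algebra_measure_unique _ R T G mG g Gg cov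
  (density_measure mF F0) (density_measure mF' F0') IG) => //.
move=> k; apply: le_lt_trans foo.
apply: ge0_subset_integral => //; first exact/mG/Gg.
  exact/measurable_EFinP.
by move=> w _; rewrite lee_fin.
Qed.
End pi_lambda.

Section block_products.
Context (R : realType) (T : Type).
Variables (X : nat -> T -> R) (D : nat -> T -> nat) (J : nat -> T -> R).

Definition count (K : nat) (w : T) : nat := (\sum_(k < K) D k w)%N.

(** A test function of the first [K] blocks. The number of marks of each block is prescribed by [l],
    so the marks that have been revealed form a deterministic initial segment. *)
Definition block_weight (K : nat) (f : nat -> R -> R) (l : nat -> nat)
    (h : nat -> R -> R) (w : T) : R :=
  \prod_(k < K) f k (X k w) * \prod_(k < K) (D k w == l k)%:R
  * \prod_(m < \sum_(k < K) l k) h m (J m w).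

Definition block_event (K : nat) (E : nat -> set R) (l : nat -> nat)
    (E' : nat -> set R) : set T :=
  [set w | [/\ (forall k, (k < K)%N -> E k (X k w)),
               (forall k, (k < K)%N -> D k w = l k) &
               (forall m, (m < \sum_(k < K) l k)%N -> E' m (J m w))]].

Lemma indic_block_event K E l E' w :
  \1_(block_event K E l E') w
  = block_weight K (fun k => \1_(E k)) l (fun m => \1_(E' m)) w :> R.
Proof.
rewrite /block_weight indicE; case: (boolP (w \in _)) => [|/negP].
  rewrite inE => -[h1 h2 h3].
  rewrite [X in X * _ * _]big1 => [|k _]; last first.
    by rewrite indicE mem_set//; exact: h1.
  rewrite [X in _ * X * _]big1 => [|k _]; last by rewrite h2// eqxx.
  rewrite [X in _ * X]big1 ?mulr1// => k _.
  by rewrite indicE mem_set//; exact: h3.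
move=> wN; apply/esym.
apply/eqP; rewrite !mulf_eq0; apply: contra_notT wN.
rewrite !negb_or => /andP[/andP[/prodf_neq0 h1 /prodf_neq0 h2] /prodf_neq0 h3].
rewrite inE; split.
- move=> k kK; have := h1 (Ordinal kK) isT.
  by rewrite indicE /= pnatr_eq0 eqb0 negbK inE.
- move=> k kK; have := h2 (Ordinal kK) isT.
  by rewrite pnatr_eq0 eqb0 negbK => /eqP.
- move=> k kK; have := h3 (Ordinal kK) isT.
  by rewrite indicE /= pnatr_eq0 eqb0 negbK inE.
Qed.

Lemma block_weight_count K f l h w : block_weight K f l h w != 0 ->
  count K w = (\sum_(k < K) l k)%N.
Proof.
rewrite /block_weight !mulf_eq0 !negb_or => /andP[/andP[_ /prodf_neq0 h2] _].
apply: eq_bigr => k _; have := h2 k isT.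
by rewrite pnatr_eq0 eqb0 negbK => /eqP.
Qed.

End block_products.

Lemma measurable_fun_nat_index d d' (T : measurableType d) (S : measurableType d')
    (N : T -> nat) (G : nat -> T -> S) :
  measurable_fun setT N -> (forall j, measurable_fun setT (G j)) ->
  measurable_fun setT (fun w => G (N w) w).
Proof.
move=> mN mG; have mE j : measurable (N @^-1` [set j]).
  by rewrite -[X in measurable X]setTI; exact: mN.
have -> : [set: T] = \bigcup_j (N @^-1` [set j]).
  by apply/seteqP; split=> // w _; exists (N w).
apply/measurable_fun_bigcup => // j.
apply: (eq_measurable_fun (G j)); last exact: measurable_funTS.
by move=> w; rewrite inE /= => ->.
Qed.

Section discrete_model.
Context d (T : measurableType d) (R : realType).
Variables (P : probability T R) (Q : {finite_measure set T -> \bar R}).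
Variables (X : nat -> T -> R) (D : nat -> T -> nat) (J : nat -> T -> R).
Variable pd : nat -> nat -> R.
Hypotheses (mX : forall k, measurable_fun setT (X k))
  (mD : forall k, measurable_fun setT (D k))
  (mJ : forall k, measurable_fun setT (J k)).
Local Open Scope ereal_scope.

Definition mean (Y : T -> R) (f : R -> R) (e : R) : Prop :=
  [/\ measurable_fun setT f, (forall x, 0 <= f x)%R &
      \int[P]_w (f (Y w))%:E = e%:E].

(* Under Q, the three families are independent with the laws they have under  *)
(* P, up to the total mass of Q.                                              *)
Hypothesis frozen : forall K p (f h : nat -> R -> R) (l : nat -> nat)
    (ef eh : nat -> R),
  (forall k, mean (X k) (f k) (ef k)) -> (forall m, mean (J m) (h m) (eh m)) ->
  \int[Q]_w (\prod_(k < K) f k (X k w) * \prod_(k < K) (D k w == l k)%:R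
     * \prod_(m < p) h m (J m w))%:E
  = Q setT * (\prod_(k < K) ef k * \prod_(k < K) pd k (l k)
     * \prod_(m < p) eh m)%:E.

Local Notation bweight := (block_weight X D J).

(** Block [K] with exactly [j] marks is appended to the test function; the result is again a product
    of the kind treated by [frozen], now with [K.+1] blocks and [j] more marks, so the new factors
    split off. *)
Lemma base_step K (f h : nat -> R -> R) (l : nat -> nat) ef eh (u : R -> R) eu j (v : nat -> R -> R) ev :
  (forall k, mean (X k) (f k) (ef k)) -> (forall m, mean (J m) (h m) (eh m)) ->
  mean (X K) u eu ->
  (forall m, mean (J ((\sum_(k < K) l k) + m)%N) (v m) (ev m)) ->
  \int[Q]_w (bweight K f l h w * (u (X K w) * (D K w == j)%:R
     * \prod_(m < j) v m (J (\sum_(k < K) l k + m)%N w)))%:E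
  = \int[Q]_w (bweight K f l h w)%:E * (eu * pd K j * \prod_(m < j) ev m)%:E.
Proof.
move=> Hf Hh Hu Hv; set n := (\sum_(k < K) l k)%N.
pose f' k := if (k == K)%N then u else f k.
pose l' k := if (k == K)%N then j else l k.
pose h' m := if (m < n)%N then h m else v (m - n)%N.
pose ef' k := if (k == K)%N then eu else ef k.
pose eh' m := if (m < n)%N then eh m else ev (m - n)%N.
have neK (k : 'I_K) : (k == K :> nat)%N = false by rewrite ltn_eqF.
transitivity (\int[Q]_w (\prod_(k < K.+1) f' k (X k w)
    * \prod_(k < K.+1) (D k w == l' k)%:R * \prod_(m < n + j) h' m (J m w))%:E).
  apply: eq_integral => w _; congr EFin; rewrite /block_weight.
  rewrite !big_ord_recr big_split_ord /= /f' /l' /h' !eqxx.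
  under [in RHS]eq_bigr do rewrite neK.
  under [X in (_ = _ * (X * _) * _)%R]eq_bigr do rewrite neK.
  under [X in (_ = _ * (X * _))%R]eq_bigr do rewrite /= ltn_ord.
  under [X in (_ = _ * (_ * X))%R]eq_bigr do rewrite /= ltnNge leq_addr/= addKn.
  by ring.
rewrite (@frozen K.+1 (n + j)%N f' h' l' ef' eh').
- rewrite /block_weight (@frozen K n f h l ef eh)// -muleA -EFinM; congr (_ * _%:E).
  rewrite !big_ord_recr big_split_ord /= /ef' /l' /eh' !eqxx.
  under eq_bigr do rewrite neK.
  under [X in (_ * (X * _) * _ = _)%R]eq_bigr do rewrite neK.
  under [X in (_ * (X * _) = _)%R]eq_bigr do rewrite /= ltn_ord.
  under [X in (_ * (_ * X) = _)%R]eq_bigr do rewrite /= ltnNge leq_addr/= addKn.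
  by ring.
- by move=> k; rewrite /f' /ef'; case: eqP => [->|].
- move=> m; rewrite /h' /eh'; case: ltnP => // nm.
  by have := Hv (m - n)%N; rewrite subnKC.
Qed.

Lemma series_pick (F : nat -> R) (k : nat) : (forall j, 0 <= F j)%R ->
  \sum_(j <oo) ((k == j)%:R * F j)%:E = (F k)%:E.
Proof.
move=> F0; rewrite (@nneseriesD1 _ _ k)//; last first.
  by move=> j; rewrite lee_fin mulr_ge0.
rewrite eqxx mul1r eseries0 ?adde0// => j _ /andP[_ /negbTE].
by rewrite eq_sym => ->; rewrite mul0r.
Qed.

Lemma measurable_count K : measurable_fun setT (count D K).
Proof.
elim: K => [|K IH].
  by rewrite (_ : count D 0 = cst 0%N)//; apply/funext => w; rewrite /count big_ord0.
rewrite (_ : count D K.+1 = (fun w => count D K w + D K w)%N); last first.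
  by apply/funext => w; rewrite /count big_ord_recr.
apply: (@measurable_fun_nat_index _ _ _ _ _ (fun j w => j + D K w)%N) => // j.
exact: (@measurableT_comp _ _ _ _ _ _ (addn j)).
Qed.

Lemma measurable_block_weight K (f h : nat -> R -> R) (l : nat -> nat) :
  (forall k, measurable_fun setT (f k)) -> (forall k, measurable_fun setT (h k)) ->
  measurable_fun setT (bweight K f l h).
Proof.
move=> mf mh; apply: measurable_funM; first apply: measurable_funM.
- by apply: measurable_prod => k _; exact: measurableT_comp.
- apply: measurable_prod => k _.
  rewrite (_ : (fun w => _) = (fun j => (j == l k)%:R) \o D k)//.
  exact: measurableT_comp.
- by apply: measurable_prod => m _; exact: measurableT_comp.
Qed.

(** Splitting according to the value j of [D K] reduces a quantity with a random number of marks to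
    quantities with a fixed number. [G] need only have the right form where the block weight does
    not vanish, that is where the number of earlier marks is known. *)
Lemma sum_step K (f h : nat -> R -> R) (l : nat -> nat) (Psi : nat -> T -> R)
    (a : nat -> R) (rho : R) (G : T -> R) :
  (forall k, measurable_fun setT (f k)) -> (forall k, measurable_fun setT (h k)) ->
  (forall k x, 0 <= f k x)%R -> (forall k x, 0 <= h k x)%R ->
  (forall j, measurable_fun setT (Psi j)) -> (forall j w, 0 <= Psi j w)%R ->
  (forall j, 0 <= a j)%R ->
  \int[Q]_w (bweight K f l h w)%:E \is a fin_num ->
  (forall j, \int[Q]_w (bweight K f l h w * ((D K w == j)%:R * Psi j w))%:E
     = \int[Q]_w (bweight K f l h w)%:E * (a j)%:E) ->
  \sum_(j <oo) (a j)%:E = rho%:E ->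
  (forall w, bweight K f l h w != 0%R -> G w = Psi (D K w) w) ->
  \int[Q]_w (bweight K f l h w * G w)%:E
  = \int[Q]_w (bweight K f l h w)%:E * rho%:E.
Proof.
move=> mf mh f0 h0 mPsi Psi0 a0 /fineK <- Hj Ha HG.
have W0 w : (0 <= bweight K f l h w)%R.
  by rewrite mulr_ge0// ?mulr_ge0// prodr_ge0.
have mW := measurable_block_weight K l mf mh.
transitivity (\int[Q]_w (\sum_(j <oo)
    (bweight K f l h w * ((D K w == j)%:R * Psi j w))%:E)).
  apply: eq_integral => w _.
  under eq_eseriesr do rewrite mulrCA.
  rewrite series_pick; last by move=> j; rewrite mulr_ge0.
  by have [->|/HG ->//] := eqVneq (bweight K f l h w) 0%R; rewrite !mul0r.
rewrite integral_nneseries//; first last.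
- by move=> j w _; rewrite lee_fin; apply: mulr_ge0 => //; exact: mulr_ge0.
- move=> j; apply/measurable_EFinP; apply: measurable_funM => //.
  apply: measurable_funM => //.
  rewrite (_ : (fun w => _) = (fun i => (i == j)%:R) \o D K)//.
  exact: measurableT_comp.
under eq_eseriesr do rewrite Hj.
rewrite nneseriesZl ?Ha//.
  by move=> j _; rewrite lee_fin.
Qed.

Lemma frozen_fin_num K (f h : nat -> R -> R) (l : nat -> nat) ef eh :
  (forall k, mean (X k) (f k) (ef k)) -> (forall m, mean (J m) (h m) (eh m)) ->
  \int[Q]_w (bweight K f l h w)%:E \is a fin_num.
Proof.
move=> Hf Hh; rewrite /block_weight (@frozen K _ f h l ef eh)//.
by rewrite fin_numM// fin_num_measure.
Qed.

(** In conditional terms: given the first [K] blocks, the factor contributed by block [K] has mean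
    [rho], however many marks came before ([n]). *)
Lemma multiplicative_step K (f h : nat -> R -> R) (l : nat -> nat) ef eh
    (u phi : R -> R) eu (ephi : nat -> R) rho :
  (forall k, mean (X k) (f k) (ef k)) -> (forall m, mean (J m) (h m) (eh m)) ->
  mean (X K) u eu -> (forall m, mean (J m) phi (ephi m)) ->
  (forall k j, 0 <= pd k j)%R ->
  (forall n, \sum_(j <oo) (eu * pd K j * \prod_(m < j) ephi (n + m)%N)%:E = rho%:E) ->
  \int[Q]_w (bweight K f l h w
     * (u (X K w) * \prod_(m < D K w) phi (J (count D K w + m)%N w)))%:E
  = \int[Q]_w (bweight K f l h w)%:E * rho%:E.
Proof.
move=> Hf Hh Hu Hphi pd0 Hrho.
have mf k : measurable_fun setT (f k) by case: (Hf k).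
have mh k : measurable_fun setT (h k) by case: (Hh k).
have f0 k x : (0 <= f k x)%R by case: (Hf k).
have h0 k x : (0 <= h k x)%R by case: (Hh k).
have [mu u0 Eu] := Hu.
have mphi : measurable_fun setT phi by case: (Hphi 0%N).
have phi0 x : (0 <= phi x)%R by case: (Hphi 0%N).
have eu0 : (0 <= eu)%R.
  by rewrite -lee_fin -Eu; apply: integral_ge0 => w _; rewrite lee_fin.
have ephi0 m : (0 <= ephi m)%R.
  case: (Hphi m) => _ _; rewrite -lee_fin => <-.
  by apply: integral_ge0 => w _; rewrite lee_fin.
set n := (\sum_(k < K) l k)%N.
apply: (@sum_step K f h l
  (fun j w => u (X K w) * \prod_(m < j) phi (J (n + m)%N w))%R
  (fun j => eu * pd K j * \prod_(m < j) ephi (n + m)%N)%R) => //.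
- move=> j; apply: measurable_funM; first exact: measurableT_comp.
  by apply: measurable_prod => m _; exact: measurableT_comp.
- by move=> j w; rewrite mulr_ge0// prodr_ge0.
- by move=> j; rewrite mulr_ge0 ?mulr_ge0// prodr_ge0.
- exact: frozen_fin_num Hf Hh.
- move=> j; rewrite -(@base_step K f h l ef eh u eu j (fun=> phi)
    (fun m => ephi (n + m)%N))//.
  by apply: eq_integral => w _; congr EFin; ring.
- by move=> w W0; rewrite (block_weight_count W0).
Qed.

Lemma additive_step K (f h : nat -> R -> R) (l : nat -> nat) ef eh
    (phi : R -> R) (ephi : nat -> R) rho :
  (forall k, mean (X k) (f k) (ef k)) -> (forall m, mean (J m) (h m) (eh m)) ->
  (forall m, mean (J m) phi (ephi m)) ->
  (forall k j, 0 <= pd k j)%R ->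
  (forall n, \sum_(j <oo) (pd K j * \sum_(m < j) ephi (n + m)%N)%:E = rho%:E) ->
  \int[Q]_w (bweight K f l h w
     * \sum_(m < D K w) phi (J (count D K w + m)%N w))%:E
  = \int[Q]_w (bweight K f l h w)%:E * rho%:E.
Proof.
move=> Hf Hh Hphi pd0 Hrho.
have mf k : measurable_fun setT (f k) by case: (Hf k).
have mh k : measurable_fun setT (h k) by case: (Hh k).
have f0 k x : (0 <= f k x)%R by case: (Hf k).
have h0 k x : (0 <= h k x)%R by case: (Hh k).
have mphi : measurable_fun setT phi by case: (Hphi 0%N).
have phi0 x : (0 <= phi x)%R by case: (Hphi 0%N).
have ephi0 m : (0 <= ephi m)%R.
  case: (Hphi m) => _ _; rewrite -lee_fin => <-.
  by apply: integral_ge0 => w _; rewrite lee_fin.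
have mean1 Y : mean Y (fun=> 1%R) 1%R.
  by split=> //; rewrite integral_cst // mul1e; exact: probability_setT.
set n := (\sum_(k < K) l k)%N.
apply: (@sum_step K f h l (fun j w => \sum_(m < j) phi (J (n + m)%N w))%R
  (fun j => pd K j * \sum_(m < j) ephi (n + m)%N)%R) => //.
- by move=> j; apply: measurable_sum => m; exact: measurableT_comp.
- by move=> j w; rewrite sumr_ge0.
- by move=> j; rewrite mulr_ge0// sumr_ge0.
- exact: frozen_fin_num Hf Hh.
- move=> j; rewrite mulr_sumr -sumEFin ge0_sume_distrr; last first.
    by move=> m _; rewrite lee_fin mulr_ge0.
  (* The sum over the marks is treated term by term: the term [m0] is the product with weight [phi]
     at [m0] and 1 at the other marks, to which [base_step] applies. *)
  pose v (m0 m : nat) := if m == m0 then phi else fun=> 1%R.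
  pose ev (m0 m : nat) := if m == m0 then ephi (n + m)%N else 1%R.
  have pick (F : nat -> R) (m0 : 'I_j) :
      (\prod_(m < j) (if (m == m0 :> nat)%N then F m else 1) = F m0)%R.
    rewrite (bigD1 m0)//= eqxx big1 ?mulr1// => m mm0.
    by rewrite ifN.
  transitivity (\sum_(m0 < j) \int[Q]_w (bweight K f l h w * (1 *
     (D K w == j)%:R * \prod_(m < j) v m0 m (J (n + m)%N w)))%:E).
    rewrite -ge0_integral_sum//; last 2 first.
    - move=> m0; apply/measurable_EFinP; apply: measurable_funM.
        exact: measurable_block_weight.
      apply: measurable_funM.
        apply: measurable_funM => //.
        rewrite (_ : (fun w => _) = (fun i => (i == j)%:R) \o D K)//.
        exact: measurableT_comp.
      apply: measurable_prod => m _; apply: measurableT_comp => //.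
      by rewrite /v; case: ifP.
    - move=> m0 w _; rewrite lee_fin; apply: mulr_ge0.
        by rewrite mulr_ge0// ?mulr_ge0// prodr_ge0.
      rewrite mul1r mulr_ge0// prodr_ge0// => m _; rewrite /v.
      by case: ifP => // _; rewrite ler01.
    apply: eq_integral => w _; rewrite sumEFin; congr EFin.
    rewrite !mulr_sumr; apply: eq_bigr => m0 _; rewrite mul1r.
    rewrite -(pick (fun m => phi (J (n + m)%N w)) m0); congr (_ * (_ * _))%R.
    by apply: eq_bigr => m _; rewrite /v; case: eqP.
  apply: eq_bigr => m0 _.
  rewrite (@base_step K f h l ef eh (fun=> 1%R) 1%R j (v m0) (ev m0))//.
    rewrite mul1r; congr (_ * (_ * _)%:E).
    exact: (pick (fun m => ephi (n + m)%N) m0).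
  by move=> m; rewrite /v /ev; case: ifP.
- by move=> w W0; rewrite (block_weight_count W0).
Qed.

End discrete_model.

(** * Optional stopping on a grid *)

Section history.
Context d (T : measurableType d) (R : realType).
Variables (X : nat -> T -> R) (D : nat -> T -> nat) (J : nat -> T -> R).
Hypotheses (mX : forall k, measurable_fun setT (X k))
  (mD : forall k, measurable_fun setT (D k))
  (mJ : forall k, measurable_fun setT (J k)).

(* A pi-system generating the information of the first K blocks; fixing the   *)
(* numbers of marks makes the set of revealed marks deterministic.            *)
Definition history (K : nat) : set_system T :=
  [set A | A = set0 \/ exists (E : nat -> set R) (l : nat -> nat)
     (E' : nat -> set R), [/\ forall k, measurable (E k),
       forall m, measurable (E' m) & A = block_event X D J K E l E']].

Lemma measurable_block_event K E l E' :
  (forall k, measurable (E k)) -> (forall m, measurable (E' m)) ->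
  measurable (block_event X D J K E l E').
Proof.
move=> mE mE'.
rewrite (_ : block_event _ _ _ _ _ _ _ =
  \bigcap_(k in `I_K) (X k @^-1` E k) `&`
  \bigcap_(k in `I_K) (D k @^-1` [set l k]) `&`
  \bigcap_(m in `I_(\sum_(k < K) l k)) (J m @^-1` E' m)).
  apply: measurableI; first apply: measurableI.
  - by apply: bigcap_measurableType => k _; rewrite -[X in measurable X]setTI; exact: mX.
  - by apply: bigcap_measurableType => k _; rewrite -[X in measurable X]setTI; exact: mD.
  - by apply: bigcap_measurableType => k _; rewrite -[X in measurable X]setTI; exact: mJ.
apply/seteqP; split => w /=.
  by move=> [h1 h2 h3]; split; [split|] => k /=; [exact: h1|exact: h2|exact: h3].
by move=> [[h1 h2] h3]; split => k; [exact: h1|exact: h2|exact: h3].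
Qed.

Lemma history_measurable K : history K `<=` measurable.
Proof.
move=> A [->//|[E [l [E' [mE mE' ->]]]]].
exact: measurable_block_event.
Qed.

(** Events that prescribe different counts are disjoint, which is why [history] contains the empty
    set. For equal counts the revealed marks are the same and the constraints intersect
    coordinatewise. *)
Lemma history_setI K : setI_closed (history K).
Proof.
move=> A B [->|[E [l [E' [mE mE' ->]]]]]; first by rewrite set0I; left.
move=> [->|[F [l' [F' [mF mF' ->]]]]]; first by rewrite setI0; left.
have [ll'|/existsNP[k /not_implyP[kK /eqP kl]]] :=
    pselect (forall k, (k < K)%N -> l k = l' k); last first.
  left; apply/seteqP; split => w //= [[_ h _] [_ h' _]].
  by move: kl; rewrite -(h k)// -(h' k)// eqxx.
right; exists (fun k => E k `&` F k), l, (fun m => E' m `&` F' m).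
split; [by move=> k; exact: measurableI|by move=> k; exact: measurableI|].
have sl : (\sum_(k < K) l k = \sum_(k < K) l' k)%N.
  by apply: eq_bigr => k _; exact: ll'.
apply/seteqP; split => w /=.
  move=> [[h1 h2 h3] [h1' h2' h3']]; split => //.
    by move=> k kK; split; [exact: h1|exact: h1'].
  by move=> m mK; split; [exact: h3|apply: h3'; rewrite -sl].
move=> [h1 h2 h3]; split; split => //.
- by move=> k /h1[].
- by move=> k /h3[].
- by move=> k /h1[].
- by move=> k kK; rewrite -ll'//; exact: h2.
- by rewrite -sl => k /h3[].
Qed.

Definition count_event (K : nat) (l : nat -> nat) : set T :=
  block_event X D J K (fun=> setT) l (fun=> setT).

(** The whole space is not in the pi-system, but it is the union of the countably many count events,
    enumerated here through codes of finite sequences. *)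
Let cover (K n : nat) : set T :=
  if @unpickle (seq nat) n is Some s then count_event K (nth 0%N s) else set0.

Let history_cover K n : history K (cover K n).
Proof.
rewrite /cover; case: unpickle => [s|]; last by left.
by right; exists (fun=> setT), (nth 0%N s), (fun=> setT).
Qed.

Let bigcup_cover K : \bigcup_n (cover K n) = setT.
Proof.
apply/seteqP; split => // w _.
exists (pickle [seq D k w | k <- iota 0 K]) => //.
rewrite /cover pickleK; split => // k kK.
by rewrite (nth_map 0%N) ?size_iota// nth_iota// add0n.
Qed.

Lemma history_integral (Q : {finite_measure set T -> \bar R}) K (F F' : T -> R) :
  measurable_fun setT F -> measurable_fun setT F' ->
  (forall w, 0 <= F w) -> (forall w, 0 <= F' w) ->
  (\int[Q]_w (F' w)%:E < +oo)%E ->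
  (forall (E E' : nat -> set R) l,
     (forall k, measurable (E k)) -> (forall m, measurable (E' m)) ->
     \int[Q]_w (block_weight X D J K (fun k => \1_(E k)) l (fun m => \1_(E' m)) w
        * F w)%:E
     = \int[Q]_w (block_weight X D J K (fun k => \1_(E k)) l
         (fun m => \1_(E' m)) w * F' w)%:E)%E ->
  forall A, <<s history K >> A ->
  (\int[Q]_(w in A) (F w)%:E = \int[Q]_(w in A) (F' w)%:E)%E.
Proof.
move=> mF mF' F0 F0' foo H A sA; apply/esym.
apply: (@pi_lambda_integral _ T R Q (history K) (cover K) F' F) => //.
- exact: history_measurable.
- exact: history_setI.
- move=> _ [->|[E [l [E' [mE mE' ->]]]]]; first by rewrite !integral_set0.
  have mA := @measurable_block_event K E l E' mE mE'.
  have eqI (G : T -> R) : (\int[Q]_(w in block_event X D J K E l E') (G w)%:E =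
    \int[Q]_w (block_weight X D J K (fun k => \1_(E k)) l (fun m => \1_(E' m)) w
      * G w)%:E)%E.
    rewrite integral_mkcond; apply: eq_integral => w _.
    rewrite -indic_block_event patchE indicE; case: ifP => _.
      by rewrite mul1r.
    by rewrite mul0r.
  by rewrite !eqI H.
Qed.

Definition history_type (K : nat) := g_sigma_algebraType (history K).

Lemma measurable_fun_history d' (S : measurableType d') K (F : T -> S) :
  (forall l, measurable_fun (count_event K l : set (history_type K)) F) ->
  measurable_fun (setT : set (history_type K)) F.
Proof.
move=> HF; rewrite -(bigcup_cover K).
have mc n : measurable (cover K n : set (history_type K)).
  by apply: (@sub_sigma_algebra _ setT (history K)); exact: history_cover.
apply/measurable_fun_bigcup => // n; rewrite /cover.
case: unpickle => [s|]; first exact: HF.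
exact: measurable_fun_set0.
Qed.

Definition walk (u phi : R -> R) (K : nat) (w : T) : R :=
  \prod_(k < K) u (X k w) * \prod_(m < count D K w) phi (J m w).

Lemma walkS u phi K w : walk u phi K.+1 w = walk u phi K w *
  (u (X K w) * \prod_(m < D K w) phi (J (count D K w + m)%N w)).
Proof.
rewrite /walk /count !big_ord_recr /= big_split_ord /=; ring.
Qed.

Lemma walk_ge0 u phi K w : (forall x, 0 <= u x) -> (forall x, 0 <= phi x) ->
  0 <= walk u phi K w.
Proof. by move=> u0 phi0; rewrite mulr_ge0// prodr_ge0. Qed.

Lemma measurable_walk u phi K : measurable_fun setT u ->
  measurable_fun setT phi -> measurable_fun setT (walk u phi K).
Proof.
move=> mu mphi; apply: measurable_funM.
  by apply: measurable_prod => k _; exact: measurableT_comp.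
apply: (@measurable_fun_nat_index _ _ _ _ _ (fun j w => \prod_(m < j) phi (J m w))).
  exact: measurable_count.
by move=> j; apply: measurable_prod => m _; exact: measurableT_comp.
Qed.

(** On a count event the walk is a product of a fixed number of factors, each depending on a single
    increment or on a single revealed mark. *)
Lemma walk_adapted u phi k K : measurable_fun setT u ->
  measurable_fun setT phi -> (k <= K)%N ->
  measurable_fun (setT : set (history_type K)) (walk u phi k).
Proof.
move=> mu mphi kK; apply: measurable_fun_history => l.
pose W (w : history_type K) : R := \prod_(j < k) u (X j w) *
  \prod_(m < \sum_(j < k) l j) phi (J m w).
have mc : measurable (count_event K l : set (history_type K)).
  by apply: (@sub_sigma_algebra _ setT (history K)); right; exists (fun=> setT), l, (fun=> setT).
apply: (eq_measurable_fun W).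
  move=> w; rewrite inE => -[_ h _]; rewrite /W /walk /count.
  have -> // : (\sum_(j < k) D j w = \sum_(j < k) l j)%N.
  by apply: eq_bigr => j _; apply: h; exact: leq_trans kK.
apply: measurable_funM.
  apply: measurable_prod => j _; apply: (measurable_comp measurableT) => //.
  move=> _ B mB; apply: (@sub_sigma_algebra _ setT (history K)); right.
  exists (fun i => if i == j :> nat then B else setT), l, (fun=> setT).
  split => //; first by move=> i; case: ifP.
  apply/seteqP; split => w /= [].
    move=> [_ h _] hB; split => // i iK; case: ifP => // /eqP ->//.
  move=> h1 h2 h3; split => //.
  by have := h1 j (leq_trans (ltn_ord j) kK); rewrite eqxx.
apply: measurable_prod => m _; apply: (measurable_comp measurableT) => //.
have mK : (m < \sum_(j < K) l j)%N.
  apply: leq_trans (ltn_ord m) _.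
  by rewrite (big_ord_widen K l kK) [leqRHS](bigID (fun i : 'I_K => (i < k)%N)) leq_addr.
move=> _ B mB; apply: (@sub_sigma_algebra _ setT (history K)); right.
exists (fun=> setT), l, (fun i => if i == m :> nat then B else setT).
split => //; first by move=> i; case: ifP.
apply/seteqP; split => w /= [].
  move=> [_ h _] hB; split => // i iK; case: ifP => // /eqP ->//.
move=> h1 h2 h3; split => //.
by have := h3 m mK; rewrite eqxx.
Qed.

End history.

(** The discrete setting for optional stopping: increments [X], counts [D] with probabilities [pd],
    and marks [J], independent under a finite measure [Q] with their laws under [P]. *)
Definition block_model d (T : measurableType d) (R : realType)
    (P : probability T R) (Q : {finite_measure set T -> \bar R})
    (X : nat -> T -> R) (D : nat -> T -> nat) (J : nat -> T -> R)
    (pd : nat -> R) : Prop :=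
  [/\ forall k, measurable_fun setT (X k), forall k, measurable_fun setT (D k),
      forall k, measurable_fun setT (J k), forall j, 0 <= pd j &
      forall K p (f h : nat -> R -> R) (l : nat -> nat) (ef eh : nat -> R),
  (forall k, mean P (X k) (f k) (ef k)) -> (forall m, mean P (J m) (h m) (eh m)) ->
  (\int[Q]_w (\prod_(k < K) f k (X k w) * \prod_(k < K) (D k w == l k)%:R
     * \prod_(m < p) h m (J m w))%:E
  = Q setT * (\prod_(k < K) ef k * \prod_(k < K) pd (l k)
     * \prod_(m < p) eh m)%:E)%E].

Section stopping.
Context d (T : measurableType d) (R : realType).
Variables (P : probability T R) (Q : {finite_measure set T -> \bar R}).
Variables (X : nat -> T -> R) (D : nat -> T -> nat) (J : nat -> T -> R).
Variable pd : nat -> R.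
Hypothesis model : block_model P Q X D J pd.

Let mX k : measurable_fun setT (X k). Proof. by case: model. Qed.
Let mD k : measurable_fun setT (D k). Proof. by case: model. Qed.
Let mJ k : measurable_fun setT (J k). Proof. by case: model. Qed.
Let pd0 : forall k j : nat, 0 <= pd j. Proof. by case: model. Qed.
Let frozen := let: And5 _ _ _ _ h := model in h.

Let mean_indic (Y : T -> R) (f : R -> R) e (E : set R) :
  measurable_fun setT Y -> mean P Y f e -> measurable E ->
  mean P Y (fun x => \1_E x * f x) (fine (\int[P]_w (\1_E (Y w) * f (Y w))%:E)%E).
Proof.
move=> mY [mf f0 Ef] mE; split.
- by apply: measurable_funM => //; exact: measurable_indic.
- by move=> x; rewrite mulr_ge0.
- rewrite fineK// ge0_fin_numE; last first.
    by apply: integral_ge0 => w _; rewrite lee_fin mulr_ge0.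
  apply: (@le_lt_trans _ _ (\int[P]_w (f (Y w))%:E)%E); last by rewrite Ef ltry.
  apply: ge0_le_integral => //.
  - by move=> w _; rewrite lee_fin mulr_ge0.
  - apply/measurable_EFinP; apply: measurable_funM; last exact: measurableT_comp.
    exact: (measurableT_comp (@measurable_indic _ _ R setT _ mE) mY).
  - by apply/measurable_EFinP; exact: measurableT_comp.
  - by move=> w _; rewrite lee_fin ler_piMl.
Qed.

Let mean_cst1 Y : mean P Y (fun=> 1) 1.
Proof.
by split=> //; rewrite integral_cst // mul1e; exact: probability_setT.
Qed.

Let mean_indic1 (Y : T -> R) (E : set R) :
  measurable_fun setT Y -> measurable E ->
  mean P Y (\1_E) (fine (\int[P]_w (\1_E (Y w) * 1)%:E)%E).
Proof.
move=> mY mE; have := mean_indic mY (mean_cst1 Y) mE.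
by rewrite (_ : (fun x => _ * 1) = \1_E)//; apply/funext => x; rewrite mulr1.
Qed.

(** The series hypothesis says that each block multiplies the walk by a factor of mean 1. Constancy
    of the mean and the martingale property go together: the pi-lambda argument for step [K] needs
    the mean at [K] to be finite, and the step gives the mean at [K.+1]. *)
Lemma martingale_step (u phi : R -> R) (eu : nat -> R) (ephi : nat -> R) :
  (forall k, mean P (X k) u (eu k)) -> (forall m, mean P (J m) phi (ephi m)) ->
  (forall K n, \sum_(j <oo) (eu K * pd j * \prod_(m < j) ephi (n + m)%N)%:E = 1%:E)%E ->
  forall K, (\int[Q]_w (walk X D J u phi K w)%:E = Q setT)%E /\
  forall A, <<s history X D J K >> A ->
   (\int[Q]_(w in A) (walk X D J u phi K.+1 w)%:E
    = \int[Q]_(w in A) (walk X D J u phi K w)%:E)%E.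
Proof.
move=> Hu Hphi Hser.
have [mu u0 _] := Hu 0%N; have [mphi phi0 _] := Hphi 0%N.
have mw K := @measurable_walk _ _ _ _ _ _ mX mD mJ u phi K mu mphi.
have w0 K w : 0 <= walk X D J u phi K w by exact: walk_ge0.
have step K : (\int[Q]_w (walk X D J u phi K w)%:E = Q setT)%E ->
  forall A, <<s history X D J K >> A ->
   (\int[Q]_(w in A) (walk X D J u phi K.+1 w)%:E
    = \int[Q]_(w in A) (walk X D J u phi K w)%:E)%E.
  move=> EK; apply: history_integral => //.
    rewrite EK; apply: fin_num_fun_lty; exact: fin_num_measure.
  move=> E E' l mE mE'.
  pose f k x := \1_(E k) x * u x.
  pose h m x := \1_(E' m) x * phi x.
  have Hf k : mean P (X k) (f k) (fine (\int[P]_w (f k (X k w))%:E)%E).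
    exact: mean_indic (Hu k) _.
  have Hh m : mean P (J m) (h m) (fine (\int[P]_w (h m (J m w))%:E)%E).
    exact: mean_indic (Hphi m) _.
  have eqW w : block_weight X D J K (fun k => \1_(E k)) l (fun m => \1_(E' m)) w
      * walk X D J u phi K w = block_weight X D J K f l h w.
    have -> : block_weight X D J K f l h w =
        block_weight X D J K (fun k => \1_(E k)) l (fun m => \1_(E' m)) w *
        (\prod_(k < K) u (X k w) * \prod_(m < \sum_(k < K) l k) phi (J m w)).
      by rewrite /block_weight /f /h !big_split /=; ring.
    set W := block_weight _ _ _ _ _ _ _ _.
    have [->|Wn0] := eqVneq W 0; first by rewrite !mul0r.
    by rewrite /walk (block_weight_count Wn0).
  transitivity (\int[Q]_w (block_weight X D J K f l h w
     * (u (X K w) * \prod_(m < D K w) phi (J (count D K w + m)%N w)))%:E)%E.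
    by apply: eq_integral => w _; rewrite walkS mulrA eqW.
  rewrite (@multiplicative_step _ _ _ P Q X D J (fun=> pd) mX mD mJ _ K f h l
    _ _ u phi (eu K) ephi 1 Hf Hh (Hu K) Hphi _ (Hser K))//.
  by rewrite mule1; apply: eq_integral => w _; rewrite eqW.
suff EK K : (\int[Q]_w (walk X D J u phi K w)%:E = Q setT)%E.
  by move=> K; split; [exact: EK|exact: step].
elim: K => [|K IH].
  rewrite -[RHS]mul1e -integral_cst//; apply: eq_integral => w _.
  by rewrite /walk /count !big_ord0 mulr1.
rewrite -IH; apply: (step K IH).
exact: (@measurableT _ (history_type X D J K)).
Qed.

Lemma compound_step (phi : R -> R) (ephi : nat -> R) (beta : R) :
  (forall m, mean P (J m) phi (ephi m)) ->
  (forall n, \sum_(j <oo) (pd j * \sum_(m < j) ephi (n + m)%N)%:E = beta%:E)%E ->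
  forall K A, <<s history X D J K >> A ->
   (\int[Q]_(w in A) (\sum_(m < D K w) phi (J (count D K w + m)%N w))%:E
    = beta%:E * Q A)%E.
Proof.
move=> Hphi Hser K A sA.
have [mphi phi0 _] := Hphi 0%N.
have ephi0 m : 0 <= ephi m.
  case: (Hphi m) => _ _; rewrite -lee_fin => <-.
  by apply: integral_ge0 => w _; rewrite lee_fin.
have b0 : 0 <= beta.
  rewrite -lee_fin -(Hser 0%N); apply: nneseries_ge0 => j _ _.
  by rewrite lee_fin mulr_ge0 ?sumr_ge0//; exact: pd0.
have mA : measurable A.
  by apply: (smallest_sub _ (@history_measurable _ _ _ _ _ _ mX mD mJ K)) sA;
     exact: sigma_algebra_measurable.
rewrite -integral_cst//.
apply: (@history_integral _ _ _ X D J mX mD mJ Q K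
  (fun w => \sum_(m < D K w) phi (J (count D K w + m)%N w)) (fun=> beta)) => //.
- apply: (@measurable_fun_nat_index _ _ _ _ (D K) (fun j w =>
    \sum_(m < j) phi (J (count D K w + m)%N w))) => // j.
  apply: measurable_sum => m.
  apply: (@measurable_fun_nat_index _ _ _ _ _ (fun i w => phi (J (i + m)%N w))).
    exact: measurable_count.
  by move=> i; exact: measurableT_comp.
- by move=> w; rewrite sumr_ge0.
- rewrite integral_cst//; rewrite lte_mul_pinfty ?lee_fin//.
  by apply: fin_num_fun_lty; exact: fin_num_measure.
- move=> E E' l mE mE'.
  rewrite (@additive_step _ _ _ P Q X D J (fun=> pd) mX mD mJ _ K _ _ l
    _ _ phi ephi beta (fun k => mean_indic1 (mX k) (mE k))
     (fun k => mean_indic1 (mJ k) (mE' k)) Hphi _ Hser)//.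
  rewrite muleC -ge0_integralZl_EFin//.
  - by apply: eq_integral => w _; rewrite -EFinM mulrC.
  - by move=> w _; rewrite lee_fin -indic_block_event.
  - apply/measurable_EFinP; apply: measurable_block_weight => // k;
    exact: measurable_indic.
Qed.

Lemma increment_step (u : R -> R) (eu : R) K : mean P (X K) u eu ->
  (\sum_(j <oo) (pd j)%:E = 1%:E)%E ->
  forall A, <<s history X D J K >> A ->
   (\int[Q]_(w in A) (u (X K w))%:E = eu%:E * Q A)%E.
Proof.
move=> Hu Hser A sA; have [mu u0 Eu] := Hu.
have eu0 : 0 <= eu.
  by rewrite -lee_fin -Eu; apply: integral_ge0 => w _; rewrite lee_fin.
have mA : measurable A.
  by apply: (smallest_sub _ (@history_measurable _ _ _ _ _ _ mX mD mJ K)) sA;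
     exact: sigma_algebra_measurable.
rewrite -integral_cst//.
apply: (@history_integral _ _ _ X D J mX mD mJ Q K
  (fun w => u (X K w)) (fun=> eu)) => //.
- exact: measurableT_comp.
- rewrite integral_cst//; rewrite lte_mul_pinfty ?lee_fin//.
  by apply: fin_num_fun_lty; exact: fin_num_measure.
- move=> E E' l mE mE'.
  transitivity (\int[Q]_w (block_weight X D J K (fun k => \1_(E k)) l
    (fun m => \1_(E' m)) w * (u (X K w) * \prod_(m < D K w) 1))%:E)%E.
    by apply: eq_integral => w _; rewrite big1// mulr1.
  rewrite (@multiplicative_step _ _ _ P Q X D J (fun=> pd) mX mD mJ _ K _ _ l
    _ _ u (fun=> 1) eu (fun=> 1) eu (fun k => mean_indic1 (mX k) (mE k))
     (fun k => mean_indic1 (mJ k) (mE' k)) Hu (fun m => mean_cst1 _))//; last first.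
    move=> n; under eq_eseriesr do rewrite big1// mulr1 EFinM.
    by rewrite nneseriesZl ?Hser ?mule1// => j _; rewrite lee_fin pd0.
  rewrite muleC -ge0_integralZl_EFin//.
  - by apply: eq_integral => w _; rewrite -EFinM mulrC.
  - by move=> w _; rewrite lee_fin -indic_block_event.
  - apply/measurable_EFinP; apply: measurable_block_weight => // k;
    exact: measurable_indic.
Qed.

Definition alive (B : nat -> set T) (K : nat) : set T :=
  [set w | forall k, (k <= K)%N -> ~ B k w].

(** The first k at which [B k] occurs, capped at [K]. The recursion fits the induction for optional
    stopping: from [K] to [K.+1] the index changes only on [alive B K]. *)
Fixpoint stop_index (B : nat -> set T) (K : nat) (w : T) : nat :=
  if K is K'.+1 then
    if w \in alive B K' then K else stop_index B K' w
  else 0%N.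

Lemma stop_index_alive B K w : w \in alive B K -> stop_index B K w = K.
Proof.
case: K => [|K] //=; rewrite inE => h; rewrite mem_set// => k kK.
by apply: h; exact: leq_trans kK _.
Qed.

Lemma stop_index_le B K w : (stop_index B K w <= K)%N.
Proof. by elim: K => //= K IH; case: ifP => // _; exact: leqW. Qed.

Lemma alive_history (B : nat -> set T) K :
  (forall k, (k <= K)%N -> <<s history X D J K >> (B k)) ->
  <<s history X D J K >> (alive B K).
Proof.
move=> HB.
have -> : alive B K = \bigcap_(k in `I_K.+1) ~` B k.
  by apply/seteqP; split=> w h k kK; exact: h.
apply: (@bigcap_measurableType _ (history_type X D J K)) => k kK.
by apply: (@measurableC _ (history_type X D J K)); exact: HB.
Qed.

(** Off [alive B K] the stopped walk no longer moves; on this event of the history it goes from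
    index [K] to [K.+1], which preserves the integral by the martingale property. *)
Lemma optional_stopping (u phi : R -> R) (eu : nat -> R) (ephi : nat -> R)
    (B : nat -> set T) :
  (forall k, mean P (X k) u (eu k)) -> (forall m, mean P (J m) phi (ephi m)) ->
  (forall K n, \sum_(j <oo) (eu K * pd j * \prod_(m < j) ephi (n + m)%N)%:E = 1%:E)%E ->
  (forall k K, (k <= K)%N -> <<s history X D J K >> (B k)) ->
  forall K, measurable_fun setT (fun w => walk X D J u phi (stop_index B K w) w) /\
  (\int[Q]_w (walk X D J u phi (stop_index B K w) w)%:E = Q setT)%E.
Proof.
move=> Hu Hphi Hser HB.
have [mu u0 _] := Hu 0%N; have [mphi phi0 _] := Hphi 0%N.
have mw K := @measurable_walk _ _ _ _ _ _ mX mD mJ u phi K mu mphi.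
have w0 K w : 0 <= walk X D J u phi K w by exact: walk_ge0.
have mart := martingale_step Hu Hphi Hser.
have sA K : <<s history X D J K >> (alive B K).
  by apply: alive_history => k; exact: HB.
have mA K : measurable (alive B K).
  by apply: (smallest_sub _ (@history_measurable _ _ _ _ _ _ mX mD mJ K)) (sA K);
     exact: sigma_algebra_measurable.
elim=> [|K [IHm IH]].
  by split; [exact: mw|exact: (mart 0%N).1].
have mS : measurable_fun setT
    (fun w => walk X D J u phi (stop_index B K.+1 w) w).
  rewrite (_ : (fun w => _) = (fun w => if w \in alive B K then
    walk X D J u phi K.+1 w else walk X D J u phi (stop_index B K w) w)).
    apply: measurable_fun_if => //; last 2 first.
    - exact: measurable_funTS.
    - exact: measurable_funTS.
    - apply: (measurable_fun_bool true); rewrite setTI (_ : _ @^-1` _ = alive B K)//.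
      by apply/seteqP; split=> w /= => [/set_mem|/mem_set].
  by apply/funext => w /=; case: ifP.
split=> //.
have mE (f : T -> R) : measurable_fun setT f -> forall E, measurable_fun E (EFin \o f).
  by move=> mf E; apply/measurable_EFinP; exact: measurable_funTS.
rewrite -IH -(setvU (alive B K)).
rewrite !ge0_integral_setU//; try exact: measurableC; try (by rewrite setvU; exact: mE);
  try (by move=> w _; rewrite lee_fin); try by rewrite disj_set2E setICl.
congr (_ + _)%E.
  apply: eq_integral => w; rewrite inE => /= wN.
  by rewrite memNset.
transitivity (\int[Q]_(w in alive B K) (walk X D J u phi K.+1 w)%:E)%E.
  by apply: eq_integral => w wA; rewrite /= wA.
rewrite (mart K).2//; apply: eq_integral => w wA.
by rewrite stop_index_alive.
Qed.

End stopping.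

(** * The probability restricted to one type *)

Section restriction.
Context d (T : measurableType d) (R : realType) (P : probability T R).
Variables (A : set T) (mA : measurable A).
Local Open Scope ereal_scope.

Let PA_lty : P A < +oo.
Proof. by rewrite ltey_eq fin_num_measure. Qed.

(** Restricting instead of conditioning avoids dividing by the probability of a type, which may be
    0. *)
Definition restriction := mfrestr mA PA_lty.

HB.instance Definition _ := Measure.on restriction.
HB.instance Definition _ := FiniteMeasure.on restriction.

Lemma restrictionE B : restriction B = P (B `&` A).
Proof. by []. Qed.

Lemma ge0_integral_restriction (f : T -> R) :
  measurable_fun setT f -> (forall w, 0 <= f w)%R ->
  \int[restriction]_w (f w)%:E = \int[P]_w (f w * \1_A w)%:E.
Proof.
move=> mf f0; rewrite (@ge0_integral_transfer _ _ _ _ _ P restriction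
  (fun w => w) (\1_A) 1%R)//; rewrite ?mul1e//.
move=> E mE; rewrite mul1e; change (\int[P]_w (\1_E w * \1_A w)%:E = P (E `&` A)).
rewrite -[in RHS](setIT (E `&` A)).
rewrite -integral_indic//; last exact: measurableI.
by apply: eq_integral => w _; rewrite indicI.
Qed.

Lemma ae_restriction (Pr : T -> Prop) :
  {ae P, forall w, A w -> Pr w} -> {ae restriction, forall w, Pr w}.
Proof.
move=> [B [mB B0 sB]]; exists (B `|` ~` A); split.
- by apply: measurableU => //; exact: measurableC.
- rewrite /restriction /mfrestr /mrestr /= setIUl setICl setU0.
  apply/eqP; rewrite -measure_le0 -B0; apply: le_measure; rewrite ?inE//.
  exact: measurableI.
- move=> w /= nPr; have [Aw|nAw] := pselect (A w); [left|by right].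
  by apply: sB => /= h; exact/nPr/h.
Qed.

End restriction.

(** * Laws of the increments of the model *)

Lemma big_iota0 (V : Type) (op : V -> V -> V) (idx : V) (n : nat) (F : nat -> V) :
  \big[op/idx]_(k <- iota 0 n) F k = \big[op/idx]_(k < n) F k.
Proof. by rewrite -(big_mkord xpredT) /index_iota subn0. Qed.

Section grid.
Context d (T : measurableType d) (R : realType) (P : probability T R).
Variables (arm : bool -> levy_arm R) (p0 : R) (theta : {RV P >-> bool})
  (Z : R -> {RV P >-> R}) (N : bool -> R -> {RV P >-> nat})
  (J : bool -> nat -> {RV P >-> R}).
Hypothesis model : bandit_model arm p0 theta Z N J.
Variables (i : bool) (delta : R).
Hypothesis delta0 : 0 < delta.

Definition grid_point (k : nat) : R := k%:R * delta.
Definition brownian_increment (k : nat) (w : T) : R :=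
  Z (grid_point k.+1) w - Z (grid_point k) w.
Definition count_increment (k : nat) (w : T) : nat :=
  (N i (grid_point k.+1) w - N i (grid_point k) w)%N.

(* When there are no jumps, nothing is known about the law of [J i m].        *)
Definition mark (m : nat) (w : T) : R :=
  if levy_mass (arm i) == 0 then 0 else J i m w.

Definition count_pmf (j : nat) : R :=
  fine (poisson_prob (levy_mass (arm i) * delta) 0 [set j]).

Let mZ k : measurable_fun setT (brownian_increment k).
Proof. by apply: measurable_funB. Qed.

Let mN k : measurable_fun setT (count_increment k).
Proof.
apply: (@measurable_fun_nat_index _ _ _ _ (N i (grid_point k))
  (fun j w => N i (grid_point k.+1) w - j)%N) => // j.
exact: (@measurableT_comp _ _ _ _ _ _ (fun n => n - j)%N).
Qed.

Let mJ m : measurable_fun setT (mark m).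
Proof. by rewrite /mark; case: (_ == _). Qed.

Let grid_homo : {homo grid_point : m n / (m <= n)%N >-> m <= n}.
Proof. by move=> m n mn; rewrite ler_pM2r// ler_nat. Qed.

Let grid_ge0 k : 0 <= grid_point k.
Proof. by rewrite mulr_ge0// ltW. Qed.

Let gridS k : grid_point k.+1 - grid_point k = delta.
Proof. by rewrite /grid_point -natr1; ring. Qed.

Lemma count_pmfE k l : P [set w | count_increment k w = l] = (count_pmf l)%:E.
Proof.
have [_ _ /(_ i)[[_ _ _ _ H] _] _] := model.
rewrite fineK ?fin_num_measure//.
rewrite (H (grid_point k) (grid_point k.+1) [set l])//.
  by rewrite gridS.
exact: grid_homo.
Qed.

Let sigma_process_measurable d' (T' : measurableType d') (Y : R -> T -> T') :
  (forall t, measurable_fun setT (Y t)) -> sigma_process Y `<=` measurable.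
Proof.
move=> mY; apply: smallest_sub; first exact: sigma_algebra_measurable.
by move=> A [t _ [B mB <-]]; rewrite setTI -[X in measurable X]setTI; exact: mY.
Qed.

Let sigma_process_fun d' (T' : measurableType d') (Y : R -> T -> T') (t : R) :
  0 <= t -> measurable_fun
    (setT : set (g_sigma_algebraType
       (\bigcup_(t in [set t : R | 0 <= t]) sigma_rv (Y t)))) (Y t).
Proof.
by move=> t0 _ B mB; apply: sub_sigma_algebra; exists t => //; exists B.
Qed.

Local Open Scope ereal_scope.

Let fac (m : nat) : set_system T :=
  match m with
  | 0%N => sigma_rv theta
  | 1%N => sigma_process (fun t => Z t : T -> R)
  | 2%N => sigma_process (fun t => N i t : T -> nat)
  | m'.+3 => sigma_rv (J i m')
  end.

Let fac_measurable m : fac m `<=` measurable.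
Proof.
case: m => [|[|[|m]]].
- by move=> A [B mB <-]; exact: measurable_funP.
- by apply: sigma_process_measurable => t; exact: measurable_funP.
- by apply: sigma_process_measurable => t; exact: measurable_funP.
- by move=> A [B mB <-]; exact: measurable_funP.
Qed.

Let mtheta : measurable (theta @^-1` [set i]).
Proof. exact: measurable_funPTI. Qed.

(** Independence is used on two levels: between the type, the Brownian motion, the counts and the
    marks, and then between the increments inside the Brownian motion and inside the counting
    process. *)
Lemma grid_block_model :
  block_model P (restriction P mtheta) brownian_increment count_increment mark
    count_pmf.
Proof.
split => //; first by move=> j; exact: fine_ge0.
move=> K p f h l ef eh Hf Hh.
have mf k : measurable_fun setT (f k) by case: (Hf k).
have mh k : measurable_fun setT (h k) by case: (Hh k).
have f0 k x : (0 <= f k x)%R by case: (Hf k).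
have h0 k x : (0 <= h k x)%R by case: (Hh k).
have Ef k : \int[P]_w (f k (brownian_increment k w))%:E = (ef k)%:E by case: (Hf k).
have Eh k : \int[P]_w (h k (mark k w))%:E = (eh k)%:E by case: (Hh k).
rewrite ge0_integral_restriction; last 2 first.
- apply: measurable_funM; first apply: measurable_funM.
  + by apply: measurable_prod => k _; exact: measurableT_comp.
  + apply: measurable_prod => k _.
    rewrite (_ : (fun w => _) = (fun j => (j == l k)%:R) \o count_increment k)//.
    exact: measurableT_comp.
  + by apply: measurable_prod => k _; exact: measurableT_comp.
- by move=> w; rewrite mulr_ge0 ?mulr_ge0 ?prodr_ge0.
(* One factor for each independent family of the model: the type, the Brownian increments, the
   counts, then the individual marks. *)
pose F m : T -> R := match m with
  | 0%N => \1_(theta @^-1` [set i])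
  | 1%N => fun w => (\prod_(k < K) f k (brownian_increment k w))%R
  | 2%N => fun w => (\prod_(k < K) (count_increment k w == l k)%:R)%R
  | m'.+3 => fun w => if (m' < p)%N then h m' (mark m' w) else 1%R
  end.
have [_ _ /(_ i)[[_ _ _ indepN _] _] /(_ i) indepF] := model.
have [_ _ indepZ _] : brownian_motion Z by case: model.
have EZ : \int[P]_w (F 1%N w)%:E = (\prod_(k < K) ef k)%:E.
  transitivity (\int[P]_w (\prod_(k <- iota 0 K)
      f k (brownian_increment k w))%:E).
    by apply: eq_integral => w _; rewrite big_iota0.
  have indepX := indepZ grid_point (grid_ge0 0) grid_homo.
  rewrite (@indep_prod _ _ _ P _ indepX _ (fun k w => f k (brownian_increment k w)))//.
  - by rewrite -prodEFin big_iota0; apply: eq_bigr.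
  - by move=> k A [B mB <-]; rewrite setTI -[X in measurable X]setTI; exact: mZ.
  - move=> k E mE; exists (f k @^-1` E); last by rewrite setTI.
    by rewrite -[X in measurable X]setTI; exact: mf.
  - by move=> k; rewrite Ef ltry.
  - exact: iota_uniq.
have EN : \int[P]_w (F 2%N w)%:E = (\prod_(k < K) count_pmf (l k))%:E.
  transitivity (\int[P]_w (\prod_(k <- iota 0 K)
      (count_increment k w == l k)%:R)%:E).
    by apply: eq_integral => w _; rewrite big_iota0.
  have indepD := indepN grid_point (grid_ge0 0) grid_homo.
  have Ed k : \int[P]_w (count_increment k w == l k)%:R%:E = (count_pmf (l k))%:E.
    rewrite -(count_pmfE k) -[LHS]/(\int[P]_w ((count_increment k w == l k)%:R)%:E).
    rewrite -[X in _ = P X]setIT -integral_indic//; last first.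
      by rewrite -[X in measurable X]setTI; exact: (@mN k measurableT [set l k]).
    apply: eq_integral => w _; rewrite indicE.
    have [kl|/eqP kl] := eqVneq (count_increment k w) (l k).
      by rewrite mem_set.
    by rewrite memNset.
  rewrite (@indep_prod _ _ _ P _ indepD _
    (fun k w => (count_increment k w == l k)%:R))//.
  - by rewrite -prodEFin big_iota0; apply: eq_bigr.
  - by move=> k A [B mB <-]; rewrite setTI -[X in measurable X]setTI; exact: mN.
  - by move=> k E mE; exists ((fun j : nat => (j == l k)%:R) @^-1` E); [|rewrite setTI].
  - by move=> k; rewrite Ed ltry.
  - exact: iota_uniq.
transitivity (\int[P]_w (\prod_(m <- iota 0 (p.+3)) F m w)%:E).
  apply: eq_integral => w _; congr EFin.
  rewrite big_iota0 3!big_ord_recl /= !mulrA mulrC !mulrA; congr (_ * _ * _ * _)%R.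
  by apply: eq_bigr => m _ /=; rewrite ltn_ord.
rewrite (@indep_prod _ _ _ P _ indepF fac_measurable F)//.
- rewrite big_iota0 3!big_ord_recl /= EZ EN !muleA.
  rewrite [X in X * _ * _ * _](_ : _ = restriction P mtheta setT).
    rewrite -!muleA; congr (_ * _); rewrite !EFinM muleA; congr (_ * _).
    rewrite -prodEFin; apply: eq_bigr => m _ /=.
    by rewrite ltn_ord Eh.
  rewrite integral_indic// setIT.
  by change (P (theta @^-1` [set i]) = P (setT `&` theta @^-1` [set i])); rewrite setTI.
- case=> [|[|[|m]]] w /=.
  + by [].
  + by apply: prodr_ge0 => k _.
  + by apply: prodr_ge0 => k _.
  + by case: ifP => // _; rewrite ler01.
- case=> [|[|[|m]]] E mE.
  + exists ((fun b : bool => (b == i)%:R) @^-1` E); [by []|rewrite setTI].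
    rewrite -comp_preimage; congr (_ @^-1` E); apply/funext => w /=.
    have [wi|/eqP wi] := eqVneq (theta w) i; first by rewrite indicE mem_set.
    by rewrite indicE memNset.
  + have: measurable_fun (setT : set (g_sigma_algebraType
       (\bigcup_(t in [set t : R | (0 <= t)%R]) sigma_rv (Z t)))) (F 1%N).
      apply: measurable_prod => k _; apply: (measurable_comp measurableT) => //.
      by apply: measurable_funB; exact: sigma_process_fun.
    by move=> /(_ measurableT E mE); rewrite setTI.
  + have: measurable_fun (setT : set (g_sigma_algebraType
       (\bigcup_(t in [set t : R | (0 <= t)%R]) sigma_rv (N i t)))) (F 2%N).
      apply: measurable_prod => k _.
      rewrite (_ : (fun w => _) =
        (fun j => (j == l k)%:R) \o count_increment k)//.
      apply: (measurable_comp measurableT) => //.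
      pose GN := g_sigma_algebraType
        (\bigcup_(t in [set t : R | (0 <= t)%R]) sigma_rv (N i t)).
      apply: (@measurable_fun_nat_index _ _ GN _ (N i (grid_point k) : GN -> nat)
        (fun j w => N i (grid_point k.+1) w - j)%N).
        exact: sigma_process_fun.
      move=> j; apply: (@measurable_comp _ _ _ _ _ _ setT (fun n => n - j)%N) => //.
      exact: sigma_process_fun.
    by move=> /(_ measurableT E mE); rewrite setTI.
  + pose g (x : R) : R := if (m < p)%N then
      h m (if levy_mass (arm i) == 0%R then 0%R else x) else 1%R.
    have mg : measurable_fun setT g.
      rewrite /g; case: (m < p)%N => //; apply: measurableT_comp => //.
      by case: (_ == _).
    exists (g @^-1` E); last by rewrite setTI.
    by rewrite -[X in measurable X]setTI; exact: mg.
- case=> [|[|[|m]]].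
  + rewrite /= integral_indic// setIT.
    by rewrite ltey_eq fin_num_measure.
  + by rewrite EZ ltry.
  + by rewrite EN ltry.
  + rewrite /=; case: (m < p)%N; first by rewrite Eh ltry.
    by rewrite integral_cst// mul1e ltey_eq fin_num_measure.
- exact: iota_uniq.
Qed.
End grid.

Lemma expR_series (R : realType) (x : R) : 0 <= x ->
  (\sum_(n <oo) (x ^+ n / n`!%:R)%:E = (expR x)%:E)%E.
Proof.
move=> x0; rewrite expRE -EFin_lim; last first.
  rewrite /pseries/=; under eq_fun do rewrite mulrC.
  exact: is_cvg_series_exp_coeff.
apply/congr_lim/funext => n/=; rewrite /pseries/= /series/= -sumEFin//.
by under eq_bigr do rewrite mulrC.
Qed.

Section laws.
Context d (T : measurableType d) (R : realType) (P : probability T R).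
Variables (arm : bool -> levy_arm R) (p0 : R) (theta : {RV P >-> bool})
  (Z : R -> {RV P >-> R}) (N : bool -> R -> {RV P >-> nat})
  (J : bool -> nat -> {RV P >-> R}).
Hypothesis model : bandit_model arm p0 theta Z N J.
Variables (i : bool) (delta : R).
Hypothesis delta0 : 0 < delta.
Local Notation lam := (levy_mass (arm i)).
Local Notation X := (brownian_increment Z delta).

Lemma levy_mass_ge0 : 0 <= lam.
Proof. exact: fine_ge0. Qed.

Lemma ge0_integral_increment k (f : R -> R) :
  measurable_fun setT f -> (forall x, 0 <= f x) ->
  (\int[P]_w (f (X k w))%:E
   = \int[lebesgue_measure]_x (f x * normal_pdf 0 (Num.sqrt delta) x)%:E)%E.
Proof.
move=> mf f0.
have mX : measurable_fun setT (X k) by exact: measurable_funB.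
have -> : (\int[P]_w (f (X k w))%:E = \int[normal_prob 0 (Num.sqrt delta)]_x (f x)%:E)%E.
  have := @ge0_integral_transfer _ _ _ _ _ P (normal_prob 0 (Num.sqrt delta)) (X k)
    (fun=> 1) 1 mX _ _ _ _ f mf f0.
  rewrite mul1e => <-//.
    by apply: eq_integral => w _; rewrite mulr1.
  move=> E mE; rewrite mul1e.
  have [_ [_ _ _ H] _ _] := model.
  have gS : grid_point delta k.+1 - grid_point delta k = delta.
    by rewrite /grid_point -natr1; ring.
  have := H (grid_point delta k) (grid_point delta k.+1) E.
  rewrite gS => PE; transitivity (P [set w | E (X k w)]); last first.
    by apply: PE => //; [rewrite mulr_ge0// ltW|rewrite -subr_gt0 gS].
  have mE' : measurable [set w | E (X k w)].
    by rewrite -[X in measurable X]setTI; exact: (@mX measurableT E mE).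
  rewrite -[X in _ = P X]setIT -integral_indic//.
  by apply: eq_integral => w _; rewrite mulr1 !indicE.
have := @ge0_integral_transfer _ _ _ _ R lebesgue_measure
  (normal_prob 0 (Num.sqrt delta)) (fun x => x) (normal_pdf 0 (Num.sqrt delta)) 1
  _ _ _ _ _ f mf f0.
rewrite mul1e => -> //.
- exact: measurable_normal_pdf.
- by move=> x; exact: normal_pdf_ge0.
move=> E mE; rewrite mul1e.
transitivity (\int[lebesgue_measure]_(x in E) (normal_pdf 0 (Num.sqrt delta) x)%:E)%E;
  last by [].
rewrite [RHS]integral_mkcond.
apply: eq_integral => x _; rewrite patchE indicE.
by case: ifP; rewrite ?mul1r ?mul0r.
Qed.

Lemma mean_expR_increment k (a : R) :
  mean P (X k) (fun x => expR (a * x)) (expR (a ^+ 2 * delta / 2)).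
Proof.
split.
- by apply: measurableT_comp => //; exact: measurable_funM.
- by move=> x; exact: expR_ge0.
rewrite (@ge0_integral_increment k (fun x => expR (a * x))); last 2 first.
- by apply: measurableT_comp => //; exact: measurable_funM.
- by move=> x; exact: expR_ge0.
have sd0 : Num.sqrt delta != 0 by rewrite gt_eqF// sqrtr_gt0.
(* Completing the square turns the exponential weight into a shift of the Gaussian mean by
   [a * delta]. *)
transitivity (\int[lebesgue_measure]_x ((expR (a ^+ 2 * delta / 2))%:E *
    (normal_pdf (a * delta) (Num.sqrt delta) x)%:E))%E.
  apply: eq_integral => x _; rewrite -EFinM; congr EFin.
  rewrite !normal_pdfE// /normal_fun sqr_sqrtr ?ltW//.
  rewrite mulrCA [RHS]mulrCA -!expRD; congr (_ * expR _).
  by field; exact: lt0r_neq0.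
rewrite ge0_integralZl_EFin ?expR_ge0//.
- by rewrite integral_normal_pdf ?mule1.
- by move=> x _; rewrite lee_fin normal_pdf_ge0.
- by apply/measurable_EFinP; exact: measurable_normal_pdf.
Qed.

(** The increment is centred; this is stated for its two parts because [mean] only concerns
    nonnegative functions. It follows from the exponential moments: for a sign s, integrating 1 + a
    s x <= exp(a s x) bounds the mean of s x by (exp(a^2 delta / 2) - 1) / a, which tends to 0 with
    a. *)
Lemma mean_pos_increment k : exists e,
  mean P (X k) (fun x => Num.max x 0) e /\
  mean P (X k) (fun x => Num.max (- x) 0) e.
Proof.
have mX : measurable_fun setT (X k) by exact: measurable_funB.
have mpos : measurable_fun setT (fun x : R => Num.max x 0).
  exact: measurable_maxr.
have mneg : measurable_fun setT (fun x : R => Num.max (- x) 0).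
  by apply: measurable_maxr => //; exact: measurableT_comp.
have pos0 (x : R) : 0 <= Num.max x 0 by rewrite le_max lexx orbT.
have le_exp (x : R) : Num.max x 0 <= expR x.
  by rewrite ge_max expR_ge0 andbT (le_trans _ (expR_ge1Dx x))// lerDr.
have exists_mean (f : R -> R) (a : R) : measurable_fun setT f ->
    (forall x, 0 <= f x) -> (forall x, f x <= expR (a * x)) ->
    exists e, mean P (X k) f e.
  move=> mf f0 fe; exists (fine (\int[P]_w (f (X k w))%:E)%E); split=> //.
  rewrite fineK// ge0_fin_numE; last by apply: integral_ge0 => w _; rewrite lee_fin.
  have [me _ Ee] := mean_expR_increment k a.
  apply: (@le_lt_trans _ _ (\int[P]_w (expR (a * X k w))%:E)%E).
    apply: ge0_le_integral => //.
    - by move=> w _; rewrite lee_fin.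
    - by apply/measurable_EFinP; exact: measurableT_comp.
    - by apply/measurable_EFinP; exact: (measurableT_comp me mX).
    - by move=> w _; rewrite lee_fin.
  by rewrite Ee ltry.
have [e1 E1] : exists e, mean P (X k) (fun x => Num.max x 0) e.
  by apply: (exists_mean _ 1) => // x; rewrite mul1r.
have [e2 E2] : exists e, mean P (X k) (fun x => Num.max (- x) 0) e.
  by apply: (exists_mean _ (-1)) => // x; rewrite mulN1r.
(* [1 + a x <= exp (a x)] as [a] tends to 0. *)
have small (f g : R -> R) (e e' s a : R) : mean P (X k) f e -> mean P (X k) g e' ->
    s ^+ 2 = 1 -> (forall x, s * x = f x - g x) -> 0 < a -> a ^+ 2 * delta <= 1 ->
    e - e' <= a * delta.
  move=> [mf f0 Ef] [mg g0 Eg] s1 sx a0 aS.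
  have [me _ Ee] := mean_expR_increment k (a * s).
  have : (\int[P]_w (1 + a * f (X k w))%:E <=
          \int[P]_w (expR (a * s * X k w) + a * g (X k w))%:E)%E.
    apply: ge0_le_integral => //.
    - by move=> w _; rewrite lee_fin addr_ge0// mulr_ge0// ltW.
    - apply/measurable_EFinP; apply: measurable_funD => //.
      by apply: measurable_funM => //; exact: measurableT_comp.
    - apply/measurable_EFinP; apply: measurable_funD => //.
        exact: (measurableT_comp me mX).
      by apply: measurable_funM => //; exact: measurableT_comp.
    - move=> w _; rewrite lee_fin -lerBlDr -addrA -mulrBr -sx mulrA.
      exact: expR_ge1Dx.
  under eq_integral do rewrite EFinD.
  under [in leRHS]eq_integral do rewrite EFinD.
  rewrite !ge0_integralD//; first last.
  - by apply/measurable_EFinP; apply: measurable_funM => //; exact: measurableT_comp.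
  - by move=> w _; rewrite lee_fin mulr_ge0// ltW.
  - by apply/measurable_EFinP; apply: measurable_funM => //; exact: measurableT_comp.
  - by move=> w _; rewrite lee_fin mulr_ge0// ltW.
  - by apply/measurable_EFinP; exact: (measurableT_comp me mX).
  have lin (h : R -> R) : measurable_fun setT h -> (forall x, 0 <= h x) ->
      (\int[P]_w (a * h (X k w))%:E = a%:E * \int[P]_w (h (X k w))%:E)%E.
    move=> mh h0; rewrite -ge0_integralZl_EFin//; last exact: ltW.
    - by move=> w _; rewrite lee_fin.
    - by apply/measurable_EFinP; exact: measurableT_comp.
  rewrite !lin//.
  rewrite integral_cst// mul1e Ef Eg Ee [X in (X + _ <= _)%E]probability_setT.
  rewrite -!EFinM -!EFinD lee_fin exprMn s1 mulr1 => h.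
  set y := a ^+ 2 * delta / 2.
  have y0 : 0 <= y by rewrite /y divr_ge0// mulr_ge0 ?sqr_ge0 ?ltW.
  have y1 : y <= 2^-1 by rewrite /y ler_piMl.
  have ey : expR y <= 1 + 2 * y.
    have := expR_ge1Dx (- y); rewrite expRN => hy.
    have ep := expR_gt0 y.
    have : (1 - y) * expR y <= 1 by rewrite -ler_pdivlMr// div1r.
    by move: y1; set E := expR y in ep *; nra.
  rewrite -(ler_pM2l a0) (le_trans (y := expR y - 1))//.
    by move: h; rewrite -/y; lra.
  by move: ey; rewrite /y; lra.
have eq12 (f g : R -> R) (e e' s : R) : mean P (X k) f e -> mean P (X k) g e' ->
    s ^+ 2 = 1 -> (forall x, s * x = f x - g x) -> e <= e'.
  move=> Ef Eg s1 sx; rewrite leNgt; apply/negP => ee'.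
  have D0 : 0 < e - e' by rewrite subr_gt0.
  (* Small enough for [a ^+ 2 * delta <= 1] and for [a * delta] to be at most half of the supposed
     gap. *)
  pose a := Num.min ((e - e') / (2 * delta)) (1 + delta)^-1.
  have a0 : 0 < a.
    by rewrite lt_min divr_gt0 ?mulr_gt0//= invr_gt0 addr_gt0.
  have a1 : a * (1 + delta) <= 1.
    by rewrite -ler_pdivlMr ?addr_gt0// div1r ge_min lexx orbT.
  have := small f g e e' s a Ef Eg s1 sx a0 _.
  have aD : a * delta <= (e - e') / 2.
    rewrite -ler_pdivlMr// -mulrA -invfM ge_min.
    by rewrite lexx.
  have : a ^+ 2 * delta <= 1.
    by rewrite expr2; move: a0 a1 delta0; nra.
  by move=> h /(_ h); lra.
have maxN (x : R) : x = Num.max x 0 - Num.max (- x) 0.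
  by case: (lerP 0 x) => x0; [rewrite max_r ?oppr_le0// subr0|
     rewrite max_l ?opprK ?add0r// oppr_ge0 ltW].
exists e1; split => //.
suff -> : e1 = e2 by [].
apply/eqP; rewrite eq_le; apply/andP; split.
  by apply: (eq12 _ _ _ _ 1 E1 E2); rewrite ?expr1n// => x; rewrite mul1r {1}(maxN x).
by apply: (eq12 _ _ _ _ (-1) E2 E1); rewrite ?sqrrN ?expr1n// => x;
  rewrite mulN1r {1}(maxN x) opprB.
Qed.

End laws.

Section jump_laws.
Context d (T : measurableType d) (R : realType) (P : probability T R).
Variables (arm : bool -> levy_arm R) (p0 : R) (theta : {RV P >-> bool})
  (Z : R -> {RV P >-> R}) (N : bool -> R -> {RV P >-> nat})
  (J : bool -> nat -> {RV P >-> R}).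
Hypothesis model : bandit_model arm p0 theta Z N J.
Variables (i : bool) (delta : R).
Hypothesis delta0 : 0 < delta.
Local Notation lam := (levy_mass (arm i)).

Lemma levy_massE : levy (arm i) setT = lam%:E.
Proof. by rewrite fineK// fin_num_measure. Qed.

(** Writing [lam * e m = Phi] rather than a quotient includes the arm without jumps, whose marks are
    set to 0. *)
Lemma mean_mark (phi : R -> R) (Phi : R) :
  measurable_fun setT phi -> (forall x, 0 <= phi x) ->
  (\int[levy (arm i)]_x (phi x)%:E = Phi%:E)%E ->
  exists e : nat -> R, (forall m, mean P (mark arm J i m) phi (e m)) /\
    forall m, lam * e m = Phi.
Proof.
move=> mphi phi0 EPhi; have [lam0|lamn0] := eqVneq lam 0.
  exists (fun=> phi 0); split => m.
    split => //; rewrite /mark lam0 eqxx integral_cst//.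
    by rewrite [X in (_ * X)%E]probability_setT mule1.
  rewrite lam0 mul0r; apply: EFin_inj; rewrite -EPhi.
  apply/esym/null_set_integral => //; last by apply: (eq_trans levy_massE); rewrite lam0.
  exact/measurable_EFinP.
exists (fun=> Phi / lam); split => m; last by rewrite mulrC divfK.
split => //; rewrite /mark (negbTE lamn0).
have lam_ge0 : 0 <= lam by exact: levy_mass_ge0.
have mJ : measurable_fun setT (J i m) by [].
have := @ge0_integral_transfer _ _ _ _ _ P (levy (arm i)) (J i m) (fun=> 1) lam^-1
  mJ _ _ _ _ phi mphi phi0.
rewrite EPhi -EFinM mulrC => <-//.
- by apply: eq_integral => w _; rewrite mulr1.
- by rewrite invr_ge0.
move=> E mE; have [_ _ /(_ i)[_ /(_ m E mE) EJ] _] := model.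
transitivity ((lam^-1)%:E * (lam%:E * P (J i m @^-1` E)))%E; last first.
  by congr (_ * _)%E; rewrite -levy_massE; exact: EJ.
rewrite muleA -EFinM mulVf// mul1e.
have mJE : measurable (J i m @^-1` E) by exact: measurable_funPTI.
rewrite -[X in _ = P X]setIT -integral_indic//.
by apply: eq_integral => w _; rewrite mulr1 !indicE.
Qed.

Lemma count_pmf_lam0 j : lam = 0 -> count_pmf arm i delta j = (j == 0)%:R.
Proof.
move=> lam0; rewrite /count_pmf /poisson_prob lam0 mul0r ltxx.
rewrite /dirac indicE; case: j => [|j] /=; first by rewrite mem_set.
by rewrite memNset.
Qed.

Lemma count_pmf_gt0 j : lam != 0 -> count_pmf arm i delta j =
  expR (- (lam * delta)) * ((lam * delta) ^+ j / j`!%:R).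
Proof.
move=> lam0; have rho0 : 0 < lam * delta.
  by rewrite mulr_gt0// lt_neqAle eq_sym lam0 levy_mass_ge0.
rewrite /count_pmf /poisson_prob rho0 esum_set1 ?lee_fin ?poisson_pmf_ge0//=.
by rewrite /poisson_pmf rho0 mulrC.
Qed.

(** The generating function of the Poisson law at [Phi / lam], the mean of [phi] over one mark. *)
Lemma count_pmf_prod (ephi : nat -> R) (Phi : R) (n : nat) :
  (forall m, lam * ephi m = Phi) -> (forall m, 0 <= ephi m) ->
  (\sum_(j <oo) (count_pmf arm i delta j * \prod_(m < j) ephi (n + m)%N)%:E
  = (expR (delta * (Phi - lam)))%:E)%E.
Proof.
move=> HPhi ephi0; have [lam0|lamn0] := eqVneq lam 0.
  have Phi0 : Phi = 0 by rewrite -(HPhi 0%N) lam0 mul0r.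
  rewrite Phi0 lam0 subr0 mulr0 expR0.
  under eq_eseriesr do rewrite (count_pmf_lam0 _ lam0) eq_sym.
  by rewrite series_pick ?big_ord0// => j; exact: prodr_ge0.
have lam_ge0 : 0 <= lam by exact: levy_mass_ge0.
have Phi0 : 0 <= Phi by rewrite -(HPhi 0%N) mulr_ge0.
have E m : ephi m = Phi / lam by rewrite -(HPhi m) mulrAC divff ?mul1r.
transitivity (\sum_(j <oo) ((expR (- (lam * delta)))%:E *
    ((delta * Phi) ^+ j / j`!%:R)%:E))%E.
  apply: eq_eseriesr => j _; rewrite (count_pmf_gt0 _ lamn0) -EFinM; congr EFin.
  rewrite -mulrA; congr (_ * _); rewrite mulrAC; congr (_ / _).
  under eq_bigr do rewrite E.
  rewrite prodr_const card_ord -exprMn; congr (_ ^+ _).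
  by field.
rewrite nneseriesZl; last first.
  by move=> j _; rewrite lee_fin divr_ge0// exprn_ge0// mulr_ge0// ltW.
rewrite expR_series ?mulr_ge0 ?(ltW delta0)// -EFinM -expRD.
by congr (expR _)%:E; ring.
Qed.

Lemma count_pmf_sum (ephi : nat -> R) (Phi : R) (n : nat) :
  (forall m, lam * ephi m = Phi) -> (forall m, 0 <= ephi m) ->
  (\sum_(j <oo) (count_pmf arm i delta j * \sum_(m < j) ephi (n + m)%N)%:E
  = (delta * Phi)%:E)%E.
Proof.
move=> HPhi ephi0; have [lam0|lamn0] := eqVneq lam 0.
  have Phi0 : Phi = 0 by rewrite -(HPhi 0%N) lam0 mul0r.
  rewrite Phi0 mulr0.
  under eq_eseriesr do rewrite (count_pmf_lam0 _ lam0) eq_sym.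
  by rewrite series_pick ?big_ord0// => j; exact: sumr_ge0.
have lam_ge0 : 0 <= lam by exact: levy_mass_ge0.
have Phi0 : 0 <= Phi by rewrite -(HPhi 0%N) mulr_ge0.
have E m : ephi m = Phi / lam by rewrite -(HPhi m) mulrAC divff ?mul1r.
have d0 := ltW delta0.
rewrite nneseries_recl//; last first.
  by move=> j; rewrite lee_fin mulr_ge0 ?sumr_ge0// fine_ge0.
rewrite big_ord0 mulr0 add0e.
transitivity (\sum_(j <oo) ((expR (- (lam * delta)) * (delta * Phi))%:E *
    ((lam * delta) ^+ j / j`!%:R)%:E))%E.
  rewrite -nneseries_addn; last first.
    by move=> j; rewrite lee_fin mulr_ge0 ?sumr_ge0// fine_ge0.
  apply: eq_eseriesr => j _; rewrite addn1 (count_pmf_gt0 _ lamn0) -EFinM; congr EFin.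
  under eq_bigr do rewrite E.
  rewrite sumr_const card_ord exprSr factS natrM -mulr_natr; field.
  by rewrite lamn0 pnatr_eq0 -lt0n fact_gt0 addrC natr1 pnatr_eq0.
rewrite nneseriesZl; last first.
  by move=> j _; rewrite lee_fin divr_ge0// exprn_ge0// mulr_ge0.
by rewrite expR_series ?mulr_ge0// -EFinM mulrAC -expRD addNr expR0 mul1r.
Qed.

End jump_laws.

(** * Discounted Stieltjes integrals *)

Section discount.
Context (R : realType) (r : R).
Hypothesis r0 : 0 < r.

Definition discount_density (t : R) : R := r * expR (- r * t).

Lemma expRN_ler (u v : R) : u <= v -> expR (- r * v) <= expR (- r * u).
Proof. by move=> uv; rewrite ler_expR !mulNr lerN2 ler_pM2l. Qed.

Lemma expRN_le1 (u : R) : 0 <= u -> expR (- r * u) <= 1.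
Proof. by move=> u0; rewrite expR_le1 mulNr oppr_le0 mulr_ge0// ltW. Qed.

Lemma expRN_diff_ge (u v : R) :
  discount_density v * (v - u) <= expR (- r * u) - expR (- r * v).
Proof.
have -> : expR (- r * u) = expR (- r * v) * expR (r * (v - u)).
  by rewrite -expRD; congr expR; ring.
have := expR_ge1Dx (r * (v - u)); have := expR_gt0 (- r * v).
rewrite /discount_density; set a := expR (- r * v); set b := expR _ => a0 h.
rewrite -subr_ge0 (_ : _ - _ = a * (b - (1 + r * (v - u)))); last by ring.
by rewrite mulr_ge0 ?subr_ge0// ltW.
Qed.

Lemma expRN_diff_le (u v : R) :
  expR (- r * u) - expR (- r * v) <= discount_density u * (v - u).
Proof. by have := expRN_diff_ge v u; lra. Qed.

Lemma discount_density_ge0 t : 0 <= discount_density t.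
Proof. by rewrite mulr_ge0 ?expR_ge0// ltW. Qed.

Lemma discount_density_ler (u v : R) : u <= v ->
  discount_density v <= discount_density u.
Proof. by move=> uv; rewrite ler_pM2l// expRN_ler. Qed.

Lemma discount_density_le (u : R) : 0 <= u -> discount_density u <= r.
Proof. by move=> u0; rewrite ger_pMr// expRN_le1. Qed.

Lemma discount_density_lip (u v : R) : 0 <= u -> u <= v ->
  discount_density u - discount_density v <= r ^+ 2 * (v - u).
Proof.
move=> u0 uv; rewrite -mulrBr expr2 -mulrA ler_pM2l//.
apply: (le_trans (expRN_diff_le u v)).
by rewrite ler_wpM2r ?subr_ge0// discount_density_le.
Qed.

(* I behaves locally as the integral of the discount density against Y; V     *)
(* controls the error.                                                        *)
Definition stieltjes_primitive (Y I : R -> R) : Prop :=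
  exists2 V : R -> R, (forall u v, 0 <= u -> u <= v -> V u <= V v) &
  forall B e : R, 0 < e -> exists2 delta : R, 0 < delta &
    forall u w v c, 0 <= u -> u <= w -> w <= v -> v <= B -> u <= c -> c <= v ->
      v - u < delta ->
      `| I w - I u - discount_density c * (Y w - Y u) | <= e * (V v - V u).

Lemma primitive_sum (Y I V : R -> R) (B e delta : R) :
  (forall u w v c, 0 <= u -> u <= w -> w <= v -> v <= B -> u <= c -> c <= v ->
      v - u < delta ->
      `| I w - I u - discount_density c * (Y w - Y u) | <= e * (V v - V u)) ->
  forall (m : nat) (t c : nat -> R), 0 <= t 0%N -> t m <= B ->
    (forall k, (k < m)%N -> [/\ t k <= c k, c k <= t k.+1 & t k.+1 - t k < delta]) ->
  `| \sum_(k < m) discount_density (c k) * (Y (t k.+1) - Y (t k))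
     - (I (t m) - I (t 0%N)) | <= e * (V (t m) - V (t 0%N)).
Proof.
move=> H m t c t0 tB Hk.
have homo_t k : (k < m)%N -> t k <= t k.+1.
  by move=> /Hk[h1 h2 _]; exact: le_trans h2.
have t_ge0 k : (k <= m)%N -> 0 <= t k.
  elim: k => // k IH km; apply: le_trans (homo_t k km).
  by apply: IH; exact: ltnW.
have t_leB_add j k : (k + j)%N = m -> t k <= B.
  elim: j k => [|j IH] k; first by rewrite addn0 => ->.
  rewrite addnS => km; apply: (le_trans (homo_t k _)).
    by rewrite -km ltnS leq_addr.
  by apply: IH; rewrite addSn.
have t_leB k : (k <= m)%N -> t k <= B.
  by move=> km; apply: (t_leB_add (m - k)%N); rewrite subnKC.
have {}H k : (k < m)%N -> `|I (t k.+1) - I (t k)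
    - discount_density (c k) * (Y (t k.+1) - Y (t k))| <= e * (V (t k.+1) - V (t k)).
  move=> km; have [h1 h2 h3] := Hk _ km.
  apply: H => //; [by apply: t_ge0; exact: ltnW|exact: homo_t|exact: t_leB].
elim: m {tB Hk homo_t t_ge0 t_leB_add t_leB} H => [|m IH] H.
  by rewrite big_ord0 !subrr normr0 mulr0.
rewrite big_ord_recr /=.
have h1 := IH (fun k km => H k (ltnW km)).
have h2 := H m (ltnSn m).
rewrite (_ : _ - _ = (\sum_(k < m) discount_density (c k) * (Y (t k.+1) - Y (t k))
   - (I (t m) - I (t 0%N))) - (I (t m.+1) - I (t m) -
   discount_density (c m) * (Y (t m.+1) - Y (t m)))); last by ring.
apply: (le_trans (ler_normB _ _)).
rewrite (_ : e * _ = e * (V (t m) - V (t 0%N)) + e * (V (t m.+1) - V (t m))).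
  exact: lerD.
by ring.
Qed.

Lemma primitive_stieltjes (Y I : R -> R) (b : R) : stieltjes_primitive Y I -> 0 <= b ->
  is_stieltjes_integral (fun t => r * expR (- r * t)) Y 0 b (I b - I 0).
Proof.
move=> [V ndV H] b0 e e0.
have D0 : 0 < V b - V 0 + 1 by rewrite ltr_wpDl// subr_ge0 ndV.
have e'0 : 0 < e / (V b - V 0 + 1) by rewrite divr_gt0.
have [delta delta0 {}H] := H b _ e'0.
exists delta => // m t c t0 tm Hk.
have := primitive_sum H (m := m) (t := t) (c := c).
rewrite t0 tm => /(_ (lexx _) (lexx _) Hk) h; apply: (le_lt_trans h).
by rewrite mulrAC ltr_pdivrMr// ltr_pM2l// ltrDl.
Qed.

Lemma primitive_lin (Y1 I1 Y2 I2 : R -> R) (a1 a2 : R) :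
  stieltjes_primitive Y1 I1 -> stieltjes_primitive Y2 I2 ->
  stieltjes_primitive (fun t => a1 * Y1 t + a2 * Y2 t)
    (fun t => a1 * I1 t + a2 * I2 t).
Proof.
move=> [V1 nd1 H1] [V2 nd2 H2].
exists (fun t => `|a1| * V1 t + `|a2| * V2 t).
  by move=> u v u0 uv; rewrite lerD// ler_wpM2l// (nd1, nd2).
move=> B e e0; have [d1 d10 {}H1] := H1 B e e0; have [d2 d20 {}H2] := H2 B e e0.
exists (Num.min d1 d2); first by rewrite lt_min d10.
move=> u w v c u0 uw wv vB uc cv; rewrite lt_min => /andP[vd1 vd2].
have {}H1 := H1 u w v c u0 uw wv vB uc cv vd1.
have {}H2 := H2 u w v c u0 uw wv vB uc cv vd2.
rewrite (_ : _ - _ = a1 * (I1 w - I1 u - discount_density c * (Y1 w - Y1 u)) +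
  a2 * (I2 w - I2 u - discount_density c * (Y2 w - Y2 u))); last by ring.
apply: (le_trans (ler_normD _ _)); rewrite !normrM.
apply: (le_trans (lerD (ler_wpM2l (normr_ge0 a1) H1) (ler_wpM2l (normr_ge0 a2) H2))).
by rewrite le_eqVlt; apply/orP; left; apply/eqP; ring.
Qed.

Definition stop (tau : \bar R) (t : R) : R := fine (mine t%:E tau).

Lemma stopE tau t : (0 <= tau)%E -> (stop tau t)%:E = mine t%:E tau.
Proof.
rewrite /stop; case: tau => [x|_|//].
  by move=> _; rewrite -EFin_min.
by rewrite min_l ?leey.
Qed.

Lemma stop_id tau t : (t%:E <= tau)%E -> stop tau t = t.
Proof. by move=> h; rewrite /stop min_l. Qed.

Lemma stop_ge tau t x : tau = x%:E -> x <= t -> stop tau t = x.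
Proof. by move=> -> h; rewrite /stop min_r. Qed.

Lemma stop_ge0 tau t : (0 <= tau)%E -> 0 <= t -> 0 <= stop tau t.
Proof. by move=> tau0 t0; rewrite -lee_fin stopE// le_min tau0 lee_fin t0. Qed.

Lemma stop_le tau t : (0 <= tau)%E -> stop tau t <= t.
Proof. by move=> tau0; rewrite -lee_fin stopE// ge_min lexx. Qed.

(** After stopping, the increment over [u, w] becomes the one over [u, min(w, tau)], while the mesh
    and the sample point still refer to [u, v]. This is why [stieltjes_primitive] keeps w and v
    apart. *)
Lemma primitive_stop (Y I : R -> R) (tau : \bar R) : (0 <= tau)%E ->
  stieltjes_primitive Y I ->
  stieltjes_primitive (fun t => Y (stop tau t)) (fun t => I (stop tau t)).
Proof.
move=> tau0 [V ndV H]; exists V => // B e e0.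
have [delta delta0 {}H] := H B e e0; exists delta => // u w v c u0 uw wv vB uc cv vd.
have uv := le_trans uw wv.
have [tu|ut] := leP tau u%:E.
  case: tau tau0 tu => [x|//|//] x0 xu.
  rewrite (@stop_ge x%:E w x)//; last by rewrite (le_trans _ uw).
  rewrite (@stop_ge x%:E u x)// !subrr mulr0 subr0 normr0.
  by rewrite mulr_ge0// ?(ltW e0)// subr_ge0 ndV.
rewrite (stop_id (ltW ut)) /=; apply: H => //.
  by rewrite -lee_fin stopE// le_min lee_fin uw ltW.
by rewrite (le_trans _ wv)// stop_le.
Qed.

Lemma primitive_id : stieltjes_primitive (fun t => t) (fun t => 1 - expR (- r * t)).
Proof.
exists id => // B e e0.
have r20 : 0 < r ^+ 2 by rewrite exprn_gt0.
(* On nonnegative times the discount density is Lipschitz with constant [r ^+ 2]. *)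
exists (e / r ^+ 2); first by rewrite divr_gt0.
move=> u w v c u0 uw wv vB uc cv; rewrite ltr_pdivlMr// => vd.
have h1 := expRN_diff_le u w.
have h2 := expRN_diff_ge u w.
have uv := le_trans uw wv.
have h3 := discount_density_lip u0 uv.
have h4 := discount_density_ler uc; have h5 := discount_density_ler cv.
have h6 := discount_density_ler wv.
have wu : 0 <= w - u by rewrite subr_ge0.
have wvu : w - u <= v - u by rewrite lerB.
have k1 : discount_density v * (w - u) <= discount_density c * (w - u).
  by rewrite ler_wpM2r.
have k2 : discount_density c * (w - u) <= discount_density u * (w - u).
  by rewrite ler_wpM2r.
have k3 : discount_density v * (w - u) <= discount_density w * (w - u).
  by rewrite ler_wpM2r.
have k4 : (discount_density u - discount_density v) * (w - u) <= e * (v - u).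
  apply: ler_pM => //; last by lra.
  by rewrite subr_ge0 discount_density_ler.
rewrite ler_norml /=; apply/andP; split; lra.
Qed.

End discount.

(** * Integration by parts against the discount density *)

Section by_parts.
Context (R : realType) (r : R).
Hypothesis r0 : 0 < r.
Local Notation mu := lebesgue_measure.
Local Notation f := (discount_density r).

Let continuous_f : continuous f.
Proof.
move=> x; apply: cvgM; first exact: cvg_cst.
apply: continuous_comp; last exact: continuous_expR.
by apply: cvgM; [exact: cvg_cst|exact: cvg_id].
Qed.

Let measurable_f : measurable_fun setT f.
Proof. exact: continuous_measurable_fun. Qed.

Let itv_lty b1 b2 (u v : R) :
  (mu [set` Interval (BSide b1 u) (BSide b2 v)] < +oo)%E.
Proof. by rewrite lebesgue_measure_itv /=; case: ifP => // _; rewrite ltry. Qed.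

Let bounded_integrable (u v : R) (Y : R -> R) (M : R) : measurable_fun `[u, v] Y ->
  (forall t, u <= t <= v -> `|Y t| <= M) ->
  mu.-integrable `[u, v] (EFin \o Y).
Proof.
move=> mY YM; apply: measurable_bounded_integrable => //.
  exact: itv_lty.
exists M; split; [exact: num_real|move=> x Mx y /=]; rewrite in_itv /= => /YM h.
by rewrite (le_trans h)// ltW.
Qed.

Lemma Rintegral_discount_density (x : R) : 0 <= x ->
  \int[mu]_(t in `[0, x]) f t = 1 - expR (- r * x).
Proof.
rewrite le_eqVlt => /predU1P[<-|x0].
  by rewrite mulr0 expR0 subrr set_itv1 Rintegral_set1.
rewrite /Rintegral; have := @exponential_prob_itv0c R r x x0.
rewrite /exponential_prob => E.
transitivity (fine (1 - (expR (- r * x))%:E)%E); last by [].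
rewrite -E; congr fine; apply: eq_integral => t.
by rewrite inE /= in_itv /= => /andP[t0 _]; rewrite exponential_pdfE.
Qed.

Variables (Y V : R -> R).
Hypotheses (mY : forall B : R, measurable_fun `[0, B] Y)
  (bY : forall B : R, exists M : R, forall t, 0 <= t <= B -> `|Y t| <= M).

(** Since f' = - r f, integration by parts gives the integral of f against Y over [0, b] as the
    difference of this function at b and at 0. It makes sense for Brownian paths, which have
    unbounded variation. *)
Definition by_parts (b : R) : R := f b * Y b + r * \int[mu]_(t in `[0, b]) (f t * Y t).

Let integrable_fY (B : R) : mu.-integrable `[0, B] (EFin \o (fun t => f t * Y t)).
Proof.
have [M HM] := bY B; apply: (@bounded_integrable _ _ _ (r * M)).
  by apply: measurable_funM => //; exact: measurable_funTS.
move=> t tB; have t0 : 0 <= t by case/andP: tB.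
rewrite normrM ger0_norm ?discount_density_ge0//.
by rewrite ler_pM ?discount_density_ge0// ?discount_density_le ?HM.
Qed.

Let integrable_f (B : R) : mu.-integrable `[0, B] (EFin \o f).
Proof.
apply: (@bounded_integrable _ _ _ r); first exact: measurable_funTS.
move=> t /andP[t0 _].
by rewrite ger0_norm ?discount_density_ge0// discount_density_le.
Qed.

Let Rintegral_oc (g : R -> R) (u w : R) : 0 <= u -> u <= w ->
  mu.-integrable `[0, w] (EFin \o g) ->
  \int[mu]_(t in `[0, w]) g t - \int[mu]_(t in `[0, u]) g t =
  \int[mu]_(t in `]u, w]) g t.
Proof. by move=> u0 uw ig; rewrite Rintegral_itvB// bnd_simp. Qed.

Lemma by_parts_diff (u w : R) : 0 <= u -> u <= w ->
  by_parts w - by_parts u = f w * (Y w - Y u)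
    + r * \int[mu]_(t in `]u, w]) (f t * (Y t - Y u)).
Proof.
move=> u0 uw; have w0 := le_trans u0 uw.
have sub : `]u, w]%classic `<=` `[0, w]%classic.
  by apply: subset_itvr; rewrite bnd_simp.
have i1 : mu.-integrable `]u, w] (EFin \o (fun t => f t * Y t)).
  exact: integrableS (integrable_fY w).
have i2 : mu.-integrable `]u, w] (EFin \o f).
  exact: integrableS (integrable_f w).
have i3 : mu.-integrable `]u, w] (EFin \o (fun t => f t * Y u)).
  rewrite (_ : EFin \o _ = (fun t => (Y u)%:E * (EFin \o f) t)%E).
    exact: integrableZl.
  by apply/funext => t /=; rewrite -EFinM mulrC.
have -> : \int[mu]_(t in `]u, w]) (f t * (Y t - Y u)) =
    \int[mu]_(t in `]u, w]) (f t * Y t) - Y u * \int[mu]_(t in `]u, w]) f t.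
  rewrite -RintegralZl//.
  under [in X in _ - X]eq_Rintegral do rewrite mulrC.
  rewrite -RintegralB//; apply: eq_Rintegral => t _; ring.
rewrite -!Rintegral_oc// !Rintegral_discount_density// /by_parts.
rewrite /discount_density; ring.
Qed.

Let integral_bound (u w M : R) : 0 <= u -> u <= w -> 0 <= M ->
  (forall t, u <= t <= w -> `|Y t - Y u| <= M) ->
  `|\int[mu]_(t in `]u, w]) (f t * (Y t - Y u))| <= f u * M * (w - u).
Proof.
move=> u0 uw M0 HM.
have sub : `]u, w]%classic `<=` `[0, w]%classic.
  by apply: subset_itvr; rewrite bnd_simp.
have mh : measurable_fun `]u, w] (fun t => f t * (Y t - Y u)).
  apply: measurable_funM; first exact: measurable_funTS.
  by apply: measurable_funB => //; apply: (measurable_funS _ sub (@mY w)).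
have hM t : u <= t <= w -> `|f t * (Y t - Y u)| <= f u * M.
  move=> utw; have t0 : 0 <= t by rewrite (le_trans u0)//; case/andP: utw.
  rewrite normrM ger0_norm ?discount_density_ge0// ler_pM ?discount_density_ge0 ?HM//.
  by apply: discount_density_ler => //; case/andP: utw.
have fin_uw : (mu `]u, w] < +oo)%E by exact: itv_lty.
have ih : mu.-integrable `]u, w] (EFin \o (fun t => f t * (Y t - Y u))).
  apply: measurable_bounded_integrable => //.
  exists (f u * M); split; [exact: num_real|move=> x Mx t /=]; rewrite in_itv /= => /andP[ut tw].
  by rewrite (le_trans (hM _ _)) ?(ltW ut)// ltW.
apply: (le_trans (le_normr_Rintegral _ _)) => //.
apply: (@le_trans _ _ (\int[mu]_(t in `]u, w]) (f u * M))).
  apply: le_Rintegral => //.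
  - rewrite (_ : EFin \o _ = (abse \o (EFin \o (fun t => f t * (Y t - Y u)))))//.
    exact: integrable_abse.
  - apply: measurable_bounded_integrable => //.
    exists `|f u * M|; split; first exact: num_real.
    by move=> x Mx t _ /=; rewrite ltW.
  - move=> t; rewrite /= in_itv /= => /andP[ut tw].
    by rewrite hM// (ltW ut).
have Emu : fine (mu `]u, w]) = w - u.
  rewrite lebesgue_measure_itv /= lte_fin; case: ltP => //= wu.
  by apply/esym/eqP; rewrite subr_eq0 eq_le uw wu.
apply: (@le_trans _ _ (f u * M * fine (mu `]u, w]))); last by rewrite Emu.
by rewrite Rintegral_cst.
Qed.

Hypothesis ndV : forall u v, 0 <= u -> u <= v -> V u <= V v.
Hypothesis control : forall B e : R, 0 < e -> exists2 delta : R, 0 < delta &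
  forall u v, 0 <= u -> u <= v -> v <= B -> v - u < delta ->
    `|Y v - Y u| <= e + (V v - V u).

(** By [control], the oscillation of [Y] on a short interval is a small term plus the increase of
    [V]. The error on the interval consists of a change of f times an increment of [Y] and of an
    integral of [Y t - Y u], both of order (v - u) times the oscillation. *)
Lemma by_parts_primitive : stieltjes_primitive r Y by_parts.
Proof.
exists (fun t => t + V t); first by move=> u v u0 uv; rewrite lerD// ndV.
move=> B e e0; have r2 : 0 < 2 * r ^+ 2 by rewrite mulr_gt0// exprn_gt0.
have e'0 : 0 < e / (2 * r ^+ 2) by rewrite divr_gt0.
have [delta delta0 H] := control B e'0.
(* The same bound [e / (2 * r ^+ 2)] is imposed on the small part of the oscillation and on the
   mesh: the first pays for [e * (v - u)], the second for [e * (V v - V u)]. *)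
exists (Num.min delta (e / (2 * r ^+ 2))); first by rewrite lt_min delta0.
move=> u w v c u0 uw wv vB uc cv; rewrite lt_min => /andP[vd ve].
have uv := le_trans uw wv.
set osc := e / (2 * r ^+ 2) + (V v - V u).
have osc_ge t : u <= t <= w -> `|Y t - Y u| <= osc.
  move=> /andP[ut tw]; apply: (le_trans (H u t u0 ut _ _)).
  - exact: le_trans tw (le_trans wv vB).
  - by apply: le_lt_trans vd; rewrite lerB// (le_trans tw).
  - by rewrite lerD2l lerB// ndV ?(le_trans u0)// (le_trans tw).
have osc0 : 0 <= osc by rewrite addr_ge0 ?subr_ge0 ?ndV// ltW.
rewrite by_parts_diff// (_ : _ - _ = (f w - f c) * (Y w - Y u) +
  r * \int[mu]_(t in `]u, w]) (f t * (Y t - Y u))); last by ring.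
apply: (@le_trans _ _ (r ^+ 2 * (v - u) * osc + r * (r * osc * (v - u)))).
  apply: (le_trans (ler_normD _ _)); apply: lerD.
    rewrite normrM ler_pM ?osc_ge ?uw ?lexx//.
    have luv := discount_density_lip r0 u0 uv.
    have h1 := discount_density_ler r0 uc; have h2 := discount_density_ler r0 cv.
    have h3 := discount_density_ler r0 uw; have h4 := discount_density_ler r0 wv.
    by rewrite ler_norml; apply/andP; split; lra.
  rewrite normrM (gtr0_norm r0) ler_pM2l//.
  apply: (le_trans (integral_bound u0 uw osc0 osc_ge)).
  apply: ler_pM.
  - by rewrite mulr_ge0// discount_density_ge0.
  - by rewrite subr_ge0.
  - by rewrite ler_wpM2r// discount_density_le.
  - by rewrite lerB.
have -> : r ^+ 2 * (v - u) * osc + r * (r * osc * (v - u)) =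
   e * (v - u) + 2 * r ^+ 2 * (v - u) * (V v - V u).
  by rewrite /osc; field; rewrite gt_eqF.
rewrite [leRHS](_ : _ = e * (v - u) + e * (V v - V u)); last by ring.
rewrite lerD2l ler_wpM2r ?subr_ge0 ?ndV//.
by rewrite mulrC -ler_pdivlMr// ltW.
Qed.

(** On an interval of length at most 1 the discounted integral varies by at most a constant times
    the discount times the supremum of the path; summed over unit intervals this gives convergence
    at infinity. *)
Lemma by_parts_variation (u v M : R) : 0 <= u -> u <= v -> v - u <= 1 -> 0 <= M ->
  (forall t, u <= t <= v -> `|Y t| <= M) ->
  `|by_parts v - by_parts u| <= f u * (2 + 2 * r) * M.
Proof.
move=> u0 uv vu M0 HM; rewrite by_parts_diff//.
have hd t : u <= t <= v -> `|Y t - Y u| <= 2 * M.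
  move=> utv; apply: (le_trans (ler_normB _ _)).
  by rewrite mulr_natl mulr2n lerD ?HM ?lexx.
rewrite [leRHS](_ : _ = f u * (2 * M) + r * (f u * (2 * M) * 1)); last by ring.
apply: (le_trans (ler_normD _ _)); apply: lerD.
  rewrite normrM ger0_norm ?discount_density_ge0// ler_pM ?discount_density_ge0//.
    exact: discount_density_ler.
  by rewrite hd// uv lexx.
rewrite normrM (gtr0_norm r0) ler_pM2l//.
apply: (le_trans (integral_bound u0 uv _ hd)); first by rewrite mulr_ge0.
apply: ler_wpM2l => //; apply: mulr_ge0; first exact: discount_density_ge0.
exact: mulr_ge0.
Qed.

End by_parts.

Section summable_variation.
Context (R : realType) (I : R -> R) (a : nat -> R) (A : R).
Hypotheses (a0 : forall k, 0 <= a k) (aA : forall n, \sum_(0 <= k < n) a k <= A).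
Hypothesis Ia : forall k u v, k%:R <= u -> u <= v -> v <= k.+1%:R ->
  `|I v - I u| <= a k.

Lemma variation_le_sum (m n : nat) (u v : R) : m%:R <= u -> u <= v -> v <= n%:R ->
  `|I v - I u| <= \sum_(m <= k < n) a k.
Proof.
elim: n u v => [|n IH] u v mu uv vn.
  have -> : v = u.
    apply/eqP; rewrite eq_le uv andbT (le_trans vn)// (le_trans _ mu)//.
  by rewrite subrr normr0 sumr_ge0.
have [mn|nm] := leqP m n; last first.
  have -> : v = u.
    apply/eqP; rewrite eq_le uv andbT (le_trans vn)// (le_trans _ mu)//.
    by rewrite ler_nat.
  by rewrite subrr normr0 sumr_ge0.
rewrite big_nat_recr//=.
have [vn'|vn'] := leP v n%:R.
  by apply: (le_trans (IH u v mu uv vn')); rewrite lerDl.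
have [un'|un'] := leP u n%:R; last first.
  by apply: (le_trans (Ia (ltW un') uv vn)); rewrite lerDr sumr_ge0.
rewrite (_ : I v - I u = (I n%:R - I u) + (I v - I n%:R)); last by ring.
apply: (le_trans (ler_normD _ _)); apply: lerD; first exact: IH.
by apply: Ia => //; exact: ltW.
Qed.

Lemma variation_bound (b : R) : 0 <= b -> `|I b - I 0| <= A.
Proof.
move=> b0; apply: le_trans (aA (Num.bound b)).
apply: variation_le_sum => //.
exact/ltW/archi_boundP.
Qed.

Let tail (e : R) : 0 < e -> exists K, forall n, \sum_(K <= k < n) a k < e.
Proof.
move=> e0; pose S n := \sum_(0 <= k < n) a k.
have ndS : nondecreasing_seq S.
  apply/nondecreasing_seqP => n; rewrite /S big_nat_recr//=.
  by rewrite lerDl.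
have cS : cvgn S.
  apply: nondecreasing_is_cvgn => //; exists A => _ [n _ <-]; exact: aA.
have leS n : S n <= limn S by apply: nondecreasing_cvgn_le.
have [K _ HK] : \forall n \near \oo, `|limn S - S n| < e.
  by move/cvgrPdist_lt : cS; apply.
exists K => n; have [nK|Kn] := leqP n K; first by rewrite big_geq.
have := HK K (leqnn K); rewrite ger0_norm ?subr_ge0// => h.
have := leS n; rewrite {1}/S (big_cat_nat (n := K)) ?(ltnW Kn)//= -/(S K); lra.
Qed.

Lemma variation_cvg : cvg (I b @[b --> +oo%R]).
Proof.
apply/cauchy_cvgP; apply: cauchy_exP => e e0.
have [K HK] := tail e0; exists (I K%:R).
change (\forall b \near +oo%R, ball (I K%:R) e (I b)).
near=> b; rewrite /ball /= distrC.
apply: le_lt_trans (HK (Num.bound b)).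
apply: variation_le_sum => //.
by apply/ltW/archi_boundP; near: b; apply: nbhs_pinfty_ge; exact: num_real.
Unshelve. all: by end_near. Qed.

Lemma variation_stop_cvg (tau : \bar R) : (0 <= tau)%E ->
  cvg (I (stop tau b) @[b --> +oo%R]).
Proof.
case: tau => [x| |]// x0.
  apply/cvg_ex; exists (I x); apply: cvg_near_cst.
  have xb : \forall b \near +oo%R, x <= b by apply: nbhs_pinfty_ge; exact: num_real.
  by apply: filterS xb => b xb; rewrite (@stop_ge _ x%:E b x).
rewrite (_ : (fun b => I (stop +oo%E b)) = I); first exact: variation_cvg.
by apply/funext => b; rewrite stop_id// leey.
Qed.

End summable_variation.

(** * The running maximum of the Brownian motion *)

Lemma stop_index_hit d (T : measurableType d) (B : nat -> set T) K w : w \notin alive B K ->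
  B (stop_index B K w) w.
Proof.
elim: K => [|K IH] /=.
  move=> /negP h; apply: contrapT => nB; apply: h; rewrite inE => k.
  by rewrite leqn0 => /eqP ->.
case: ifPn => [wA|wN]; last by move=> _; exact: IH.
move=> /negP h; apply: contrapT => nB; apply: h; rewrite inE => k.
rewrite leq_eqVlt => /predU1P[->//|]; rewrite ltnS => kK.
by move: wA; rewrite inE; apply.
Qed.

Section maximal.
Context d (T : measurableType d) (R : realType) (P : probability T R).
Variables (arm : bool -> levy_arm R) (p0 : R) (theta : {RV P >-> bool})
  (Z : R -> {RV P >-> R}) (N : bool -> R -> {RV P >-> nat})
  (J : bool -> nat -> {RV P >-> R}).
Hypothesis model : bandit_model arm p0 theta Z N J.
Variable i : bool.

Lemma measurable_type_event : measurable (theta @^-1` [set i]).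
Proof. exact: measurable_funPTI. Qed.

Local Notation Q := (restriction P measurable_type_event).

Let block delta (delta0 : 0 < delta) :
  block_model P Q (brownian_increment Z delta) (count_increment N i delta)
    (mark arm J i) (count_pmf arm i delta).
Proof. exact: (grid_block_model model i delta0). Qed.

Let mean_cst1 Y : mean P Y (fun=> 1) 1.
Proof.
by split=> //; rewrite integral_cst // mul1e; exact: probability_setT.
Qed.

Lemma count_pmf_total delta : 0 < delta ->
  (\sum_(j <oo) (count_pmf arm i delta j)%:E = 1%:E)%E.
Proof.
move=> delta0.
have := @count_pmf_prod R arm i delta delta0 (fun=> 1) (levy_mass (arm i)) 0%N.
rewrite subrr mulr0 expR0 => <-//; last by move=> m; rewrite mulr1.
by apply: eq_eseriesr => j _; rewrite big1// mulr1.
Qed.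

Lemma brownian_increment_sum delta k w :
  \sum_(j < k) brownian_increment Z delta j w =
  Z (grid_point delta k) w - Z 0 w.
Proof.
elim: k => [|k IH]; first by rewrite big_ord0 /grid_point mul0r subrr.
by rewrite big_ord_recr /= IH /brownian_increment; ring.
Qed.

(** A maximal inequality: optional stopping for exp(a Z_t - a^2 t / 2) at the first grid time with a
    Z >= c, where this martingale is at least exp(c - a^2 K delta / 2). Both signs of [a] are
    allowed, so it controls both tails. *)
Lemma max_tail (delta a c : R) (K : nat) : 0 < delta ->
  (Q [set w | exists2 k, (k <= K)%N & (c <= a * (Z (grid_point delta k) w - Z 0 w))%R]
   <= Q setT * (expR (a ^+ 2 * (K%:R * delta) / 2 - c))%:E)%E.
Proof.
move=> delta0; have model' := block delta0.
have [mX mD mJ pd0 _] := model'.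
pose u x := expR (- (a ^+ 2 * delta / 2)) * expR (a * x).
have Hu k : mean P (brownian_increment Z delta k) u 1.
  have [me e0 Ee] := mean_expR_increment model delta0 k a; split.
  - exact: measurable_funM.
  - by move=> x; rewrite mulr_ge0 ?expR_ge0.
  - under eq_integral do rewrite EFinM.
    rewrite ge0_integralZl_EFin ?expR_ge0//.
    + by rewrite Ee -EFinM -expRD addNr expR0.
    + by apply/measurable_EFinP; exact: (measurableT_comp me (mX k)).
have walkE k w : walk (brownian_increment Z delta) (count_increment N i delta)
    (mark arm J i) u (fun=> 1) k w =
    expR (a * (Z (grid_point delta k) w - Z 0 w) - a ^+ 2 * (k%:R * delta) / 2).
  rewrite /walk [X in _ * X]big1// mulr1 -brownian_increment_sum.
  under eq_bigr do rewrite /u -expRD.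
  rewrite -expR_sum; congr expR; rewrite big_split /= sumr_const card_ord.
  by rewrite -mulr_sumr -mulr_natr; field.
pose v x := expR (a * x).
have mv : measurable_fun setT v.
  by apply: measurableT_comp => //; exact: measurable_funM.
pose B k := [set w | c <= a * (Z (grid_point delta k) w - Z 0 w)].
have BE k : B k = walk (brownian_increment Z delta) (count_increment N i delta)
    (mark arm J i) v (fun=> 1) k @^-1` `[expR c, +oo[%classic.
  apply/seteqP; split => w /=; rewrite in_itv /= andbT /walk [X in _ * X]big1// mulr1;
    by rewrite /v -expR_sum ler_expR -mulr_sumr brownian_increment_sum.
have HB k K' : (k <= K')%N -> <<s history (brownian_increment Z delta)
    (count_increment N i delta) (mark arm J i) K' >> (B k).
  move=> kK; rewrite BE -[X in <<s _ >> X]setTI.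
  by apply: (walk_adapted mv (measurable_cst (1 : R)) kK) => //;
    exact: (@measurableT _ (history_type _ _ _ K')).
have Hser (K' n : nat) : (\sum_(j <oo) (1 * count_pmf arm i delta j *
    \prod_(m < j) (fun=> 1) (n + m)%N)%:E = 1%:E :> \bar R)%E.
  under eq_eseriesr do rewrite mul1r big1// mulr1.
  exact: count_pmf_total.
have [mS ES] := optional_stopping model' Hu (fun m => mean_cst1 _) Hser HB K.
set E := [set w | _].
have mE : measurable E.
  rewrite (_ : E = \bigcup_(k in `I_K.+1) B k).
    apply: bigcup_measurable => k _; rewrite /B.
    rewrite (_ : [set w | _] = (fun w => a * (Z (grid_point delta k) w - Z 0 w))
      @^-1` `[c, +oo[%classic).
      rewrite -[X in measurable X]setTI.
      by apply: (measurable_funM (measurable_cst _) (measurable_funB _ _)) => //.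
    by apply/seteqP; split => w /=; rewrite in_itv /= andbT.
  by apply/seteqP; split => w [k h1 h2]; exists k.
pose x := expR (c - a ^+ 2 * (K%:R * delta) / 2).
have : (x%:E * Q E <= Q setT)%E.
  rewrite -ES -integral_cst// integral_mkcond; apply: ge0_le_integral => //.
  - by move=> w _; rewrite patchE; case: ifP => // _; rewrite lee_fin expR_ge0.
  - by apply/(measurable_restrictT _ mE); exact: measurable_cst.
  - exact/measurable_EFinP.
  - move=> w _; rewrite walkE patchE; case: ifPn => [|_]; last by rewrite lee_fin expR_ge0.
    rewrite inE => -[k kK hk]; rewrite lee_fin ler_expR.
    have wN : w \notin alive B K.
      by apply/negP; rewrite inE => /(_ k kK).
    have := stop_index_hit wN; rewrite /B /= => hit.
    rewrite lerB// ler_wpM2r// ler_wpM2l ?sqr_ge0// ler_wpM2r ?(ltW delta0)//.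
    by rewrite ler_nat stop_index_le.
rewrite -lee_pdivlMl ?expR_gt0// => h; apply: (le_trans h).
rewrite muleC le_eqVlt; apply/orP; left; apply/eqP; congr (_ * _%:E)%E.
by rewrite /x -expRN opprB.
Qed.

End maximal.

Section envelope.
Context d (T : measurableType d) (R : realType) (P : probability T R).
Variables (arm : bool -> levy_arm R) (p0 : R) (theta : {RV P >-> bool})
  (Z : R -> {RV P >-> R}) (N : bool -> R -> {RV P >-> nat})
  (J : bool -> nat -> {RV P >-> R}).
Hypothesis model : bandit_model arm p0 theta Z N J.
Variable i : bool.
Local Notation Q := (restriction P (measurable_type_event theta i)).

Definition mesh (n : nat) : R := 2 ^- n.

Lemma mesh_gt0 n : 0 < mesh n.
Proof. by rewrite invr_gt0 exprn_gt0. Qed.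

Lemma mesh_mul (L n : nat) : (L * 2 ^ n)%:R * mesh n = L%:R.
Proof. by rewrite natrM natrX mulfK// expf_eq0/= pnatr_eq0 andbF. Qed.

Lemma mesh_refine (k n : nat) : grid_point (mesh n.+1) (2 * k)%N = grid_point (mesh n) k.
Proof.
rewrite /grid_point /mesh exprS invfM natrM; field.
by rewrite expf_eq0/= pnatr_eq0 andbF.
Qed.

Let E (L m n : nat) : set T :=
  [set w | exists2 k, (k <= L * 2 ^ n)%N &
     m%:R <= `|Z (grid_point (mesh n) k) w - Z 0 w| ].

Let mE L m n : measurable (E L m n).
Proof.
rewrite (_ : E L m n = \bigcup_(k in `I_(L * 2 ^ n).+1)
    (fun w => `|Z (grid_point (mesh n) k) w - Z 0 w|) @^-1` `[m%:R, +oo[%classic).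
  apply: bigcup_measurable => k _; rewrite -[X in measurable X]setTI.
  have mf : measurable_fun setT (fun w => `|Z (grid_point (mesh n) k) w - Z 0 w|).
    by apply: measurableT_comp => //; exact: measurable_funB.
  exact: mf.
apply/seteqP; split => w [k h1 h2]; exists k => //.
  by rewrite /= in_itv /= h2.
by move: h2; rewrite /= in_itv /= andbT.
Qed.

Let E_nd L m : nondecreasing_seq (E L m).
Proof.
apply/nondecreasing_seqP => n; apply/subsetPset => w [k kL h].
exists (2 * k)%N; last by rewrite mesh_refine.
by rewrite expnS mulnCA leq_pmul2l.
Qed.

Let QE (b : R) L m n : 0 < b ->
  (Q (E L m n) <= (2 * expR (b ^+ 2 * L%:R / 2 - b * m%:R))%:E)%E.
Proof.
move=> b0; pose F (a : R) := [set w | exists2 k, (k <= L * 2 ^ n)%N &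
  b * m%:R <= a * (Z (grid_point (mesh n) k) w - Z 0 w)].
have mF a : measurable (F a).
  rewrite (_ : F a = \bigcup_(k in `I_(L * 2 ^ n).+1)
    (fun w => a * (Z (grid_point (mesh n) k) w - Z 0 w)) @^-1` `[b * m%:R, +oo[%classic).
    apply: bigcup_measurable => k _; rewrite -[X in measurable X]setTI.
    have mf : measurable_fun setT (fun w => a * (Z (grid_point (mesh n) k) w - Z 0 w)).
      by apply: measurable_funM => //; exact: measurable_funB.
    exact: mf.
  apply/seteqP; split => w [k h1 h2]; exists k => //.
    by rewrite /= in_itv /= h2.
  by move: h2; rewrite /= in_itv /= andbT.
have tail a : a ^+ 2 = b ^+ 2 ->
    (Q (F a) <= (expR (b ^+ 2 * L%:R / 2 - b * m%:R))%:E)%E.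
  move=> ab.
  have := max_tail model i a (b * m%:R) (L * 2 ^ n) (mesh_gt0 n).
  rewrite mesh_mul ab => h; apply: (le_trans h).
  rewrite -[leRHS]mul1e lee_wpmul2r ?lee_fin ?expR_ge0//.
  have mI := measurableI _ _ measurableT (measurable_type_event theta i).
  exact: (probability_le1 P mI).
apply: (@le_trans _ _ (Q (F b `|` F (- b)))).
  apply: le_measure; rewrite ?inE//; first exact: measurableU.
  move=> w [k kL h]; move: h; rewrite ler_normr => /orP[h|h]; [left|right];
    exists k => //; last by rewrite mulNr -mulrN ler_pM2l.
  by rewrite ler_pM2l.
apply: (le_trans (measureU2 _ (mF _) (mF _))).
rewrite mulr_natl mulr2n EFinD; apply: leeD; apply: tail => //.
by rewrite sqrrN.
Qed.

(** Let [F m] be the event that |Z| reaches m at some dyadic time up to L. Then the sum over m of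
    exp(a (m + 1)) on [F m] dominates exp(a |Z|) at all these times. The maximal inequality with
    parameter 2 a bounds the probability of [F m] by 2 exp(2 a^2 L - 2 a m), which leaves a
    geometric series of ratio exp(- a); hence a constant independent of L. *)
Lemma brownian_envelope (a : R) : 0 < a -> exists2 C, 0 <= C &
  forall L : nat, exists H : T -> \bar R,
    [/\ measurable_fun setT H, forall w, (0 <= H w)%E,
        (\int[Q]_w H w <= (C * expR (2 * a ^+ 2 * L%:R))%:E)%E &
        forall w n k, (k <= L * 2 ^ n)%N ->
          ((expR (a * `|Z (grid_point (mesh n) k) w - Z 0 w|))%:E <= H w)%E].
Proof.
move=> a0; pose A := limn (series (geometric (2 * expR a) (expR (- a)))).
have a1 : `|expR (- a)| < 1.
  by rewrite ger0_norm ?expR_ge0// expR_lt1 oppr_lt0.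
have cA := @is_cvg_geometric_series R (2 * expR a) (expR (- a)) a1.
have EA : (\sum_(m <oo) (geometric (2 * expR a) (expR (- a)) m)%:E = A%:E)%E.
  rewrite /A -EFin_lim//; apply/congr_lim/funext => n /=.
  by rewrite /series /= -sumEFin.
have g0 m : 0 <= geometric (2 * expR a) (expR (- a)) m.
  by rewrite /geometric /= mulr_ge0 ?exprn_ge0 ?expR_ge0// mulr_ge0 ?expR_ge0.
have A0 : 0 <= A by rewrite -lee_fin -EA nneseries_ge0// => m _ _; rewrite lee_fin.
exists A => // L; pose F m := \bigcup_n E L m n.
have mF m : measurable (F m) by apply: bigcupT_measurable => n; exact: mE.
have QF m : (Q (F m) <= (2 * expR (2 * a ^+ 2 * L%:R - 2 * a * m%:R))%:E)%E.
  have cv : Q (E L m n) @[n --> \oo] --> Q (F m).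
    by apply: nondecreasing_cvg_mu; [move=> n; exact: mE|exact: mF|exact: E_nd].
  rewrite -(cvg_lim _ cv)//; apply: lime_le; first by apply/cvg_ex; exists (Q (F m)).
  apply: nearW => n; have := @QE (2 * a) L m n.
  rewrite (_ : (2 * a) ^+ 2 * L%:R / 2 = 2 * a ^+ 2 * L%:R); last by field.
  by apply; rewrite mulr_gt0.
exists (fun w => (\sum_(m <oo) (expR (a * m.+1%:R) * \1_(F m) w)%:E)%E).
have t0 m w : (0 <= (expR (a * m.+1%:R) * \1_(F m) w)%:E)%E.
  by rewrite lee_fin mulr_ge0 ?expR_ge0.
have mt m : measurable_fun setT (fun w => (expR (a * m.+1%:R) * \1_(F m) w)%:E).
  by apply/measurable_EFinP; apply: measurable_funM => //; exact: measurable_indic.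
split.
- exact: ge0_emeasurable_sum.
- by move=> w; apply: nneseries_ge0 => m _ _.
- rewrite integral_nneseries//.
  apply: (@le_trans _ _ (\sum_(m <oo) ((expR (2 * a ^+ 2 * L%:R))%:E *
     (geometric (2 * expR a) (expR (- a)) m)%:E))%E).
    apply: lee_nneseries; first by move=> m _ _; apply: integral_ge0.
    move=> m _; under eq_integral do rewrite EFinM.
    rewrite ge0_integralZl_EFin ?expR_ge0//; last first.
      by apply/measurable_EFinP; exact: measurable_indic.
    rewrite integral_indic// setIT.
    apply: (@le_trans _ _ ((expR (a * m.+1%:R))%:E *
        (2 * expR (2 * a ^+ 2 * L%:R - 2 * a * m%:R))%:E)%E).
      by apply: lee_wpmul2l; [rewrite lee_fin expR_ge0|exact: QF].
    rewrite -!EFinM lee_fin /geometric /= -expRM_natl.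
    rewrite (_ : expR _ * (2 * _) = 2 * (expR (a * m.+1%:R) *
      expR (2 * a ^+ 2 * L%:R - 2 * a * m%:R))); last by ring.
    rewrite (_ : expR _ * (2 * _ * _) = 2 * (expR (2 * a ^+ 2 * L%:R) *
      (expR a * expR (m%:R * - a)))); last by ring.
    by rewrite -!expRD -natr1 le_eqVlt; apply/orP; left; apply/eqP;
      congr (_ * expR _); ring.
  rewrite nneseriesZl; last by move=> m _; rewrite lee_fin.
  by rewrite EA -EFinM lee_fin mulrC.
- move=> w n k kL; set x := `|Z (grid_point (mesh n) k) w - Z 0 w|.
  have x0 : 0 <= x by exact: normr_ge0.
  pose m := Num.truncn x.
  have /andP[mx xm] : m%:R <= x < m.+1%:R by exact: truncn_itv.
  apply: (@le_trans _ _ (expR (a * m.+1%:R) * \1_(F m) w)%:E).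
    rewrite indicE mem_set ?mulr1 ?lee_fin ?ler_expR ?ler_pM2l ?(ltW xm)//.
    by exists n => //; exists k.
  rewrite (@nneseriesD1 _ _ m)//.
  rewrite leeDl//. by apply: nneseries_ge0 => l _ _; exact: t0.
Qed.

End envelope.
Arguments mesh {R} n.

Section dominated_ae.
Context d (T : measurableType d) (R : realType) (mu : {measure set T -> \bar R}).

(** The limit [f] is known only almost everywhere and need not be measurable; the upper limit of the
    sequence provides a measurable version [f']. *)
Lemma dominated_ae (f_ : nat -> T -> R) (f : T -> R) (g : T -> \bar R) :
  (forall n, measurable_fun setT (f_ n)) -> mu.-integrable setT g ->
  {ae mu, forall w, forall n, (`|f_ n w|%:E <= g w)%E} ->
  {ae mu, forall w, f_ n w @[n --> \oo] --> f w} ->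
  exists f' : T -> R, [/\ measurable_fun setT f', {ae mu, forall w, f' w = f w},
    mu.-integrable setT (EFin \o f') &
    (\int[mu]_w (f_ n w)%:E @[n --> \oo] --> \int[mu]_w (f' w)%:E)%E].
Proof.
move=> mf ig fg ff.
pose f' w := fine (limn_esup (fun n => (f_ n w)%:E)).
have mf' : measurable_fun setT f'.
  apply: measurableT_comp => //; apply: measurable_fun_limn_esup => n.
  exact/measurable_EFinP.
have f'f w : f_ n w @[n --> \oo] --> f w -> f' w = f w.
  move=> h; rewrite /f' (_ : limn_esup _ = (f w)%:E)//.
  have hE : (f_ n w)%:E @[n --> \oo] --> (f w)%:E by apply: cvg_EFin => //; exact: nearW.
  by rewrite is_cvg_limn_esupE; [exact/cvg_lim|apply/cvg_ex; exists (f w)%:E].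
have aef : {ae mu, forall w, f' w = f w} by apply: filterS ff => w; exact: f'f.
have fg' : {ae mu, forall x n, [set: T] x -> (`|(f_ n x)%:E| <= g x)%E}.
  by apply: filterS fg => w h n _; exact: h.
have ff' : {ae mu, forall x, [set: T] x -> (f_ n x)%:E @[n --> \oo] --> (f' x)%:E}.
  apply: filterS ff => w h _; apply: cvg_EFin; first exact: nearW.
  by rewrite f'f.
have [i1 _ c1] := @dominated_convergence _ T R mu setT measurableT
  (fun n w => (f_ n w)%:E) (EFin \o f') g (fun n => proj2 (measurable_EFinP _ _) (mf n))
  (proj2 (measurable_EFinP _ _) mf') ff' ig fg'.
by exists f'; split.
Qed.
End dominated_ae.

(** * The jump ratio and the sample paths *)

Lemma ae_imp d (T : measurableType d) (R : realType)
    (mu : {measure set T -> \bar R}) (P1 P2 : T -> Prop) :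
  (forall x, P1 x -> P2 x) ->
  {ae mu, forall x, P1 x} -> {ae mu, forall x, P2 x}.
Proof.
move=> P12 [A [mA A0 sA]]; exists A; split => // x /= h.
by apply: sA => /= /P12.
Qed.

Lemma ae_and d (T : measurableType d) (R : realType)
    (mu : {measure set T -> \bar R}) (P1 P2 : T -> Prop) :
  {ae mu, forall x, P1 x} -> {ae mu, forall x, P2 x} ->
  {ae mu, forall x, P1 x /\ P2 x}.
Proof.
move=> [A [mA A0 sA]] [B [mB B0 sB]]; exists (A `|` B); split.
- exact: measurableU.
- apply/eqP; rewrite -measure_le0; apply: (le_trans (measureU2 _ mA mB)).
  by rewrite [X in (X + _)%E]A0 [X in (_ + X)%E]B0 adde0.
- move=> x /= /not_andP[h|h]; [left; exact: sA|right; exact: sB].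
Qed.

Section density_facts.
Context (R : realType) (arm : bool -> levy_arm R).
Hypothesis A3 : forall A : set (measurableTypeR R), measurable A ->
  (levy (arm false) A <= levy (arm true) A)%E.
Local Notation nu1 := (levy (arm true)).
Local Notation nu2 := (levy (arm false)).
Local Notation dnu := (Radon_Nikodym (charge_of_finite_measure nu2) nu1).

Let nu12 : nu2 `<< nu1.
Proof.
move=> A nA B mB BA; apply/eqP; rewrite -measure_le0.
by rewrite -(nA B mB BA) A3.
Qed.

Let idnu : nu1.-integrable setT dnu.
Proof. by apply: Radon_Nikodym_integrable; exact: nu12. Qed.

Let mdnu : measurable_fun setT dnu.
Proof. by case/integrableP : idnu. Qed.

Lemma densityE h : (density arm h)%:E = dnu h.
Proof. by rewrite /density fineK//; exact: Radon_Nikodym_fin_num. Qed.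

Lemma measurable_density : measurable_fun setT (density arm).
Proof.
apply/measurable_EFinP; rewrite (_ : EFin \o _ = dnu).
  exact: mdnu.
by apply/funext => h /=; rewrite densityE.
Qed.

Lemma levy_density (A : set (measurableTypeR R)) : measurable A ->
  nu2 A = (\int[nu1]_(h in A) (density arm h)%:E)%E.
Proof.
move=> mA; rewrite -[LHS]/(charge_of_finite_measure nu2 A).
rewrite (@Radon_Nikodym_integral _ _ _ (charge_of_finite_measure nu2) nu1 A)//.
by apply: eq_integral => h _; rewrite densityE.
Qed.

Lemma density_ge0 : {ae nu1, forall h, 0 <= density arm h}.
Proof.
have := ae_eq_Radon_Nikodym_SigmaFinite nu12 (@measurableT _ (measurableTypeR R)).
apply: filterS => h /(_ I); rewrite -densityE => e.
by rewrite -lee_fin -e; exact: Radon_Nikodym_SigmaFinite.f_ge0.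
Qed.

(** On a measurable subset E of the set where the density exceeds 1, integration gives nu2 E >= nu1
    E, and A3 gives the reverse. So the density equals 1 almost everywhere there, which is absurd
    unless the set is null. *)
Lemma density_le1 : {ae nu1, forall h, density arm h <= 1}.
Proof.
pose A : set (measurableTypeR R) := density arm @^-1` `]1, +oo[%classic.
have mA : measurable A.
  by rewrite -[X in measurable X]setTI; apply: measurable_density.
have iD : nu1.-integrable A (EFin \o density arm).
  rewrite (_ : EFin \o density arm = dnu); last first.
    by apply/funext => h /=; rewrite densityE.
  by apply: integrableS idnu.
have iT : nu1.-integrable A (EFin \o cst 1).
  apply: (integrableS measurableT mA (@subsetT _ _)).
  exact: finite_measure_integrable_cst.
have : ae_eq nu1 A (EFin \o density arm) (EFin \o cst 1).
  apply: integral_ae_eq => //.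
    exact: measurable_int iT.
  move=> E EA mE; apply/eqP; rewrite eq_le; apply/andP; split.
    have e1 : (\int[nu1]_(x in E) (EFin \o density arm) x = nu2 E)%E.
      by rewrite levy_density.
    have e2 : (\int[nu1]_(x in E) (EFin \o cst (1%R : R)) x = nu1 E)%E.
      by rewrite -[RHS]mul1e -integral_cst.
    by rewrite e1 e2; exact: A3.
  apply: ge0_le_integral => //.
  - apply/measurable_EFinP; apply: (measurable_funS measurableT (@subsetT _ _)).
    exact: measurable_cst.
  - apply/measurable_EFinP; apply: (measurable_funS measurableT (@subsetT _ _)).
    exact: measurable_density.
  - move=> h /EA; rewrite /A /= in_itv /= andbT => h1.
    by rewrite lee_fin ltW.
apply: filterS => h hA; rewrite leNgt; apply/negP => h1.
have Ah : A h by rewrite /A /= in_itv /= h1.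
by have := hA Ah => -[] h1'; move: h1; rewrite h1' ltxx.
Qed.

Lemma density_gt0 : {ae nu2, forall h, 0 < density arm h}.
Proof.
pose A : set (measurableTypeR R) := density arm @^-1` `]-oo, 0]%classic.
have mA : measurable A.
  by rewrite -[X in measurable X]setTI; apply: measurable_density.
exists A; split => //.
- apply/eqP; rewrite -measure_le0.
  apply: (@le_trans _ _ (\int[nu1]_(h in A) (density arm h)%:E)%E).
    by rewrite -levy_density.
  have iD : nu1.-integrable A (EFin \o density arm).
    rewrite (_ : EFin \o density arm = dnu); last first.
      by apply/funext => h /=; rewrite densityE.
    exact: (integrableS measurableT mA (@subsetT _ _)).
  rewrite -(@integral0 _ _ _ nu1 A); apply: le_integral => //.
    exact: integrable0.
  by move=> h; rewrite inE /A /= in_itv /= => h0; rewrite lee_fin.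
- by move=> h /= /negP; rewrite -leNgt /A /= in_itv.
Qed.

(** The density clipped to [0, 1]: it agrees with the density almost everywhere, and the bounds that
    make every jump of the ratio downward now hold at every point. *)
Definition jump_ratio (h : R) : R := Num.min (Num.max (density arm h) 0) 1.

Lemma jump_ratio_ge0 h : 0 <= jump_ratio h.
Proof. by rewrite le_min le_max lexx orbT ler01. Qed.

Lemma jump_ratio_le1 h : jump_ratio h <= 1.
Proof. by rewrite ge_min lexx orbT. Qed.

Lemma measurable_jump_ratio : measurable_fun setT jump_ratio.
Proof.
apply: measurable_minr => //; apply: measurable_maxr => //.
exact: measurable_density.
Qed.

Lemma jump_ratioE h : 0 <= density arm h -> density arm h <= 1 ->
  jump_ratio h = density arm h.
Proof. by move=> h0 h1; rewrite /jump_ratio max_l// min_l. Qed.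

Lemma density_itv (i : bool) :
  {ae levy (arm i), forall h, 0 <= density arm h <= 1}.
Proof.
have h1 : {ae nu1, forall h, 0 <= density arm h <= 1}.
  by apply: filterS (ae_and density_ge0 density_le1) => h [-> ->].
case: i => //.
have [B [mB B0 sB]] := h1; exists B; split => //.
by apply/eqP; rewrite -measure_le0 -B0 A3.
Qed.

Lemma integral_density_powR (eta : R) : 0 < eta ->
  (\int[nu2]_h (density arm h `^ eta)%:E = \int[nu2]_h (jump_ratio h `^ eta)%:E)%E.
Proof.
move=> eta0; apply: ge0_ae_eq_integral => //.
- apply/measurable_EFinP; apply: (measurableT_comp (measurable_powR eta)).
  exact: measurable_density.
- apply/measurable_EFinP; apply: (measurableT_comp (measurable_powR eta)).
  exact: measurable_jump_ratio.
- by move=> h _; rewrite lee_fin powR_ge0.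
- by move=> h _; rewrite lee_fin powR_ge0.
- apply: (ae_imp _ (density_itv false)) => h /andP[h0 h1] _.
  by rewrite jump_ratioE.
Qed.

Lemma powR_le1 (x eta : R) : 0 <= x -> x <= 1 -> 0 <= eta -> x `^ eta <= 1.
Proof.
move=> x0 x1 e0; have -> : 1 = 1 `^ eta :> R by rewrite powR1.
by rewrite ge0_ler_powR// nnegrE.
Qed.

Lemma integrable_jump_ratio_powR (i : bool) (eta : R) : 0 <= eta ->
  (levy (arm i)).-integrable setT (fun h => (jump_ratio h `^ eta)%:E).
Proof.
move=> e0; apply: measurable_bounded_integrable => //.
- by rewrite ltey_eq fin_num_measure.
- apply: (measurableT_comp (measurable_powR eta)).
  exact: measurable_jump_ratio.
- exists 1; split; first exact: num_real.
  move=> M M1 h _ /=; rewrite ger0_norm ?powR_ge0// (le_trans _ (ltW M1))//.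
  by rewrite powR_le1// ?jump_ratio_ge0 ?jump_ratio_le1.
Qed.

(** Change of variables: nu2 has density [jump_ratio] with respect to nu1, which accounts for the
    extra power. This links the exponent for High to the one for Low. *)
Lemma integral_jump_ratio_powR (eta : R) : 0 < eta ->
  (\int[nu1]_h (jump_ratio h `^ (eta + 1))%:E = \int[nu2]_h (jump_ratio h `^ eta)%:E)%E.
Proof.
move=> eta0; have e0 := ltW eta0.
rewrite -(Radon_Nikodym_change_of_variables nu12 measurableT
  (integrable_jump_ratio_powR false e0)).
apply: ae_eq_integral => //.
- exact: measurable_int (integrable_jump_ratio_powR true (addr_ge0 e0 ler01)).
- apply: emeasurable_funM.
    exact: measurable_int (integrable_jump_ratio_powR true e0).
  exact: mdnu.
- apply: (ae_imp _ (density_itv true)) => h /andP[h0 h1] _.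
  rewrite -densityE -EFinM -(jump_ratioE h0 h1); congr EFin.
  have [->|jn0] := eqVneq (jump_ratio h) 0.
    by rewrite mulr0 powR0// gt_eqF// addr_gt0.
  by rewrite powRD ?jn0 ?implybT// powRr1// jump_ratio_ge0.
Qed.

End density_facts.

(** * Regularity of sample paths *)

Section path_regularity.
Context (R : realType).

Lemma within_continuous_eps (z : R -> R) :
  {within [set t : R | 0 <= t], continuous z} ->
  forall x e, 0 <= x -> 0 < e -> exists2 dl, 0 < dl &
    forall y, 0 <= y -> `|y - x| < dl -> `|z y - z x| < e.
Proof.
move=> /subspace_continuousP cz x e x0 e0.
have /cvgrPdist_lt /(_ e e0) := cz x x0.
rewrite /within /= => -[dl /= dl0 H].
exists dl => // y y0 yx; rewrite distrC; apply: (H y) => //=.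
by rewrite distrC.
Qed.

Lemma unif_continuous_segment (z : R -> R) :
  {within [set t : R | 0 <= t], continuous z} ->
  forall B e : R, 0 < e -> exists2 dl, 0 < dl &
    forall u v, 0 <= u -> u <= B -> 0 <= v -> `|v - u| < dl -> `|z v - z u| < e.
Proof.
move=> cz B e e0.
have /compact_near_coveringP/near_covering_withinP := @segment_compact R 0 B.
move=> /(_ R (0 : R)^'+ (fun dl u => forall v, 0 <= u -> 0 <= v -> `|v - u| < dl ->
  `|z v - z u| < e) _).
have step : forall x, `[0, B]%classic x -> \forall x' \near x & i \near (0 : R)^'+,
    `[0, B]%classic x' ->
    (forall v, 0 <= x' -> 0 <= v -> `|v - x'| < i -> `|z v - z x'| < e).
  move=> x /=; rewrite in_itv /= => /andP[x0 xB].
  have e2 : 0 < e / 2 by rewrite divr_gt0.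
  have [dl dl0 H] := within_continuous_eps cz x0 e2.
  exists ([set x' | `|x - x'| < dl / 2], [set i | i < dl / 2]).
    split; first by exists (dl / 2) => //=; rewrite divr_gt0.
    by apply: nbhs_right_lt; rewrite divr_gt0.
  move=> [x' i] /= [xx' i2] _ v x'0 v0 vx'.
  have h1 : `|z v - z x| < e / 2.
    apply: H => //; rewrite (_ : v - x = (v - x') + (x' - x)); last by ring.
    apply: (le_lt_trans (ler_normD _ _)); rewrite (distrC x').
    by rewrite (splitr dl) ltrD// (lt_trans vx').
  have h2 : `|z x' - z x| < e / 2.
    apply: H => //; rewrite distrC (lt_le_trans xx')// ler_pdivrMr// ler_pMr//.
    by rewrite ler1n.
  rewrite (_ : z v - z x' = (z v - z x) - (z x' - z x)); last by ring.
  by rewrite (le_lt_trans (ler_normB _ _))// (splitr e) ltrD.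
move=> /(_ step) [dl /= dl0 H].
have dl2 : 0 < dl / 2 by rewrite divr_gt0.
exists (dl / 2) => // u v u0 uB v0 uv.
apply: (H (dl / 2)) => //=.
  rewrite sub0r normrN gtr0_norm// ltr_pdivrMr// ltr_pMr// ltr1n//.
by rewrite in_itv /= u0.
Qed.

Lemma near_right_eps (P : R -> Prop) (t : R) : (\forall u \near t^'+, P u) ->
  exists2 dl, 0 < dl & forall u, t < u -> u < t + dl -> P u.
Proof.
move=> [dl /= dl0 H]; exists dl => // u tu ud; apply: H => //=.
by rewrite distrC gtr0_norm ?subr_gt0// ltrBlDl.
Qed.

Lemma continuous_bounded_segment (z : R -> R) :
  {within [set t : R | 0 <= t], continuous z} ->
  forall B : R, exists M, forall t, 0 <= t <= B -> `|z t| <= M.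
Proof.
move=> cz B; have [B0|B0] := leP 0 B; last first.
  by exists 0 => t /andP[t0 tB]; have := le_trans t0 tB; rewrite leNgt B0.
have cz' : {within `[0, B], continuous z}.
  apply: continuous_subspaceW cz => x /=.
  by rewrite in_itv /= => /andP[].
have [c1 _ h1] := EVT_max B0 cz'; have [c2 _ h2] := EVT_min B0 cz'.
exists (Num.max (z c1) (- z c2)) => t tB.
have tB' : t \in `[0, B] by rewrite in_itv.
by rewrite ler_norml lerNl !le_max h1 ?lerN2 ?h2 // orbT.
Qed.

End path_regularity.

Section good_path.
Context (R : realType) (arm : bool -> levy_arm R) (i : bool).

(** The almost sure properties of the sample paths of arm [i]. Given them, the pathwise arguments on
    belief, crossing time and discounted payoff are deterministic. *)
Record good_path (z : R -> R) (n : R -> nat) (j : nat -> R) : Prop := GoodPath {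
  good_z0 : z 0 = 0 ;
  good_cont : {within [set t : R | 0 <= t], continuous z} ;
  good_n0 : n 0 = 0%N ;
  good_mono : forall u t : R, 0 <= u -> u <= t -> (n u <= n t)%N ;
  good_right : forall t : R, 0 <= t -> \forall u \near t^'+, n u = n t ;
  good_density : forall t k, 0 <= t -> (k < n t)%N ->
    0 <= density arm (j k) <= 1 /\ (~~ i -> 0 < density arm (j k)) ;
  good_nojump : levy_mass (arm i) = 0 -> forall t, 0 <= t -> n t = 0%N }.

End good_path.

Section good_ae.
Context d (T : measurableType d) (R : realType) (P : probability T R).
Variables (arm : bool -> levy_arm R) (p0 : R) (theta : {RV P >-> bool})
  (Z : R -> {RV P >-> R}) (N : bool -> R -> {RV P >-> nat})
  (J : bool -> nat -> {RV P >-> R}).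
Hypothesis model : bandit_model arm p0 theta Z N J.
Hypothesis A3 : forall A : set (measurableTypeR R), measurable A ->
  (levy (arm false) A <= levy (arm true) A)%E.
Variable i : bool.

Let mark_ae (Pr : R -> Prop) : levy_mass (arm i) != 0 ->
  {ae levy (arm i), forall h, Pr h} -> {ae P, forall w, forall m, Pr (J i m w)}.
Proof.
move=> lam0 [B [mB B0 sB]]; apply: ae_foralln => m.
exists (J i m @^-1` B); split.
- exact: measurable_funPTI.
- have [_ _ /(_ i)[_ /(_ m B mB) EJ] _] := model.
  have : ((levy_mass (arm i))%:E * P (J i m @^-1` B) = 0)%E.
    by rewrite -levy_massE; apply: (eq_trans EJ).
  by move=> /eqP; rewrite mule_eq0 eqe (negbTE lam0) /= => /eqP.
- by move=> w /= h; apply: sB.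
Qed.

Lemma ae_good_path : {ae P, forall w, good_path arm i (fun t => Z t w)
  (fun t => N i t w) (fun k => J i k w)}.
Proof.
have [_ [Z0 Zc _ _] /(_ i)[[N0 Nm Nr _ NP] _] _] := model.
have dens : {ae P, forall w, levy_mass (arm i) != 0 -> forall m,
    0 <= density arm (J i m w) <= 1 /\ (~~ i -> 0 < density arm (J i m w))}.
  have [lam0|lam0] := eqVneq (levy_mass (arm i)) 0.
    by apply: aeW => w /eqP.
  have h1 := mark_ae lam0 (density_itv A3 i).
  have h2 : {ae P, forall w m, ~~ i -> 0 < density arm (J i m w)}.
    have [it|if_] : i \/ i = false by case: (i); [left|right].
      by apply: aeW => w m; rewrite it.
    apply: (@ae_imp _ _ _ _ (fun w => forall m, 0 < density arm (J i m w))).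
      by move=> w h m _; exact: h.
    by apply: (mark_ae (Pr := fun h => 0 < density arm h)) => //; rewrite if_;
       exact: density_gt0.
  by apply: ae_imp (ae_and h1 h2) => w [a b] _ m; split; [exact: a|exact: b].
have nojump : {ae P, forall w, levy_mass (arm i) = 0 ->
    forall k : nat, (N i k%:R w - N i 0 w = 0)%N}.
  have [lam0|lam0] := eqVneq (levy_mass (arm i)) 0; last first.
    by apply: aeW => w /eqP; rewrite (negbTE lam0).
  apply: (@ae_imp _ _ _ _ (fun w => forall k : nat, (N i k%:R w - N i 0 w = 0)%N)).
    by move=> w h _.
  apply: ae_foralln => k; pose B := [set j : nat | j <> 0%N].
  exists [set w | B (N i k%:R w - N i 0 w)%N]; split => //.
    rewrite -[X in measurable X]setTI.
    have mf : measurable_fun setT (fun w => N i k%:R w - N i 0 w)%N.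
      apply: (@measurable_fun_nat_index _ _ _ _ (N i 0)
        (fun j w => N i k%:R w - j)%N) => // j.
      exact: (@measurableT_comp _ _ _ _ _ _ (fun n => n - j)%N).
    exact: (@mf measurableT B).
  have := NP 0 k%:R B (lexx _) (ler0n _ _).
  rewrite [X in poisson_prob (X * _)](_ : _ = 0); last exact: lam0.
  rewrite mul0r /poisson_prob ltxx => PE; apply: (eq_trans PE).
  by rewrite /dirac indicE memNset// /B /= => h.
apply: ae_imp (ae_and (ae_and (ae_and Z0 Zc) (ae_and N0 Nm))
  (ae_and (ae_and Nr dens) nojump)).
move=> w [[[z0 zc] [n0 nm]] [[nr ds] nj]].
have nj' : levy_mass (arm i) = 0 -> forall t, 0 <= t -> N i t w = 0%N.
  move=> lam0 t t0; have := nj lam0 (Num.bound t).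
  rewrite n0 subn0 => h; apply/eqP; rewrite -leqn0 -h.
  by apply: nm => //; exact/ltW/archi_boundP.
split => //.
move=> t k t0 kn; have [lam0|lam0] := eqVneq (levy_mass (arm i)) 0.
  by move: kn; rewrite nj'.
exact: ds.
Qed.

End good_ae.

(** * Laplace transform of the crossing time *)

Lemma prodr_powR (R : realType) (I : finType) (F : I -> R) (eta : R) :
  (forall k, 0 <= F k) -> (\prod_k F k) `^ eta = \prod_k (F k) `^ eta.
Proof.
move=> F0; suff : 0 <= \prod_k F k /\ (\prod_k F k) `^ eta = \prod_k (F k) `^ eta by case.
apply: (big_ind2 (fun a b => 0 <= a /\ a `^ eta = b)).
- by rewrite powR1.
- by move=> a1 b1 a2 b2 [a10 <-] [a20 <-]; rewrite mulr_ge0// powRM.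
- by [].
Qed.

Lemma stop_index_alive_lt d (T : measurableType d) (B : nat -> set T) K w k :
  (k < stop_index B K w)%N -> alive B k w.
Proof.
elim: K => [|K IH] //=; case: ifPn => [|_]; last exact: IH.
rewrite inE => wA; rewrite ltnS => kK j jk; apply: wA.
exact: leq_trans kK.
Qed.

Section hitting.
Context d (T : measurableType d) (R : realType) (P : probability T R).
Variables (arm : bool -> levy_arm R) (p0 : R) (theta : {RV P >-> bool})
  (Z : R -> {RV P >-> R}) (N : bool -> R -> {RV P >-> nat})
  (J : bool -> nat -> {RV P >-> R}).
Hypothesis model : bandit_model arm p0 theta Z N J.
Hypothesis A3 : forall A : set (measurableTypeR R), measurable A ->
  (levy (arm false) A <= levy (arm true) A)%E.
Variables (i : bool) (kappa c r eta Phi x : R).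
Hypotheses (r0 : 0 < r) (eta0 : 0 < eta) (x0 : 0 <= x).
Hypothesis EPhi : (\int[levy (arm i)]_h (jump_ratio arm h `^ eta)%:E = Phi%:E)%E.
(* The exponent of the martingale [exp (- r t) ratio_t ^ eta] vanishes. *)
Hypothesis exponent0 : - r + eta ^+ 2 * kappa ^+ 2 / 2 + eta * c
  + (Phi - levy_mass (arm i)) = 0.
Local Notation Q := (restriction P (measurable_type_event theta i)).
Local Notation jr := (jump_ratio arm).
Local Notation X m := (brownian_increment Z (mesh m)).
Local Notation D m := (count_increment N i (mesh m)).
Local Notation Mk := (mark arm J i).

Definition ratio_factor (m : nat) (y : R) : R := expR (- kappa * y + c * mesh m).

Definition ratio_walk (m k : nat) (w : T) : R :=
  walk (X m) (D m) Mk (ratio_factor m) jr k w.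

Let mesh0 m : 0 < mesh m :> R := mesh_gt0 _ m.

Let model' m : block_model P Q (X m) (D m) Mk (count_pmf arm i (mesh m)).
Proof. exact: (grid_block_model model i (mesh0 m)). Qed.

Let mrf m : measurable_fun setT (ratio_factor m).
Proof.
by apply: measurableT_comp => //; apply: measurable_funD => //; exact: measurable_funM.
Qed.

Let mjr : measurable_fun setT jr.
Proof. exact: (measurable_jump_ratio A3). Qed.

Let mjre : measurable_fun setT (fun h => jr h `^ eta).
Proof. exact: (measurableT_comp (measurable_powR eta) mjr). Qed.

Let rfe m (y : R) : R := expR (- (r * mesh m)) * ratio_factor m y `^ eta.

Let discounted_walkE m k w :
  walk (X m) (D m) Mk (rfe m) (fun h => jr h `^ eta) k w =
  expR (- r * grid_point (mesh m) k) * ratio_walk m k w `^ eta.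
Proof.
rewrite /ratio_walk /walk powRM; last 2 first.
- by apply: prodr_ge0 => j _; exact: expR_ge0.
- by apply: prodr_ge0 => j _; exact: jump_ratio_ge0.
rewrite !prodr_powR; last 2 first.
- by move=> j; exact: jump_ratio_ge0.
- by move=> j; exact: expR_ge0.
rewrite big_split /= prodr_const card_ord -expRM_natl mulrA; congr (expR _ * _ * _).
by rewrite /grid_point; ring.
Qed.

Let discounted_mean m : exists2 eu, (forall k, mean P (X m k) (rfe m) eu) &
  eu = expR (- (r * mesh m) + eta * c * mesh m + eta ^+ 2 * kappa ^+ 2 / 2 * mesh m).
Proof.
eexists; last by [].
move=> k; have [me _ Ee] := mean_expR_increment model (mesh0 m) k (- (eta * kappa)).
have rfeE y : rfe m y = expR (- (r * mesh m) + eta * c * mesh m) *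
    expR (- (eta * kappa) * y).
  by rewrite /rfe /ratio_factor -expRM -!expRD; congr expR; ring.
split.
- by apply: measurable_funM => //; exact: (measurableT_comp (measurable_powR eta)).
- by move=> y; rewrite rfeE mulr_ge0 ?expR_ge0.
- under eq_integral do rewrite rfeE EFinM.
  rewrite ge0_integralZl_EFin ?expR_ge0//; last first.
    apply/measurable_EFinP; apply: (measurableT_comp me).
    exact: measurable_funB.
  by rewrite Ee -EFinM -expRD; congr (expR _)%:E; ring.
Qed.

Lemma ratio_walk_ge0 m k w : 0 <= ratio_walk m k w.
Proof. by apply: walk_ge0 => y; [exact: expR_ge0|exact: jump_ratio_ge0]. Qed.

Definition hit (m : nat) (b : R) (k : nat) : set T := [set w | b < x * ratio_walk m k w].

Lemma hit_history m b k K : (k <= K)%N -> <<s history (X m) (D m) Mk K >> (hit m b k).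
Proof.
move=> kK.
have [mX mD mJ _ _] := model' m.
have mW := walk_adapted (X := X m) (D := D m) (J := Mk) (mrf m) mjr kK.
have mxW : measurable_fun (setT : set (history_type (X m) (D m) Mk K))
    (fun w => x * ratio_walk m k w).
  by apply: measurable_funM => //; exact: mW.
have := mxW (@measurableT _ (history_type _ _ _ K)) `]b, +oo[%classic (measurable_itv _).
rewrite setTI (_ : _ @^-1` _ = hit m b k)//.
by apply/seteqP; split => w /=; rewrite in_itv /= andbT.
Qed.

Lemma measurable_hit m b k : measurable (hit m b k).
Proof.
have [mX mD mJ _ _] := model' m.
have mxW : measurable_fun setT (fun w => x * ratio_walk m k w).
  by apply: measurable_funM => //; exact: measurable_walk.
have := mxW measurableT `]b, +oo[%classic (measurable_itv _).
rewrite setTI (_ : _ @^-1` _ = hit m b k)//.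
by apply/seteqP; split => w /=; rewrite in_itv /= andbT.
Qed.

(** Over one block the Gaussian moment of [rfe] and the Poisson generating function multiply to
    exp(mesh times the left-hand side of [exponent0]), which is 1; so optional stopping applies. *)
Lemma stopped_ratio m b K :
  measurable_fun setT (fun w => expR (- r * grid_point (mesh m) (stop_index (hit m b) K w))
     * ratio_walk m (stop_index (hit m b) K w) w `^ eta) /\
  (\int[Q]_w (expR (- r * grid_point (mesh m) (stop_index (hit m b) K w))
     * ratio_walk m (stop_index (hit m b) K w) w `^ eta)%:E = Q setT)%E.
Proof.
have [eu Hu Eeu] := discounted_mean m.
have jre0 h : 0 <= jr h `^ eta by exact: powR_ge0.
have [ephi [Hphi HPhi]] := mean_mark model mjre jre0 EPhi.
have ephi0 q : 0 <= ephi q.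
  case: (Hphi q) => _ _; rewrite -lee_fin => <-.
  by apply: integral_ge0 => w _; rewrite lee_fin.
have Hser (K' n : nat) : (\sum_(j <oo) (eu * count_pmf arm i (mesh m) j *
    \prod_(q < j) ephi (n + q)%N)%:E = 1%:E :> \bar R)%E.
  under eq_eseriesr do rewrite -mulrA EFinM.
  rewrite nneseriesZl; last first.
    by move=> j _; rewrite lee_fin mulr_ge0 ?fine_ge0// prodr_ge0.
  rewrite (count_pmf_prod (mesh0 m) _ HPhi ephi0) -EFinM Eeu -expRD.
  rewrite (_ : _ + _ = mesh m * (- r + eta ^+ 2 * kappa ^+ 2 / 2 + eta * c
    + (Phi - levy_mass (arm i)))); last by ring.
  by rewrite exponent0 mulr0 expR0.
have := optional_stopping (model' m) Hu Hphi Hser (@hit_history m b) K.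
under eq_integral do rewrite discounted_walkE.
by rewrite (_ : (fun w => walk _ _ _ _ _ _ w) = fun w => expR (- r * grid_point (mesh m)
  (stop_index (hit m b) K w)) * ratio_walk m (stop_index (hit m b) K w) w `^ eta)//;
  apply/funext => w; rewrite discounted_walkE.
Qed.

(** exp(-r t) at the first grid time t <= m with a hit, and 0 if there is none: the largest discount
    factor belongs to the first hit. The horizon grows together with the fineness of the grid. *)
Definition hit_discount (m : nat) (b : R) (w : T) : R :=
  \big[Num.max/0]_(k < (m * 2 ^ m).+1)
    (expR (- r * grid_point (mesh m) k) * \1_(hit m b k) w).

Lemma measurable_hit_discount m b : measurable_fun setT (hit_discount m b).
Proof.
pose F (l : seq 'I_(m * 2 ^ m).+1) w := \big[Num.max/0]_(k <- l)
    (expR (- r * grid_point (mesh m) k) * \1_(hit m b k) w).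
suff H : forall l, measurable_fun setT (F l) by exact: H.
elim=> [|k l IH].
  by rewrite (_ : F [::] = cst 0)//; apply/funext => w; rewrite /F big_nil.
rewrite (_ : F (k :: l) = fun w => Num.max
    (expR (- r * grid_point (mesh m) k) * \1_(hit m b k) w) (F l w)).
  apply: measurable_maxr => //; apply: measurable_funM => //.
  exact/measurable_indic/measurable_hit.
by apply/funext => w; rewrite /F big_cons.
Qed.

Lemma hit_discount_ge0 m b w : 0 <= hit_discount m b w.
Proof.
exact: bigmax_ge_id.
Qed.

Lemma hit_discount_le m b w (y : R) : 0 <= y ->
  (forall k, (k <= m * 2 ^ m)%N -> hit m b k w -> expR (- r * grid_point (mesh m) k) <= y) ->
  hit_discount m b w <= y.
Proof.
move=> y0 H; apply: bigmax_le => // k _.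
rewrite indicE; case: (boolP (w \in _)) => [|_]; last by rewrite mulr0.
by rewrite inE mulr1 => h; apply: H => //; rewrite -ltnS.
Qed.

Lemma le_hit_discount m b w k : (k <= m * 2 ^ m)%N -> hit m b k w ->
  expR (- r * grid_point (mesh m) k) <= hit_discount m b w.
Proof.
rewrite -ltnS => kK h; rewrite /hit_discount.
apply: le_trans (le_bigmax _ _ (Ordinal kK)).
by rewrite /= indicE mem_set// mulr1.
Qed.

Lemma grid_point_ge0 m k : 0 <= grid_point (mesh m) k :> R.
Proof. by rewrite mulr_ge0// ltW. Qed.

Lemma hit_discount_le1 m b w : hit_discount m b w <= 1.
Proof.
apply: hit_discount_le => // k _ _; apply: expRN_le1 => //; exact: grid_point_ge0.
Qed.

(** When a hit occurs, x times the stopped ratio exceeds b, so the stopped martingale times x^eta is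
    at least b^eta times the discount of the first hit; its mean is known. *)
Lemma hit_discount_upper m b : 0 < b ->
  ((b `^ eta)%:E * \int[Q]_w (hit_discount m b w)%:E <= (x `^ eta)%:E * Q setT)%E.
Proof.
move=> b0; have [mS ES] := stopped_ratio m b (m * 2 ^ m).
rewrite -ES -!ge0_integralZl_EFin ?powR_ge0//; last 4 first.
- by move=> w _; rewrite lee_fin mulr_ge0 ?expR_ge0 ?powR_ge0.
- exact/measurable_EFinP.
- by move=> w _; rewrite lee_fin hit_discount_ge0.
- by apply/measurable_EFinP; exact: measurable_hit_discount.
apply: ge0_le_integral => //.
- by move=> w _; rewrite lee_fin mulr_ge0 ?powR_ge0 ?hit_discount_ge0.
- apply/measurable_EFinP; apply: measurable_funM => //; exact: measurable_hit_discount.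
- by apply/measurable_EFinP; exact: measurable_funM.
move=> w _; rewrite -EFinM lee_fin -ler_pdivlMl ?powR_gt0//.
set si := stop_index _ _ _.
apply: hit_discount_le.
  by rewrite mulr_ge0 ?invr_ge0 ?powR_ge0// mulr_ge0 ?powR_ge0// mulr_ge0 ?expR_ge0 ?powR_ge0.
move=> k kK hk; rewrite ler_pdivlMl ?powR_gt0//.
have wN : w \notin alive (hit m b) (m * 2 ^ m).
  by apply/negP; rewrite inE => /(_ k kK).
have hs : b < x * ratio_walk m si w := stop_index_hit wN.
have sk : (si <= k)%N.
  rewrite leqNgt; apply/negP => ks.
  have := stop_index_alive_lt ks.
  by move=> /(_ k (leqnn k)).
rewrite [leRHS]mulrCA [leLHS]mulrC.
rewrite -powRM ?ratio_walk_ge0// ler_pM ?expR_ge0 ?powR_ge0//.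
- by apply: expRN_ler => //; rewrite ler_pM2r// ler_nat.
- apply: ge0_ler_powR; rewrite ?nnegrE; [exact: ltW|exact: ltW| |exact: ltW].
  by rewrite mulr_ge0 ?ratio_walk_ge0.
Qed.

End hitting.

Lemma mesh_small (R : realType) (e : R) : 0 < e ->
  exists m0, forall m, (m0 <= m)%N -> mesh m < e.
Proof.
move=> e0; exists (Num.bound e^-1) => m Hm.
have e1 : 0 < e^-1 by rewrite invr_gt0.
rewrite /mesh -[ltRHS]invrK ltf_pV2 ?posrE ?exprn_gt0//.
apply: (lt_le_trans (archi_boundP (ltW e1))).
by rewrite -natrX ler_nat (leq_trans Hm)// ltnW// ltn_expl.
Qed.

Lemma grid_point_between (R : realType) (u t : R) : 0 <= u -> u < t ->
  exists m k, [/\ (k <= m * 2 ^ m)%N, u < grid_point (mesh m) k & grid_point (mesh m) k < t].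
Proof.
move=> u0 ut; have [m0 Hm] := mesh_small (e := t - u) ltac:(by rewrite subr_gt0).
pose m := maxn m0 (Num.bound t); have mu := Hm m (leq_maxl _ _).
have m_gt0 : 0 < mesh m :> R := mesh_gt0 R m.
have um0 : 0 <= u / mesh m by rewrite divr_ge0// ltW.
have /andP[h1 h2] := truncn_itv um0; pose k := (Num.truncn (u / mesh m)).+1.
have kt : grid_point (mesh m) k < t.
  rewrite /grid_point /k -natr1 mulrDl mul1r.
  rewrite -(ler_pM2r m_gt0) divfK ?gt_eqF// in h1; lra.
exists m, k; split => //; last by rewrite /grid_point -ltr_pdivrMr.
rewrite -(ler_nat R) -(ler_pM2r m_gt0) mesh_mul; apply: (le_trans (ltW kt)).
have t0 : 0 <= t by apply: ltW; exact: le_lt_trans ut.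
by apply: (le_trans (ltW (archi_boundP t0))); rewrite ler_nat leq_maxr.
Qed.

(** * The crossing time along a single path *)

Section path_ratio.
Context (R : realType) (arm : bool -> levy_arm R) (i : bool).
Variables (kappa c : R) (z : R -> R) (n : R -> nat) (j : nat -> R).
Hypothesis gp : good_path arm i z n j.
Local Notation jr := (jump_ratio arm).

Definition log_drift (t : R) : R := - kappa * z t + c * t.
Definition jump_factor (m : nat) : R := \prod_(k < m) jr (j k).
Definition path_ratio (t : R) : R := expR (log_drift t) * jump_factor (n t).
(** Only jumps strictly before t count, in accordance with the belief. It is the left limit of
    [path_ratio] for t > 0. *)
Definition left_ratio (t : R) : R :=
  expR (log_drift t) * \big[*%R/1]_(k \in jumps_before n t) jr (j k).

Lemma log_drift_continuous : {within [set t : R | 0 <= t], continuous log_drift}.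
Proof.
move=> t; apply: cvgD; apply: cvgM; [exact: cvg_cst|exact: (good_cont gp)|exact: cvg_cst|].
by apply: (@continuous_subspaceT _ _ _ id) => y; exact: cvg_id.
Qed.

Lemma jump_factor_ge0 m : 0 <= jump_factor m.
Proof. by apply: prodr_ge0 => k _; exact: jump_ratio_ge0. Qed.

Lemma jump_factor_le m m' : (m <= m')%N -> jump_factor m' <= jump_factor m.
Proof.
move=> /subnKC <-; rewrite /jump_factor big_split_ord /= ler_piMr ?jump_factor_ge0//.
by apply: prodr_ile1 => k _; rewrite jump_ratio_ge0 jump_ratio_le1.
Qed.

Lemma path_ratio_step u v : 0 <= u -> u <= v ->
  path_ratio v <= expR (log_drift v - log_drift u) * path_ratio u.
Proof.
move=> u0 uv; rewrite mulrA -expRD subrK ler_pM2l ?expR_gt0//.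
by apply: jump_factor_le; exact: (good_mono gp).
Qed.

Lemma path_ratio0 : path_ratio 0 = 1.
Proof.
by rewrite /path_ratio /log_drift (good_z0 gp) (good_n0 gp) !mulr0 addr0 expR0
  /jump_factor big_ord0 mulr1.
Qed.

(** The set of jumps before t is an initial segment, whose length m is the largest value of [n] on
    [0, t[; it exists since [n t] is an upper bound. *)
Lemma jumps_beforeE t : 0 <= t -> exists m, [/\ jumps_before n t = `I_m, (m <= n t)%N,
  (forall u, 0 <= u < t -> (n u <= m)%N) & (t = 0 -> m = 0%N)].
Proof.
rewrite le_eqVlt => /predU1P[<-|t0].
  exists 0%N; split => //; last by move=> u; case: ltP.
  by apply/seteqP; split => k //= [u]; case: ltP.
pose pr m := `[< exists2 u, 0 <= u < t & n u = m >].
have ex : exists m, pr m by exists (n 0); apply/asboolP; exists 0; rewrite ?lexx.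
have ub m : pr m -> (m <= n t)%N.
  by move=> /asboolP[u /andP[u0 ut] <-]; apply: (good_mono gp) => //; exact: ltW.
case: (ex_maxnP ex ub) => m prm maxm; exists m; split.
- apply/seteqP; split => k /=.
    by move=> [u ut ku]; apply: (leq_trans ku); apply: maxm; apply/asboolP; exists u.
  by move=> km; move/asboolP: prm => [u ut um]; exists u => //; rewrite um.
- exact: ub.
- by move=> u ut; apply: maxm; apply/asboolP; exists u.
- by move=> tE; rewrite tE ltxx in t0.
Qed.

Lemma left_ratioE m t : jumps_before n t = `I_m ->
  left_ratio t = expR (log_drift t) * jump_factor m.
Proof. by move=> E; rewrite /left_ratio E -fsbig_ord. Qed.

Variables (r x : R).
Hypotheses (r0 : 0 < r) (x0 : 0 <= x).

Definition crossing_time : \bar R :=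
  ereal_inf [set t%:E | t in [set t : R | 0 <= t /\ 1 <= x * left_ratio t]].

Definition discount (tau : \bar R) : R := if tau is t%:E then expR (- r * t) else 0.

Lemma discount_ge0 tau : 0 <= discount tau.
Proof. by case: tau => //= t; exact: expR_ge0. Qed.

Lemma crossing_time_ge0 : (0 <= crossing_time)%E.
Proof. by apply: le_ereal_inf_tmp => _ [t [t0 _] <-]; rewrite lee_fin. Qed.

(** Jumps only lower the ratio, so the left limit is at least the value at t. *)
Lemma crossing_time_le t : 0 <= t -> 1 < x * path_ratio t -> (crossing_time <= t%:E)%E.
Proof.
move=> t0 xt; apply: ereal_inf_lbound; exists t => //; split => //.
have [m [E mn _ _]] := jumps_beforeE t0.
rewrite (left_ratioE E) (le_trans (ltW xt))//.
by rewrite ler_wpM2l// ler_pM2l ?expR_gt0// jump_factor_le.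
Qed.

Lemma discount_crossing_ge t : 0 <= t -> 1 < x * path_ratio t ->
  expR (- r * t) <= discount crossing_time.
Proof.
move=> t0 xt; have := crossing_time_le t0 xt; have := crossing_time_ge0.
case: crossing_time => //= u; rewrite !lee_fin => u0 ut.
exact: expRN_ler.
Qed.

(* The left limit of the ratio reaches 1 at the crossing, so every level      *)
(* [b < 1] is exceeded on a fine grid shortly before.                         *)
Lemma discount_crossing_le (b y : R) : 0 < b -> b < 1 -> 0 <= y ->
  (forall m k, (k <= m * 2 ^ m)%N -> b < x * path_ratio (grid_point (mesh m) k) ->
    expR (- r * grid_point (mesh m) k) <= y) ->
  discount crossing_time <= y.
Proof.
move=> b0 b1 y0 H.
(* No attainment of the infimum is used: the bound is shown for every v beyond the crossing time,
   and then v decreases to it. *)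
have key v : (crossing_time < v%:E)%E -> expR (- r * v) <= y.
  move=> /ereal_inf_lt[_ [t [t0 xt] <-]]; rewrite lte_fin => tv.
  apply: (@le_trans _ _ (expR (- r * t))); first exact/expRN_ler/ltW.
  have [m [E mn Hm m0]] := jumps_beforeE t0.
  rewrite (left_ratioE E) in xt.
  (* At time 0 both ratios are 1, so x >= 1 > b and the grid point 0 is already a hit. *)
  move: (t0); rewrite le_eqVlt => /predU1P[tE|t_gt0].
    have := H 0%N 0%N (leqnn _); rewrite /grid_point mul0r -tE path_ratio0; apply.
    apply: (lt_le_trans b1); move: xt.
    by rewrite m0// /jump_factor big_ord0 -tE /log_drift (good_z0 gp) !mulr0 addr0 expR0 !mulr1.
  (* The level b < 1 leaves room [- ln b] in the exponent. By continuity the drift part at a grid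
     point shortly before t loses less than this, and fewer jumps have occurred there. *)
  have lb : 0 < - ln b by rewrite oppr_gt0 ln_lt0// b0.
  have [dl dl0 Hdl] := within_continuous_eps log_drift_continuous t0 lb.
  pose u := Num.max 0 (t - dl).
  have ut : u < t by rewrite gt_max t_gt0 /= ltrBlDr ltrDl.
  have u0 : 0 <= u by rewrite le_max lexx.
  have [m' [k [km uk kt]]] := grid_point_between u0 ut.
  set g := grid_point _ _ in uk kt; have g0 : 0 <= g by apply: ltW; exact: le_lt_trans uk.
  apply: (@le_trans _ _ (expR (- r * g))); first exact/expRN_ler/ltW.
  apply: H => //; rewrite -/g.
  have ld : log_drift t + ln b < log_drift g.
    have : `|g - t| < dl.
      rewrite distrC ger0_norm; last by rewrite subr_ge0 ltW.
      by move: uk; rewrite gt_max => /andP[_]; lra.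
    by move=> /(Hdl _ g0); rewrite ltr_norml => /andP[]; lra.
  have xj0 : 0 < x * jump_factor m.
    rewrite lt0r mulr_ge0 ?jump_factor_ge0// andbT; apply/eqP => xj.
    by move: xt; rewrite mulrCA xj mulr0 ler10.
  have ng : (n g <= m)%N by apply: Hm; rewrite g0.
  apply: (@lt_le_trans _ _ (expR (log_drift g) * (x * jump_factor m))); last first.
    by rewrite mulrCA ler_wpM2l// ler_pM2l ?expR_gt0// jump_factor_le.
  have : expR (log_drift t + ln b) * (x * jump_factor m)
      < expR (log_drift g) * (x * jump_factor m) by rewrite ltr_pM2r// ltr_expR.
  apply: le_lt_trans; rewrite expRD lnK ?posrE// mulrAC -[leLHS]mul1r ler_pM2r//.
  by rewrite mulrCA.
(* The time t + e / r costs at most e in the discount, because the discount density is at most r. *)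
move: key; have := crossing_time_ge0; case: crossing_time => //= t t0 key.
apply/ler_addgt0Pr => e e0.
have := key (t + e / r); rewrite lte_fin ltrDl divr_gt0// => /(_ isT) h.
have := expRN_diff_le r t (t + e / r); rewrite (_ : t + e / r - t = e / r); last by ring.
have h2 := discount_density_le r0 t0.
have : discount_density r t * (e / r) <= r * (e / r) by rewrite ler_wpM2r// divr_ge0 ?ltW.
by rewrite [r * _]mulrC divfK ?gt_eqF//; lra.
Qed.

End path_ratio.

Lemma ae_eq_of_integral_le d (T : measurableType d) (R : realType)
    (mu : {measure set T -> \bar R}) (f g : T -> R) :
  mu.-integrable setT (EFin \o f) -> mu.-integrable setT (EFin \o g) ->
  {ae mu, forall w, f w <= g w} ->
  (\int[mu]_w (g w)%:E <= \int[mu]_w (f w)%:E)%E ->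
  {ae mu, forall w, f w = g w}.
Proof.
move=> fi gi fg gf.
pose h w := g w - f w.
have hi : mu.-integrable setT (EFin \o h).
  exact: eq_integrable (integrableB measurableT gi fi).
have mh := measurable_int _ hi.
have E0 : (\int[mu]_w `|(EFin \o h) w| = 0)%E.
  apply/eqP; rewrite eq_le integral_ge0// andbT.
  have -> : (\int[mu]_w `|(EFin \o h) w| = \int[mu]_w ((EFin \o g) w - (EFin \o f) w))%E.
    apply: ae_eq_integral => //.
    - exact: measurableT_comp.
    - by apply: ae_imp fg => w hw _ /=; rewrite ger0_norm ?subr_ge0.
  by rewrite integralB// sube_le0.
have := (ae_eq_integral_abs mu measurableT mh).1 E0.
by apply: ae_imp => w /(_ I) /= [] /eqP; rewrite subr_eq0 => /eqP.
Qed.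

(** * First passages on finer and finer grids *)

Section hitting_limit.
Context d (T : measurableType d) (R : realType) (P : probability T R).
Variables (arm : bool -> levy_arm R) (p0 : R) (theta : {RV P >-> bool})
  (Z : R -> {RV P >-> R}) (N : bool -> R -> {RV P >-> nat})
  (J : bool -> nat -> {RV P >-> R}).
Hypothesis model : bandit_model arm p0 theta Z N J.
Hypothesis A3 : forall A : set (measurableTypeR R), measurable A ->
  (levy (arm false) A <= levy (arm true) A)%E.
Variables (i : bool) (kappa c r eta Phi x : R).
Hypotheses (r0 : 0 < r) (eta0 : 0 < eta) (x0 : 0 <= x) (x1 : x <= 1).
Hypothesis EPhi : (\int[levy (arm i)]_h (jump_ratio arm h `^ eta)%:E = Phi%:E)%E.
Hypothesis exponent0 : - r + eta ^+ 2 * kappa ^+ 2 / 2 + eta * c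
  + (Phi - levy_mass (arm i)) = 0.
Local Notation Q := (restriction P (measurable_type_event theta i)).
Local Notation good w := (good_path arm i (fun t => Z t w) (fun t => N i t w)
  (fun k => J i k w)).
Local Notation ratio w := (path_ratio arm kappa c (fun t => Z t w) (fun t => N i t w)
  (fun k => J i k w)).
Local Notation walk_ratio := (ratio_walk arm Z N J i kappa c).
Local Notation hits := (hit arm Z N J i kappa c x).
Local Notation hd := (hit_discount arm Z N J i kappa c r x).
Local Notation cross w := (crossing_time arm kappa c (fun t => Z t w)
  (fun t => N i t w) (fun k => J i k w) x).

Let mesh0 m : 0 < mesh m :> R := mesh_gt0 R m.

Lemma grid_pointS m k : grid_point (mesh m) k.+1 = grid_point (mesh m) k + mesh m :> R.
Proof. by rewrite /grid_point -natr1 mulrDl mul1r. Qed.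

Lemma count_grid m k w : good w ->
  count (count_increment N i (mesh m)) k w = N i (grid_point (mesh m) k) w.
Proof.
move=> gw; elim: k => [|k IH].
  by rewrite /count big_ord0 /grid_point mul0r (good_n0 gw).
rewrite /count big_ord_recr /= -/(count _ k w) IH subnKC//.
apply: (good_mono gw); first exact: grid_point_ge0.
by rewrite grid_pointS lerDl ltW.
Qed.

Lemma mark_good w k t : good w -> 0 <= t -> (k < N i t w)%N -> mark arm J i k w = J i k w.
Proof.
move=> gw t0 kt; rewrite /mark; case: eqP => // l0.
by move: kt; rewrite (good_nojump gw l0).
Qed.

Lemma ratio_walkE m k w : good w -> walk_ratio m k w = ratio w (grid_point (mesh m) k).
Proof.
move=> gw; rewrite /ratio_walk /walk /path_ratio count_grid//; congr (_ * _); last first.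
  apply: eq_bigr => j _; rewrite (mark_good gw _ (ltn_ord j))//.
  exact: grid_point_ge0.
elim: k => [|k IH].
  rewrite big_ord0 /log_drift /grid_point mul0r (good_z0 gw) !mulr0 addr0.
  by rewrite expR0.
rewrite big_ord_recr /= IH /ratio_factor -expRD; congr expR.
have -> : log_drift kappa c (fun t => Z t w) (grid_point (mesh m) k.+1) =
  - kappa * Z (grid_point (mesh m) k.+1) w + (c * grid_point (mesh m) k + c * mesh m).
  by rewrite /log_drift [X in c * X]grid_pointS mulrDr.
rewrite /brownian_increment /log_drift; ring.
Qed.

(** Grid points of one level belong to the next and the horizon grows, so no hit is lost by
    refinement. *)
Lemma hit_discount_mono m m' b w : good w -> (m <= m')%N -> hd m b w <= hd m' b w.
Proof.
move=> gw /subnKC <-; elim: (m' - m)%N => [|q IH]; first by rewrite addn0.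
apply: (le_trans IH); rewrite addnS; set l := (m + q)%N.
apply: hit_discount_le => [|k kl hk]; first exact: hit_discount_ge0.
rewrite -mesh_refine; apply: le_hit_discount.
  by rewrite expnS mulnCA leq_pmul2l// (leq_trans kl)// leq_pmul2r ?expn_gt0.
by move: hk; rewrite /hit /= !ratio_walkE// mesh_refine.
Qed.

Lemma hit_discount_anti m b b' w : b <= b' -> hd m b' w <= hd m b w.
Proof.
move=> bb; apply: hit_discount_le => [|k kl hk]; first exact: hit_discount_ge0.
by apply: le_hit_discount => //; exact: le_lt_trans hk.
Qed.

Let integrable_const (a : R) : Q.-integrable setT (EFin \o cst a).
Proof. exact: finite_measure_integrable_cst. Qed.

Let mhd m b : measurable_fun setT (hd m b).
Proof. exact: (measurable_hit_discount model A3). Qed.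

Let ae_good : {ae Q, forall w, good w}.
Proof.
by apply: ae_restriction; apply: ae_imp (ae_good_path model A3 i) => w h _.
Qed.

Lemma hit_discount_limit b : exists D : T -> R,
  [/\ measurable_fun setT D, Q.-integrable setT (EFin \o D),
   {ae Q, forall w, [/\ (forall m, hd m b w <= D w),
     (forall y, (forall m, hd m b w <= y) -> D w <= y) &
     hd m b w @[m --> \oo] --> D w]} &
   (\int[Q]_w (hd m b w)%:E @[m --> \oo] --> \int[Q]_w (D w)%:E)%E].
Proof.
pose f w := sup (range (fun m => hd m b w)).
have ub w : has_ubound (range (fun m => hd m b w)).
  by exists 1 => _ [m _ <-]; exact: hit_discount_le1.
have cv w : good w -> hd m b w @[m --> \oo] --> f w.
  move=> gw; apply: nondecreasing_cvgn; last exact: ub.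
  by move=> m m' mm; exact: hit_discount_mono.
have dom : {ae Q, forall w, forall m, (`|hd m b w|%:E <= (EFin \o cst 1%R) w)%E}.
  by apply: aeW => w m; rewrite lee_fin ger0_norm ?hit_discount_ge0 ?hit_discount_le1.
have [D [mD DE iD cD]] := @dominated_ae _ _ _ Q (fun m => hd m b) f (EFin \o cst 1)
  (mhd^~ b) (integrable_const 1) dom
  (ae_imp cv ae_good).
exists D; split => //.
apply: ae_imp (ae_and DE ae_good) => w [-> gw]; split.
- by move=> m; apply: ub_le_sup => //; exists m.
- move=> y Hy; apply: ge_sup; first by exists (hd 0%N b w); exists 0%N.
  by move=> _ [m _ <-].
- exact: cv.
Qed.

(** By optional stopping the martingale, stopped at the first hit or at L, has mean x^eta Q after
    scaling. It exceeds the discount of the hit plus exp(-r L) only by an overshoot [E m]. Jumps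
    being downward, one grid step raises the ratio by no more than the modulus of continuity of its
    exponent, so the overshoot tends to 0 on every good path. *)
Let hit_discount_lower (D : T -> R) :
  (\int[Q]_w (hd m 1 w)%:E @[m --> \oo] --> \int[Q]_w (D w)%:E)%E ->
  forall L : nat, ((x `^ eta)%:E * Q setT <= \int[Q]_w (D w)%:E
    + (expR (- r * L%:R))%:E * Q setT)%E.
Proof.
move=> cD L; pose s m w := stop_index (hits m 1) (L * 2 ^ m) w.
pose S m w := x `^ eta * (expR (- r * grid_point (mesh m) (s m w)) *
  walk_ratio m (s m w) w `^ eta).
have S0 m w : 0 <= S m w by rewrite !mulr_ge0 ?powR_ge0 ?expR_ge0.
have mS m : measurable_fun setT (S m).
  by apply: measurable_funM => //; exact: (stopped_ratio model A3 x EPhi exponent0 m 1 _).1.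
have ES m : (\int[Q]_w (S m w)%:E = (x `^ eta)%:E * Q setT)%E.
  have [m1 E1] := stopped_ratio model A3 x EPhi exponent0 m 1 (L * 2 ^ m).
  rewrite -E1 -ge0_integralZl_EFin ?powR_ge0//.
  - by move=> w _; rewrite lee_fin mulr_ge0 ?expR_ge0 ?powR_ge0.
  - exact/measurable_EFinP.
pose eL := expR (- r * L%:R).
pose E m w := Num.max (S m w - hd m 1 w - eL) 0.
have E0 m w : 0 <= E m w by rewrite le_max lexx orbT.
have mE m : measurable_fun setT (E m).
  apply: measurable_maxr => //; apply: measurable_funB => //.
  by apply: measurable_funB => //; exact: mhd.
have sL m w : grid_point (mesh m) (s m w) <= L%:R :> R.
  apply: (@le_trans _ _ ((L * 2 ^ m)%:R * mesh m)); last by rewrite mesh_mul.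
  by rewrite /grid_point ler_wpM2r ?ler_nat ?stop_index_le//; exact: ltW.
have cE w : good w -> E m w @[m --> \oo] --> (0 : R).
  move=> gw; apply/cvgrPdist_le => e e0.
  pose om := ln (1 + e) / eta.
  have om0 : 0 < om by rewrite divr_gt0// ln_gt0// ltrDl.
  have [dl dl0 Hdl] := unif_continuous_segment (@log_drift_continuous R arm i kappa c _ _ _ gw) L%:R om0.
  have [m0 Hm0] := mesh_small dl0.
  exists (maxn m0 L) => // m /=; rewrite geq_max => /andP[m0m Lm].
  rewrite sub0r normrN ger0_norm// ge_max (ltW e0) andbT.
  have xle : x * walk_ratio m (s m w) w <= expR om.
    (* Stopping at index 0 is covered by x <= 1. Otherwise the previous grid point was not a hit, so
       x times the ratio was at most 1 there. *)
    rewrite ratio_walkE//; case: (posnP (s m w)) => [->|sp].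
      rewrite /grid_point mul0r (path_ratio0 kappa c gw) mulr1 (le_trans x1)//.
      by rewrite -expR0 ler_expR ltW.
    have [s' Es] : exists s', s m w = s'.+1 by exists (s m w).-1; rewrite prednK.
    have : alive (hits m 1) s' w.
      by apply: (@stop_index_alive_lt _ _ _ (L * 2 ^ m)); rewrite -/(s m w) Es.
    move=> /(_ s' (leqnn _)); rewrite /hit /= ratio_walkE// => /negP; rewrite -leNgt => xs'.
    have g0 : 0 <= grid_point (mesh m) s' :> R by exact: grid_point_ge0.
    have gS : grid_point (mesh m) s' <= grid_point (mesh m) s'.+1 :> R.
      by rewrite grid_pointS lerDl ltW.
    rewrite Es; apply: (le_trans (ler_wpM2l x0 (path_ratio_step kappa c gw g0 gS))).
    rewrite mulrCA -[leRHS]mulr1 ler_pM ?expR_ge0//.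
      by rewrite mulr_ge0// mulr_ge0 ?expR_ge0// jump_factor_ge0.
    rewrite ler_expR ltW// (le_lt_trans (ler_norm _))// Hdl ?(le_trans g0 gS)//.
      by apply: le_trans (sL m w); rewrite Es.
    by rewrite grid_pointS addrAC subrr add0r gtr0_norm// Hm0.
  have S_le : S m w <= expR (- r * grid_point (mesh m) (s m w)) * (1 + e).
    rewrite /S mulrCA ler_pM2l ?expR_gt0// -powRM ?ratio_walk_ge0//.
    have -> : 1 + e = (expR om) `^ eta.
      by rewrite -expRM divfK ?gt_eqF// lnK// posrE addr_gt0.
    apply: ge0_ler_powR; rewrite ?nnegrE ?expR_ge0 ?(ltW eta0)//.
    by rewrite mulr_ge0 ?ratio_walk_ge0.
  have e_le : expR (- r * grid_point (mesh m) (s m w)) <= hd m 1 w + eL.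
    case: (boolP (w \in alive (hits m 1) (L * 2 ^ m))) => [wA|wN].
      rewrite /s stop_index_alive// /grid_point mesh_mul lerDr.
      exact: hit_discount_ge0.
    apply: ler_wpDr; first exact: expR_ge0.
    apply: le_hit_discount; last exact: stop_index_hit wN.
    by rewrite (leq_trans (stop_index_le _ _ _))// leq_pmul2r ?expn_gt0.
  have e1 : expR (- r * grid_point (mesh m) (s m w)) <= 1.
    by apply: expRN_le1 => //; exact: grid_point_ge0.
  rewrite -addrA -opprD lerBlDr; apply: (le_trans S_le).
  by rewrite mulrDr mulr1 addrC lerD// -[leRHS]mul1r ler_pM2r.
(* Domination: the stopped martingale is at most a constant times exp(eta |kappa| |Z|). The added 1
   keeps the parameter positive when kappa is 0. *)
pose a := eta * `|kappa| + 1.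
have a0 : 0 < a by rewrite ltr_wpDl// mulr_ge0// ltW.
have [C C0 /(_ L)[H [mH H0 iH HH]]] := brownian_envelope model i a0.
pose K := x `^ eta * expR (eta * (`|c| * L%:R)).
have K0 : 0 <= K by rewrite mulr_ge0 ?powR_ge0 ?expR_ge0.
have bE : {ae Q, forall w, forall m, (`|E m w|%:E <= K%:E * H w)%E}.
  apply: ae_imp ae_good => w gw m.
  have gs0 : 0 <= grid_point (mesh m) (s m w) :> R by exact: grid_point_ge0.
  have h1 : E m w <= S m w.
    rewrite ge_max S0 andbT -addrA -opprD gerBl addr_ge0 ?hit_discount_ge0//.
    exact: expR_ge0.
  rewrite ger0_norm//; apply: (@le_trans _ _ (K * expR (a *
      `|Z (grid_point (mesh m) (s m w)) w - Z 0 w|))%:E); last first.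
    by rewrite EFinM; apply: lee_pmul => //; rewrite ?lee_fin ?expR_ge0//;
       apply: HH; exact: stop_index_le.
  rewrite lee_fin (le_trans h1)// /S /K -!mulrA ler_wpM2l ?powR_ge0//.
  rewrite -expRD -[leRHS]mul1r ler_pM ?expR_ge0 ?powR_ge0//; first exact: expRN_le1.
  apply: (@le_trans _ _ (expR (log_drift kappa c (fun t => Z t w)
      (grid_point (mesh m) (s m w))) `^ eta)).
    apply: ge0_ler_powR; rewrite ?nnegrE ?expR_ge0 ?ratio_walk_ge0 ?(ltW eta0)//.
    rewrite ratio_walkE// /path_ratio -[leRHS]mulr1 ler_pM2l ?expR_gt0//.
    by apply: prodr_ile1 => k _; rewrite jump_ratio_ge0 jump_ratio_le1.
  rewrite -expRM ler_expR (good_z0 gw) subr0 /log_drift /a.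
  set zt := Z _ w; set t := grid_point _ _ in gs0 *.
  have tL : t <= L%:R := sL m w.
  have h2 : - kappa * zt <= `|kappa| * `|zt| by rewrite -normrM (le_trans (ler_norm _))// mulNr normrN.
  have h3 : c * t <= `|c| * L%:R.
    by rewrite (le_trans (ler_norm _))// normrM ler_wpM2l// ger0_norm.
  rewrite mulrC (le_trans (ler_wpM2l (ltW eta0) (lerD h2 h3)))//.
  by rewrite -subr_ge0 (_ : _ - _ = `|zt|)//; ring.
have iKH : Q.-integrable setT (fun w => K%:E * H w)%E.
  apply: integrableZl => //; apply/integrableP; split => //.
  under eq_integral do rewrite gee0_abs//.
  by apply: (le_lt_trans iH); rewrite ltry.
have [f' [mf' f'0 if' cf']] := dominated_ae mE iKH bE (ae_imp cE ae_good).
have If' : (\int[Q]_w (f' w)%:E = 0)%E.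
  rewrite (ae_eq_integral (cst 0%E))//; first by rewrite integral0.
    exact/measurable_EFinP.
  by apply: ae_imp f'0 => w /= -> _.
rewrite If' in cf'.
have fin_D : (\int[Q]_w (D w)%:E \is a fin_num)%E.
  have lo : (0 <= \int[Q]_w (D w)%:E)%E.
    apply: cvge_to_ge cD _; apply: nearW => m.
    by apply: integral_ge0 => w _; rewrite lee_fin hit_discount_ge0.
  rewrite ge0_fin_numE//; apply: (@le_lt_trans _ _ (Q setT)); last first.
    by rewrite ltey_eq fin_num_measure.
  apply: cvge_to_le cD _; apply: nearW => m.
  rewrite -[leRHS]mul1e -integral_cst//; apply: ge0_le_integral => //.
  - by move=> w _; rewrite lee_fin hit_discount_ge0.
  - by apply/measurable_EFinP; exact: mhd.
  - by move=> w _; rewrite lee_fin hit_discount_le1.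
have eLQ : (eL%:E * Q setT \is a fin_num)%E by rewrite fin_numM// fin_num_measure.
have lim : ((\int[Q]_w (hd m 1 w)%:E + eL%:E * Q setT + \int[Q]_w (E m w)%:E)%E
    @[m --> \oo] --> (\int[Q]_w (D w)%:E + eL%:E * Q setT + 0)%E).
  apply: cvgeD => //; first by rewrite fin_num_adde_defl.
  apply: cvgeD => //; first by rewrite fin_num_adde_defl.
  exact: cvg_cst.
rewrite adde0 in lim; apply: cvge_to_ge lim _; apply: nearW => m.
have mh : measurable_fun setT (EFin \o hd m 1) by exact/measurable_EFinP/mhd.
have mEe : measurable_fun setT (EFin \o E m) by exact/measurable_EFinP.
have h0 w : [set: T] w -> (0 <= (EFin \o hd m 1) w)%E.
  by rewrite lee_fin hit_discount_ge0.
have c0 w : [set: T] w -> (0 <= cst eL%:E w)%E by rewrite lee_fin expR_ge0.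
have hc0 w : [set: T] w -> (0 <= (EFin \o hd m 1) w + cst eL%:E w)%E.
  by move=> ?; rewrite adde_ge0 ?h0 ?c0.
have Ee0 w : [set: T] w -> (0 <= (EFin \o E m) w)%E by rewrite lee_fin.
have mhc : measurable_fun setT (fun w => (EFin \o hd m 1) w + cst eL%:E w)%E.
  exact: emeasurable_funD.
rewrite -(ES m) -integral_cst//.
rewrite -[X in (_ <= X + _)%E](ge0_integralD Q measurableT h0 mh c0 (measurable_cst _)).
rewrite -(ge0_integralD Q measurableT hc0 mhc Ee0 mEe).
apply: ge0_le_integral => //.
- by move=> w _; rewrite lee_fin.
- exact/measurable_EFinP.
- exact: emeasurable_funD.
move=> w _; rewrite -!EFinD lee_fin.
have : S m w - hd m 1 w - eL <= E m w by rewrite le_max lexx.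
by rewrite /=; lra.
Qed.

(* The crossing time is the limit of the first passages on the grids, and its *)
(* Laplace transform is [x `^ eta].                                           *)
Lemma crossing_discount : exists S : T -> R,
  [/\ measurable_fun setT S, Q.-integrable setT (EFin \o S),
   {ae Q, forall w, S w = discount r (cross w)},
   {ae Q, forall w, hd m 1 w @[m --> \oo] --> S w} &
   (\int[Q]_w (S w)%:E = (x `^ eta)%:E * Q setT)%E].
Proof.
have [D [mD iD aeD cD]] := hit_discount_limit 1.
(* Levels increasing to 1; hits at these levels detect the crossing from before. *)
pose b l : R := expR (- mesh l).
have b0 l : 0 < b l by exact: expR_gt0.
have b1 l : b l < 1 by rewrite expR_lt1 oppr_lt0.
have [F HF] := choice (fun l => hit_discount_limit (b l)).
have mF l : measurable_fun setT (F l) by have [] := HF l.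
have aeF : {ae Q, forall w, forall l, [/\ (forall m, hd m (b l) w <= F l w),
     (forall y, (forall m, hd m (b l) w <= y) -> F l w <= y) &
     hd m (b l) w @[m --> \oo] --> F l w]}.
  by apply: ae_foralln => l; have [] := HF l.
have bnd l w (Fw : forall l, [/\ (forall m, hd m (b l) w <= F l w),
     (forall y, (forall m, hd m (b l) w <= y) -> F l w <= y) &
     hd m (b l) w @[m --> \oo] --> F l w]) : 0 <= F l w <= 1.
  have [h1 h2 _] := Fw l; rewrite (le_trans (hit_discount_ge0 _ _ _ _ _ _ _ _ _ _ _ _) (h1 0%N))/=.
  by apply: h2 => m; exact: hit_discount_le1.
pose g w := inf (range (F ^~ w)).
have cg : {ae Q, forall w, F l w @[l --> \oo] --> g w}.
  apply: ae_imp aeF => w Fw; apply: nonincreasing_cvgn.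
    move=> l l' ll; have [h1 _ _] := Fw l; have [_ h2 _] := Fw l'.
    apply: h2 => m; apply: le_trans (h1 m); apply: hit_discount_anti.
    rewrite ler_expR lerN2 /mesh lef_pV2 ?posrE ?exprn_gt0//.
    by rewrite ler_weXn2l// ler1n.
  by exists 0 => _ [l _ <-]; have /andP[] := bnd l w Fw.
have dF : {ae Q, forall w, forall l, (`|F l w|%:E <= (EFin \o cst 1%R) w)%E}.
  apply: ae_imp aeF => w Fw l; have /andP[h0 h1] := bnd l w Fw.
  by rewrite lee_fin ger0_norm.
have [G [mG GE iG cG]] := dominated_ae mF (integrable_const 1) dF cg.
(* A grid hit at level 1 comes no earlier than the crossing, and for each b < 1 the first hits at
   level b come, in the limit, no later. The crossing discount thus lies between the two limits [D]
   and [G]. *)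
have sandwich : {ae Q, forall w, D w <= discount r (cross w) <= G w}.
  apply: ae_imp (ae_and (ae_and aeD ae_good) (ae_and aeF (ae_and cg GE))).
  move=> w [[[D1 D2 _] gw] [Fw [cgw ->]]]; apply/andP; split.
    apply: D2 => m; apply: hit_discount_le => [|k km]; first exact: discount_ge0.
    rewrite /hit /= ratio_walkE//; apply: (discount_crossing_ge gw r0 x0).
    exact: grid_point_ge0.
  rewrite -(cvg_lim _ cgw)//; apply: limr_ge; first by apply/cvg_ex; exists (g w).
  apply: nearW => l; have [h1 _ _] := Fw l.
  apply: (discount_crossing_le gw r0 x0 (b0 l) (b1 l)).
    by have /andP[] := bnd l w Fw.
  move=> m k km hk; apply: le_trans (h1 m); apply: le_hit_discount => //.
  by rewrite /hit /= ratio_walkE.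
have Qfin : (Q setT \is a fin_num)%E by rewrite fin_num_measure.
have [q Eq] : exists q, Q setT = q%:E by exists (fine (Q setT)); rewrite fineK.
have finI f : Q.-integrable setT (EFin \o f) -> exists y, (\int[Q]_w (f w)%:E = y%:E)%E.
  by move=> fi; exists (fine (\int[Q]_w (f w)%:E)); rewrite fineK// integrable_fin_num.
have q0 : 0 <= q by rewrite -lee_fin -Eq measure_ge0.
have [iDv EDv] := finI _ iD; have [iGv EGv] := finI _ iG.
have lowD : x `^ eta * q <= iDv.
  have h L : x `^ eta * q <= iDv + expR (- r * L%:R) * q.
    by rewrite -lee_fin EFinD !EFinM -EDv -Eq; exact: hit_discount_lower.
  apply/ler_addgt0Pr => e e0.
  have : (expR (- r * L%:R) * q) @[L --> \oo] --> (0 : R).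
    rewrite -[X in _ --> X](mul0r q); apply: cvgM; last exact: cvg_cst.
    under eq_fun do rewrite mulNr -mulrN mulrC mulNr -mulrN expRM_natl.
    by apply: cvg_expr; rewrite ger0_norm ?expR_ge0// expR_lt1 oppr_lt0.
  move=> /cvgrPdist_lt /(_ e e0)[L _ /(_ L (leqnn L))].
  rewrite /= sub0r normrN ger0_norm ?mulr_ge0 ?expR_ge0// => hL.
  by apply: (le_trans (h L)); rewrite lerD2l ltW.
have uppG : iGv <= x `^ eta * q.
  have iGv0 : 0 <= iGv.
    rewrite -lee_fin -EGv; apply: cvge_to_ge cG _; apply: nearW => l.
    have [_ _ aeFl cl] := HF l; apply: cvge_to_ge cl _; apply: nearW => m.
    by apply: integral_ge0 => w _; rewrite lee_fin hit_discount_ge0.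
  have h l : b l `^ eta * iGv <= x `^ eta * q.
    rewrite -lee_fin !EFinM -Eq -EGv.
    have lim : (((b l `^ eta)%:E * \int[Q]_w (F l' w)%:E)%E @[l' --> \oo] -->
        ((b l `^ eta)%:E * \int[Q]_w (G w)%:E)%E) by apply: cvgeZl.
    apply: cvge_to_le lim _; exists l => // l' /= ll.
    have [_ _ _ cl] := HF l'.
    have lim : (((b l `^ eta)%:E * \int[Q]_w (hd m (b l') w)%:E)%E @[m --> \oo] -->
        ((b l `^ eta)%:E * \int[Q]_w (F l' w)%:E)%E) by apply: cvgeZl.
    apply: cvge_to_le lim _; apply: nearW => m.
    apply: le_trans (hit_discount_upper model A3 r0 eta0 x0 EPhi exponent0 m (b0 l)).
    apply: lee_pmul => //; first by rewrite lee_fin powR_ge0.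
      by apply: integral_ge0 => w _; rewrite lee_fin hit_discount_ge0.
    apply: ge0_le_integral => //.
    - by move=> w _; rewrite lee_fin hit_discount_ge0.
    - exact/measurable_EFinP/mhd.
    - exact/measurable_EFinP/mhd.
    - move=> w _; rewrite lee_fin; apply: hit_discount_anti.
      rewrite ler_expR lerN2 /mesh lef_pV2 ?posrE ?exprn_gt0//.
      by rewrite ler_weXn2l// ler1n.
  apply/ler_addgt0Pr => e e0.
  have d0 : 0 < e / (eta * iGv + 1) by rewrite divr_gt0// ltr_wpDl// mulr_ge0// ltW.
  have [l Hl] := mesh_small d0; have {}Hl := Hl l (leqnn _).
  have := h l; rewrite -expRM => hl.
  have h1 : (1 - mesh l * eta) * iGv <= expR (- mesh l * eta) * iGv.
    by rewrite ler_wpM2r// -mulNr expR_ge1Dx.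
  have h2 : mesh l * (eta * iGv + 1) < e by rewrite -ltr_pdivlMr// ltr_wpDl// mulr_ge0// ltW.
  have := mesh0 l; nra.
exists D; split => //.
(* The bounds on [D] and [G] have integrals in the wrong order, which forces [D] = [G] almost
   everywhere, both equal to the crossing discount. *)
- have DG : {ae Q, forall w, D w <= G w}.
    by apply: ae_imp sandwich => w /andP[]; exact: le_trans.
  have := ae_eq_of_integral_le iD iG DG; rewrite EDv EGv lee_fin => /(_ (le_trans uppG lowD)) eDG.
  apply: ae_imp (ae_and eDG sandwich) => w [e /andP[h1 h2]].
  by apply/eqP; rewrite eq_le h1 e h2.
- by apply: ae_imp aeD => w [].
- apply/eqP; rewrite EDv Eq -EFinM eqe eq_le lowD andbT.
  rewrite -lee_fin EFinM -EDv -Eq; apply: cvge_to_le cD _; apply: nearW => m.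
  have := hit_discount_upper model A3 r0 eta0 x0 EPhi exponent0 m (@ltr01 R).
  by rewrite powR1 mul1e.
Qed.

End hitting_limit.

(** * The compensated payoff *)

(** Summation by parts with nonincreasing weights. Subtracting the boundary term [f m * Y m] makes
    the induction telescope. The bound does not depend on the number of terms, hence not on the
    grid. *)
Lemma abel_bound (R : realType) (f Y : nat -> R) (B : R) (s : nat) :
  (forall k, 0 <= f k) -> (forall k, f k.+1 <= f k) ->
  (forall k, (k <= s)%N -> `|Y k| <= B) ->
  `|\sum_(k < s) f k * (Y k.+1 - Y k)| <= 2 * f 0%N * B.
Proof.
move=> f0 ndf YB.
have key m : (m <= s)%N ->
    `|\sum_(k < m) f k * (Y k.+1 - Y k) - f m * Y m| <= (2 * f 0%N - f m) * B.
  elim: m => [_|m IH ms].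
    rewrite big_ord0 sub0r normrN normrM ger0_norm//.
    have := YB 0%N (leq0n _); have := f0 0%N => h1 h2.
    by rewrite (_ : 2 * f 0%N - f 0%N = f 0%N) ?ler_wpM2l//; ring.
  rewrite big_ord_recr /=.
  rewrite (_ : _ - _ = (\sum_(k < m) f k * (Y k.+1 - Y k) - f m * Y m) +
    (f m - f m.+1) * Y m.+1); last by ring.
  rewrite (_ : _ * B = (2 * f 0%N - f m) * B + (f m - f m.+1) * B); last by ring.
  apply: (le_trans (ler_normD _ _)); apply: lerD; first exact/IH/ltnW.
  by rewrite normrM ger0_norm ?subr_ge0// ler_wpM2l ?subr_ge0 ?YB.
have := key s (leqnn _).
have h : `|f s * Y s| <= f s * B by rewrite normrM ger0_norm// ler_wpM2l ?YB.
set a := \sum_(k < s) _ => h1.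
rewrite (_ : a = (a - f s * Y s) + f s * Y s); last by ring.
apply: (le_trans (ler_normD _ _)); apply: (le_trans (lerD h1 h)).
by rewrite le_eqVlt; apply/orP; left; apply/eqP; ring.
Qed.

Section primitive_limits.
Context (R : realType) (r : R) (Y I : R -> R).
Hypotheses (r0 : 0 < r) (primI : stieltjes_primitive r Y I).

Lemma primitive_right_cvg (u : nat -> R) (v : R) : 0 <= v ->
  (forall m, v <= u m) -> u m @[m --> \oo] --> v -> Y (u m) @[m --> \oo] --> Y v ->
  I (u m) @[m --> \oo] --> I v.
Proof.
move=> v0 vu cu cY; have [V ndV H] := primI.
apply/cvgrPdist_lt => e e0.
have D0 : 0 < V (v + 1) - V v + 1 by rewrite ltr_wpDl// subr_ge0 ndV// lerDl.
have e'0 : 0 < e / 2 / (V (v + 1) - V v + 1) by rewrite !divr_gt0.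
have [delta delta0 {}H] := H (v + 1) _ e'0.
have e20 : 0 < e / (2 * r) by rewrite divr_gt0// mulr_gt0.
have m0 : 0 < Num.min delta 1 by rewrite lt_min delta0 ltr01.
move/cvgrPdist_lt: (cu) => /(_ _ m0) cu'; move/cvgrPdist_lt: cY => /(_ _ e20) cY.
near=> m.
have um : `|v - u m| < Num.min delta 1 by near: m.
have Ym : `|Y v - Y (u m)| < e / (2 * r) by near: m.
have vum := vu m; move: um; rewrite distrC ger0_norm ?subr_ge0// lt_min => /andP[um1 um2].
have um3 : u m <= v + 1 by lra.
have := H v (u m) (u m) v v0 vum (lexx _) um3 (lexx _) vum um1.
have h1 : V (u m) - V v <= V (v + 1) - V v by rewrite lerB// ndV// (le_trans v0).
have h2 : e / 2 / (V (v + 1) - V v + 1) * (V (u m) - V v) < e / 2.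
  rewrite mulrAC ltr_pdivrMr// ltr_pM2l ?divr_gt0//; lra.
have h3 : `|discount_density r v * (Y (u m) - Y v)| < e / 2.
  rewrite normrM distrC ger0_norm ?discount_density_ge0//.
  have : discount_density r v * `|Y v - Y (u m)| <= r * `|Y v - Y (u m)|.
    by rewrite ler_wpM2r// discount_density_le.
  move=> h; apply: (le_lt_trans h).
  by rewrite mulrC -ltr_pdivlMr// (lt_le_trans Ym)// invfM mulrA.
rewrite distrC => h4.
rewrite (_ : I v - I (u m) = - ((I (u m) - I v - discount_density r v * (Y (u m) - Y v))
  + discount_density r v * (Y (u m) - Y v))); last by ring.
rewrite normrN (le_lt_trans (ler_normD _ _))// [ltRHS](splitr e).
by apply: ltrD => //; apply: (le_lt_trans _ h2); rewrite distrC.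
Unshelve. all: by end_near. Qed.

(** The sum up to a grid point approximates the increment of [I] up to that point; right continuity
    of [I], inherited from [Y] along the sequence, then brings the end point to v. *)
Lemma grid_sum_cvg (L : nat) (s : nat -> nat) (v : R) : 0 <= v ->
  (forall m, (s m <= L * 2 ^ m)%N) ->
  (forall m, (L <= m)%N -> v <= grid_point (mesh m) (s m)) ->
  grid_point (mesh m) (s m) @[m --> \oo] --> v ->
  Y (grid_point (mesh m) (s m)) @[m --> \oo] --> Y v ->
  \sum_(k < s m) discount_density r (grid_point (mesh m) k) *
    (Y (grid_point (mesh m) k.+1) - Y (grid_point (mesh m) k)) @[m --> \oo] -->
  I v - I 0.
Proof.
move=> v0 sL vs cs cY; have [V ndV H] := primI.
have cI : I (grid_point (mesh m) (s m)) - I 0 @[m --> \oo] --> I v - I 0.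
  apply: cvgB; last exact: cvg_cst.
  rewrite -(cvg_shiftn L); apply: primitive_right_cvg => //.
  - by move=> m; apply: vs; rewrite leq_addl.
  - by rewrite (cvg_shiftn L (fun m => grid_point (mesh m) (s m))).
  - by rewrite (cvg_shiftn L (fun m => Y (grid_point (mesh m) (s m)))).
apply: cvg_sub0 cI.
apply/cvgrPdist_lt => e e0.
have D0 : 0 < V L%:R - V 0 + 1 by rewrite ltr_wpDl// subr_ge0 ndV.
have e'0 : 0 < e / (V L%:R - V 0 + 1) by rewrite divr_gt0.
have [delta delta0 {}H] := H L%:R _ e'0; have [m0 Hm0] := mesh_small delta0.
exists m0 => // m /= m0m; rewrite sub0r normrN.
have g0 : grid_point (mesh m) 0 = 0 :> R by rewrite /grid_point mul0r.
have gL : grid_point (mesh m) (s m) <= L%:R :> R.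
  rewrite -(mesh_mul R L m) /grid_point ler_wpM2r ?ler_nat ?sL//.
  by rewrite ltW// mesh_gt0.
have step k : (k < s m)%N -> [/\ grid_point (mesh m) k <= grid_point (mesh m) k :> R,
    grid_point (mesh m) k <= grid_point (mesh m) k.+1 :> R &
    grid_point (mesh m) k.+1 - grid_point (mesh m) k < delta :> R].
  move=> _; rewrite grid_pointS lexx lerDl (ltW (mesh_gt0 R m)); split => //.
  by rewrite addrAC subrr add0r Hm0.
have := primitive_sum H (m := s m) (t := grid_point (mesh m)) (c := grid_point (mesh m)).
rewrite g0 => /(_ (lexx _) gL step) h; apply: (le_lt_trans h).
have gs0 : 0 <= grid_point (mesh m) (s m) :> R by exact: grid_point_ge0.
rewrite mulrAC ltr_pdivrMr// ltr_pM2l//.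
by apply: (@le_lt_trans _ _ (V L%:R - V 0)); [rewrite lerB// ndV|rewrite ltrDl].
Qed.

End primitive_limits.

Section compensated_payoff.
Context (R : realType) (arm : bool -> levy_arm R) (i : bool).
Variables (r : R) (z : R -> R) (n : R -> nat) (j : nat -> R).
Hypotheses (r0 : 0 < r) (gp : good_path arm i z n j).

Definition compensated_payoff (t : R) : R :=
  risky_payoff arm i z n j t - payoff_rate (arm i) * t.

Definition jump_variation (t : R) : R := \sum_(k < n t) `|j k|.

Local Notation y := compensated_payoff.
Local Notation jump_mean := (\int[levy (arm i)]_h h).

Let continuous_component (t : R) : R := volatility (arm i) * z t - jump_mean * t.

Let yE t : y t = continuous_component t + \sum_(k < n t) j k.
Proof.
rewrite /y /risky_payoff /continuous_part /payoff_rate /continuous_component; ring.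
Qed.

Let continuous_component_continuous :
  {within [set t : R | 0 <= t], continuous continuous_component}.
Proof.
move=> t; apply: cvgB; apply: cvgM; [exact: cvg_cst|exact: (good_cont gp)|exact: cvg_cst|].
by apply: (@continuous_subspaceT _ _ _ id) => x; exact: cvg_id.
Qed.

Lemma jump_variation_le u v : 0 <= u -> u <= v -> jump_variation u <= jump_variation v.
Proof.
move=> u0 uv; have := good_mono gp u0 uv; rewrite /jump_variation => /subnKC <-.
by rewrite big_split_ord /= lerDl sumr_ge0.
Qed.

Lemma compensated_payoff_bound t : 0 <= t -> `|y t| <=
  `|volatility (arm i)| * `|z t| + `|jump_mean| * t + jump_variation t.
Proof.
move=> t0; rewrite yE; apply: (le_trans (ler_normD _ _)); apply: lerD; last exact: ler_norm_sum.
by apply: (le_trans (ler_normB _ _)); rewrite !normrM (ger0_norm t0).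
Qed.

Let measurable_y (B : R) : measurable_fun `[0, B] y.
Proof.
(* Extended by 0 to negative times, the count is monotone on the whole line, so its level sets are
   intervals and it is measurable. *)
pose n' t := if 0 <= t then n t else 0%N.
have n'_mono u v : u <= v -> (n' u <= n' v)%N.
  rewrite /n' => uv; case: ifP => // u0; rewrite (le_trans u0 uv).
  exact: (good_mono gp).
have mn' : measurable_fun setT n'.
  move=> _ A mA; rewrite setTI (_ : _ @^-1` _ = \bigcup_(k in A) (n' @^-1` [set k])).
    apply: bigcup_measurable => k _; apply: is_interval_measurable.
    move=> a b /= ak bk c /andP[ac cb]; apply/eqP.
    by rewrite eqn_leq -{1}bk n'_mono//= -ak n'_mono.
  apply/seteqP; split => [t At|t [k Ak tk]]; first by exists (n' t).
  by move: tk => /= tk; rewrite /preimage /= tk.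
have mS : measurable_fun setT (fun t => \sum_(k < n' t) j k).
  by apply: (measurable_fun_nat_index (G := fun m t => \sum_(k < m) j k)) => // m;
    exact: measurable_cst.
have mL : measurable_fun `[0, B] continuous_component.
  apply: subspace_continuous_measurable_fun => //.
  apply: continuous_subspaceW continuous_component_continuous => t /=.
  by rewrite in_itv /= => /andP[].
have : measurable_fun `[0, B] (fun t => continuous_component t + \sum_(k < n' t) j k).
  by apply: measurable_funD => //; exact: measurable_funTS.
apply: eq_measurable_fun => t; rewrite inE /= in_itv /= => /andP[t0 _].
by rewrite yE /n' t0.
Qed.

Let bounded_y (B : R) : exists M : R, forall t, 0 <= t <= B -> `|y t| <= M.
Proof.
have [M HM] := continuous_bounded_segment (good_cont gp) B.
exists (`|volatility (arm i)| * M + `|jump_mean| * B + jump_variation B) => t /andP[t0 tB].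
apply: (le_trans (compensated_payoff_bound t0)).
by rewrite !lerD ?ler_wpM2l ?HM ?t0 ?jump_variation_le.
Qed.

Lemma compensated_primitive : stieltjes_primitive r y (by_parts r y).
Proof.
apply: (by_parts_primitive r0 measurable_y bounded_y jump_variation_le) => B e e0.
have [dl dl0 H] := unif_continuous_segment continuous_component_continuous B e0.
exists dl => // u v u0 uv vB vu; rewrite !yE.
have nuv := good_mono gp u0 uv.
rewrite (_ : _ - _ = (continuous_component v - continuous_component u) +
  (\sum_(k < n v) j k - \sum_(k < n u) j k)); last by ring.
apply: (le_trans (ler_normD _ _)); apply: lerD.
  apply/ltW/H => //; first exact: le_trans vB.
  - exact: le_trans uv.
  - by rewrite ger0_norm// subr_ge0.
rewrite /jump_variation -(subnKC nuv) !big_split_ord /= addrAC subrr add0r.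
by rewrite addrAC subrr add0r ler_norm_sum.
Qed.

Lemma compensated_right_cvg (u : nat -> R) (v : R) : 0 <= v ->
  (forall m, v <= u m) -> u m @[m --> \oo] --> v -> y (u m) @[m --> \oo] --> y v.
Proof.
move=> v0 vu cu; apply/cvgrPdist_lt => e e0.
have [d1 d10 H1] := near_right_eps (good_right gp v0).
have [d2 d20 H2] := within_continuous_eps continuous_component_continuous v0 e0.
have m0 : 0 < Num.min d1 d2 by rewrite lt_min d10.
move/cvgrPdist_lt: cu => /(_ _ m0); apply: filterS => m.
rewrite distrC lt_min => /andP[h1 h2].
have num : n (u m) = n v.
  have := vu m; rewrite le_eqVlt => /predU1P[<-//|vm]; apply: H1 => //.
  by move: h1; rewrite ger0_norm ?subr_ge0// ltrBlDl.
rewrite !yE num opprD addrACA subrr addr0 distrC; apply: H2 => //.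
exact: le_trans (vu m).
Qed.

Section limits_at_infinity.
Variables (b : nat -> R) (A : R).
Hypotheses (b_ge0 : forall k, 0 <= b k)
  (yb : forall k t, k%:R <= t <= k.+1%:R -> `|y t| <= b k)
  (bA : forall m, \sum_(0 <= k < m) (discount_density r k%:R * (2 + 2 * r) * b k) <= A).

Let a0 k : 0 <= discount_density r k%:R * (2 + 2 * r) * b k.
Proof.
apply: mulr_ge0 => //; apply: mulr_ge0; first exact: discount_density_ge0.
by rewrite addr_ge0// mulr_ge0// ltW.
Qed.

Let variation_y k u v : k%:R <= u -> u <= v -> v <= k.+1%:R ->
  `|by_parts r y v - by_parts r y u| <= discount_density r k%:R * (2 + 2 * r) * b k.
Proof.
move=> ku uv vk; have u0 : 0 <= u by exact: le_trans ku.
have vu : v - u <= 1 by move: vk; rewrite -natr1; lra.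
apply: (le_trans (by_parts_variation r0 measurable_y bounded_y u0 uv vu (b_ge0 k) _)).
  by move=> t /andP[ut tv]; apply: yb; rewrite (le_trans ku ut) (le_trans tv vk).
rewrite ler_wpM2r// ler_wpM2r ?addr_ge0 ?mulr_ge0 ?(ltW r0)//.
exact: discount_density_ler.
Qed.

Lemma compensated_primitive_bound t : 0 <= t -> `|by_parts r y t - by_parts r y 0| <= A.
Proof. exact: (variation_bound a0 bA variation_y). Qed.

(** With g the mean rate, the payoff is the stopped compensated payoff plus (g - s) times the
    stopped clock plus s t. Each term has an explicit primitive. *)
Lemma stopped_discounted_payoff (s : R) (tau : \bar R) : (0 <= tau)%E ->
  exists2 l : R, by_parts r y (stop tau L%:R) - by_parts r y 0 @[L --> \oo] --> l &
    is_discounted_payoff r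
      (fun t => risky_payoff arm i z n j (stop tau t) + s * (t - stop tau t))
      (l + payoff_rate (arm i) * (1 - discount r tau) + s * discount r tau).
Proof.
move=> tau0; have := variation_stop_cvg a0 bA variation_y tau0.
move=> /cvg_ex[l0 cl]; set g := payoff_rate _.
have cnat (f : R -> R) (l : R) : f x @[x --> +oo] --> l -> f L%:R @[L --> \oo] --> l.
  move=> cf; apply: (cvg_comp (fun L : nat => L%:R : R) f _ cf).
  exact: cvgr_idn.
exists (l0 - by_parts r y 0).
  by apply: cvgB; [exact: cnat cl|exact: cvg_cst].
pose Iid t := 1 - expR (- r * t).
have pI := primitive_lin 1 1 (primitive_stop tau0 compensated_primitive)
  (primitive_lin (g - s) s (primitive_stop tau0 (primitive_id r0)) (primitive_id r0)).
set Y' := (fun t => _) in pI; set I' := (X in stieltjes_primitive _ _ X) in pI.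
have -> : (fun t => risky_payoff arm i z n j (stop tau t) + s * (t - stop tau t)) = Y'.
  by apply/funext => t; rewrite /Y' /compensated_payoff -/g; ring.
exists (fun t => I' t - I' 0).
  by move=> t t0; exact: primitive_stieltjes.
have cexp : expR (- r * t) @[t --> +oo%R] --> (0 : R).
  apply/cvgrPdist_lt => e e0; near=> t.
  rewrite sub0r normrN ger0_norm ?expR_ge0// -(lnK e0) ltr_expR mulNr ltrNl.
  by rewrite mulrC -ltr_pdivrMr//; near: t; apply: nbhs_pinfty_gt; exact: num_real.
have cdisc : expR (- r * stop tau t) @[t --> +oo%R] --> discount r tau.
  case: (tau) tau0 => [x x0| _ |//] /=.
    apply: cvg_near_cst; exists x; split => [|t xt]; first exact: num_real.
    by rewrite (stop_ge (erefl _))// ltW.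
  by under eq_fun do rewrite stop_id ?leey//.
have I'0 : I' 0 = by_parts r y 0.
  rewrite /I' /= (_ : stop tau 0 = 0); last by rewrite stop_id.
  rewrite mulr0 expR0; ring.
rewrite I'0 (_ : _ + _ = (1 * l0 + 1 * ((g - s) * (1 - discount r tau) + s * (1 - 0)))
  - by_parts r y 0); last by ring.
apply: cvgB; last exact: cvg_cst.
apply: cvgD; first by apply: cvgM => //; exact: cvg_cst.
apply: cvgM; first exact: cvg_cst.
apply: cvgD; apply: cvgM; try exact: cvg_cst.
  by apply: cvgB => //; exact: cvg_cst.
by apply: cvgB => //; exact: cvg_cst.
Unshelve. all: by end_near. Qed.

End limits_at_infinity.
End compensated_payoff.

Lemma integral_of_parts d (T : measurableType d) (R : realType)
    (mu : {measure set T -> \bar R}) (A : set T) (f1 f2 : T -> R) (a1 a2 : R) :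
  measurable A -> measurable_fun A f1 -> measurable_fun A f2 ->
  (forall w, 0 <= f1 w) -> (forall w, 0 <= f2 w) ->
  (\int[mu]_(w in A) (f1 w)%:E = a1%:E)%E -> (\int[mu]_(w in A) (f2 w)%:E = a2%:E)%E ->
  mu.-integrable A (EFin \o (fun w => f1 w - f2 w)) /\
  (\int[mu]_(w in A) (f1 w - f2 w)%:E = (a1 - a2)%:E)%E.
Proof.
move=> mA m1 m2 f10 f20 E1 E2.
have ifin (f : T -> R) (a : R) : measurable_fun A f -> (forall w, 0 <= f w) ->
    (\int[mu]_(w in A) (f w)%:E = a%:E)%E -> mu.-integrable A (EFin \o f).
  move=> mf f0 Ef; apply/integrableP; split; first exact/measurable_EFinP.
  rewrite (_ : (\int[mu]_(w in A) `|(EFin \o f) w| = a%:E)%E) ?ltry// -Ef.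
  by apply: eq_integral => w _ /=; rewrite ger0_norm.
have i1 := ifin _ _ m1 f10 E1; have i2 := ifin _ _ m2 f20 E2.
split; first exact: eq_integrable (integrableB mA i1 i2).
rewrite EFinB -E1 -E2 -integralB//.
Qed.

(** * Means and bounds for the compensated payoff *)

Section payoff_increments.
Context d (T : measurableType d) (R : realType) (P : probability T R).
Variables (arm : bool -> levy_arm R) (p0 : R) (theta : {RV P >-> bool})
  (Z : R -> {RV P >-> R}) (N : bool -> R -> {RV P >-> nat})
  (J : bool -> nat -> {RV P >-> R}).
Hypothesis model : bandit_model arm p0 theta Z N J.
Hypothesis A3 : forall A : set (measurableTypeR R), measurable A ->
  (levy (arm false) A <= levy (arm true) A)%E.
Variable i : bool.
Hypothesis levyP : admissible_levy (arm i).
Variable r : R.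
Hypothesis r0 : 0 < r.
Local Notation Q := (restriction P (measurable_type_event theta i)).
Local Notation good w := (good_path arm i (fun t => Z t w) (fun t => N i t w)
  (fun k => J i k w)).
Local Notation y w := (compensated_payoff arm i (fun t => Z t w) (fun t => N i t w)
  (fun k => J i k w)).
Local Notation X m := (brownian_increment Z (mesh m)).
Local Notation D m := (count_increment N i (mesh m)).
Local Notation Mk := (mark arm J i).
Local Notation jump_mean := (\int[levy (arm i)]_h h).

Let mesh0 m : 0 < mesh m :> R := mesh_gt0 R m.

Let model' m : block_model P Q (X m) (D m) Mk (count_pmf arm i (mesh m)).
Proof. exact: (grid_block_model model i (mesh0 m)). Qed.

Let ae_good : {ae Q, forall w, good w}.
Proof.
by apply: ae_restriction; apply: ae_imp (ae_good_path model A3 i) => w h _.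
Qed.

Let Q_le1 : (Q setT <= 1)%E.
Proof.
by rewrite restrictionE setTI; apply: probability_le1; exact: measurable_type_event.
Qed.

Let jump_moment (phi : R -> R) : measurable_fun setT phi -> (forall h, 0 <= phi h) ->
  (forall h, phi h <= `|h|) -> exists2 Phi, 0 <= Phi &
  (\int[levy (arm i)]_h (phi h)%:E = Phi%:E)%E.
Proof.
move=> mphi phi0 phiH; have [_ ih] := levyP.
have lt : (\int[levy (arm i)]_h (phi h)%:E < +oo)%E.
  have /integrableP[mh] := ih; apply: le_lt_trans.
  apply: ge0_le_integral => //.
  - by move=> h _; rewrite lee_fin.
  - exact/measurable_EFinP.
  - exact: measurableT_comp.
  - by move=> h _; rewrite /= lee_fin.
have ge : (0 <= \int[levy (arm i)]_h (phi h)%:E)%E.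
  by apply: integral_ge0 => h _; rewrite lee_fin.
exists (fine (\int[levy (arm i)]_h (phi h)%:E)); first exact: fine_ge0.
by rewrite fineK// ge0_fin_numE.
Qed.

Let compound_mean (phi : R -> R) (Phi : R) m K A : measurable_fun setT phi ->
  (forall h, 0 <= phi h) -> (\int[levy (arm i)]_h (phi h)%:E = Phi%:E)%E ->
  <<s history (X m) (D m) Mk K >> A ->
  (\int[Q]_(w in A) (\sum_(q < D m K w) phi (Mk (count (D m) K w + q)%N w))%:E
    = (mesh m * Phi)%:E * Q A)%E.
Proof.
move=> mphi phi0 EPhi; have [e [He HPhi]] := mean_mark model mphi phi0 EPhi.
have e0 q : 0 <= e q.
  case: (He q) => _ _; rewrite -lee_fin => <-.
  by apply: integral_ge0 => w _; rewrite lee_fin.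
apply: (compound_step (model' m) He) => q.
exact: (count_pmf_sum (mesh0 m) _ HPhi e0).
Qed.

Let history_setT m K : <<s history (X m) (D m) Mk K >> setT.
Proof. exact: (@measurableT _ (history_type (X m) (D m) Mk K)). Qed.

Let measurable_compound m (phi : R -> R) K : measurable_fun setT phi ->
  measurable_fun setT (fun w => \sum_(q < D m K w) phi (Mk (count (D m) K w + q)%N w)).
Proof.
move=> mphi; have [mX mD mJ _ _] := model' m.
apply: (measurable_fun_nat_index
  (G := fun j w => \sum_(q < j) phi (Mk (count (D m) K w + q)%N w))) => // j.
apply: measurable_sum => q.
apply: (measurable_fun_nat_index (G := fun l w => phi (Mk (l + q)%N w))).
  exact: measurable_count.
by move=> l; exact: measurableT_comp.
Qed.

Let variation_mean : exists2 Phi, 0 <= Phi & forall L, exists V : T -> R,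
  [/\ measurable_fun setT V, (forall w, 0 <= V w),
   (\int[Q]_w (V w)%:E <= (L%:R * Phi)%:E)%E &
   forall w, good w -> V w = jump_variation (fun t => N i t w) (fun k => J i k w) L%:R].
Proof.
have mabs : measurable_fun setT (fun h : R => `|h|) by exact: measurableT_comp.
have [Phi Phi0 EPhi] := jump_moment mabs (fun h => normr_ge0 h) (fun h => lexx _).
exists Phi => // L; have [mX mD mJ _ _] := model' 0%N.
pose V L w := \sum_(k < count (D 0%N) L w) `|Mk k w|.
have mV l : measurable_fun setT (V l).
  apply: (measurable_fun_nat_index (G := fun j w => \sum_(k < j) `|Mk k w|)).
    exact: measurable_count.
  by move=> j; apply: measurable_sum => k; exact: measurableT_comp.
have V0 l w : 0 <= V l w by exact: sumr_ge0.
exists (V L); split => //.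
  elim: L => [|L IH].
    rewrite mul0r (_ : (fun w => (V 0%N w)%:E) = cst 0%E); first by rewrite integral0.
    by apply/funext => w; rewrite /V /count big_ord0 big_ord0.
  have VS w : (V L.+1 w)%:E = ((V L w)%:E +
      (\sum_(q < D 0%N L w) `|Mk (count (D 0%N) L w + q)%N w|)%:E)%E.
    by rewrite -EFinD /V /count big_ord_recr /= big_split_ord.
  under eq_integral do rewrite VS.
  have n1 w : [set: T] w -> (0 <= (V L w)%:E)%E by rewrite lee_fin.
  have m1 : measurable_fun setT (EFin \o V L) by exact/measurable_EFinP.
  have n2 w : [set: T] w ->
      (0 <= (\sum_(q < D 0%N L w) `|Mk (count (D 0%N) L w + q)%N w|)%:E)%E.
    by rewrite lee_fin sumr_ge0.
  have m2 := proj2 (measurable_EFinP _ _) (measurable_compound 0 L mabs).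
  rewrite (ge0_integralD Q measurableT n1 m1 n2 m2).
  rewrite (compound_mean mabs (fun h => normr_ge0 h) EPhi (@history_setT 0%N L)).
  rewrite -natr1 mulrDl mul1r EFinD; apply: leeD => //.
  rewrite /mesh expr0 invr1 mul1r -[leRHS]mule1.
  by apply: lee_pmul => //; rewrite ?lee_fin.
move=> w gw; rewrite /V /jump_variation (_ : count _ L w = N i L%:R w); last first.
  by rewrite (count_grid 0 L gw) /grid_point /mesh expr0 invr1 mulr1.
by apply: eq_bigr => k _; rewrite (mark_good gw _ (ltn_ord k)).
Qed.

(** The supremum over [0, L] has mean growing at most like exp(r L / 2), which the discount exp(-r
    L) outweighs. The Brownian part is dominated by [brownian_envelope], the jumps by their total
    variation, whose mean is linear in L. *)
Lemma payoff_envelope : exists2 C, 0 <= C & forall L : nat, exists W : T -> R,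
  [/\ measurable_fun setT W, (forall w, 0 <= W w),
   (\int[Q]_w (W w)%:E <= (C * expR (r / 2 * L%:R))%:E)%E &
   {ae Q, forall w, forall t, 0 <= t <= L%:R -> `|y w t| <= W w}].
Proof.
(* Chosen so that the growth rate [2 * a ^+ 2] of the Brownian envelope is [r / 2]. *)
pose a := Num.sqrt r / 2.
have a0 : 0 < a by rewrite divr_gt0// sqrtr_gt0.
have aa : 2 * a ^+ 2 = r / 2.
  by rewrite /a expr_div_n sqr_sqrtr ?(ltW r0)//; field.
have [C C0 HC] := brownian_envelope model i a0.
have [Phi Phi0 HV] := variation_mean.
pose c1 := `|volatility (arm i)| / a; pose c2 := (`|jump_mean| + Phi) * (2 / r).
have c10 : 0 <= c1 by rewrite divr_ge0// ltW.
have c20 : 0 <= c2 by rewrite mulr_ge0// ?addr_ge0// divr_ge0// ltW.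
exists (c1 * C + c2); first by rewrite addr_ge0// mulr_ge0.
move=> L; have [H [mH H0 iH HH]] := HC L; have [V [mV V0 iV EV]] := HV L.
have mfH : measurable_fun setT (fine \o H) by exact: measurableT_comp.
have fH0 w : 0 <= fine (H w) by exact: fine_ge0.
pose W w := c1 * fine (H w) + (`|jump_mean| * L%:R + V w).
have iH' : Q.-integrable setT H.
  apply/integrableP; split => //; under eq_integral do rewrite gee0_abs//.
  by apply: (le_lt_trans iH); rewrite ltry.
have aeH : {ae Q, forall w, H w \is a fin_num}.
  by apply: ae_imp (integrable_ae measurableT iH') => w; apply.
have EW w : (W w)%:E = (c1%:E * (fine (H w))%:E + (`|jump_mean| * L%:R)%:E + (V w)%:E)%E.
  by rewrite -EFinM -!EFinD /W addrA.
exists W; split.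
- by apply: measurable_funD; [exact: measurable_funM|exact: measurable_funD].
- by move=> w; apply: addr_ge0; [exact: mulr_ge0|apply: addr_ge0 => //; exact: mulr_ge0].
- under eq_integral do rewrite EW.
  have m1 : measurable_fun setT (fun w => c1%:E * (fine (H w))%:E)%E.
    by apply/measurable_EFinP; exact: measurable_funM.
  have m2 : measurable_fun setT (cst (`|jump_mean| * L%:R)%:E : T -> \bar R) by [].
  have n1 w : [set: T] w -> (0 <= c1%:E * (fine (H w))%:E)%E.
    by move=> _; rewrite mule_ge0// lee_fin.
  have n2 w : [set: T] w -> (0 <= cst (`|jump_mean| * L%:R)%:E w)%E.
    by move=> _; rewrite lee_fin mulr_ge0.
  have n3 w : [set: T] w -> (0 <= (V w)%:E)%E by move=> _; rewrite lee_fin.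
  have mV' : measurable_fun setT (EFin \o V) by exact/measurable_EFinP.
  have n12 w : [set: T] w -> (0 <= c1%:E * (fine (H w))%:E + cst (`|jump_mean| * L%:R)%:E w)%E.
    by move=> ?; rewrite adde_ge0 ?n1 ?n2.
  rewrite (ge0_integralD Q measurableT n12 (emeasurable_funD m1 m2) n3 mV').
  rewrite (ge0_integralD Q measurableT n1 m1 n2 m2).
  rewrite ge0_integralZl_EFin//; [|by move=> w _; rewrite lee_fin|exact/measurable_EFinP].
  have Efine : (\int[Q]_w (fine (H w))%:E = \int[Q]_w H w)%E.
    apply: ae_eq_integral => //; first exact/measurable_EFinP.
    by apply: ae_imp aeH => w fw _; rewrite fineK.
  rewrite Efine integral_cst//.
  apply: (@le_trans _ _ (c1%:E * (C * expR (2 * a ^+ 2 * L%:R))%:E +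
      (`|jump_mean| * L%:R)%:E * 1 + (L%:R * Phi)%:E)%E).
    apply: leeD => //; apply: leeD.
      by apply: lee_pmul => //; apply: integral_ge0 => w _.
    by apply: lee_pmul => //; rewrite lee_fin mulr_ge0.
  rewrite mule1 aa -EFinM -!EFinD lee_fin /c2; set E := expR _.
  have h : L%:R <= 2 / r * E.
    have := expR_ge1Dx (r / 2 * L%:R); rewrite -/E => h.
    have : r / 2 * L%:R <= E by lra.
    by rewrite -ler_pdivlMl ?divr_gt0// invf_div.
  have jP : 0 <= `|jump_mean| + Phi by rewrite addr_ge0.
  have := ler_wpM2l jP h; lra.
- apply: ae_imp (ae_and aeH ae_good) => w [fw gw] t /andP[t0 tL].
  apply: le_trans; first exact: compensated_payoff_bound.
  rewrite /W -addrA; apply: lerD; last first.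
    by apply: lerD; [exact: ler_wpM2l|rewrite (EV w gw); exact: (jump_variation_le gw)].
  (* At dyadic times a |Z| <= exp(a |Z|) <= H. If a |Z| exceeded H at time t, continuity would carry
     the excess to a dyadic time just before t. *)
  rewrite /c1 -mulrA ler_wpM2l// mulrC ler_pdivlMr// mulrC leNgt; apply/negP => zt.
  have zt0 : 0 < `|Z t w|.
    by rewrite -(pmulr_rgt0 _ a0); apply: le_lt_trans zt.
  have e0 : 0 < `|Z t w| - fine (H w) / a by rewrite subr_gt0 ltr_pdivrMr// mulrC.
  have [dl dl0 Hdl] := within_continuous_eps (good_cont gw) t0 e0.
  have t_gt0 : 0 < t.
    move: t0; rewrite le_eqVlt => /predU1P[t0|//].
    by move: zt0; rewrite -t0 (good_z0 gw) normr0 ltxx.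
  have ut : Num.max 0 (t - dl) < t by rewrite gt_max t_gt0 /= ltrBlDr ltrDl.
  have u0 : 0 <= Num.max 0 (t - dl) by rewrite le_max lexx.
  have [m [k [_ uk kt]]] := grid_point_between u0 ut.
  have kL : (k <= L * 2 ^ m)%N.
    rewrite -(ler_nat R) -(ler_pM2r (mesh0 m)) mesh_mul.
    by apply: (le_trans _ tL); exact: ltW.
  have := HH w m k kL; rewrite (good_z0 gw) subr0 -(fineK fw) lee_fin => hk.
  have g0 := grid_point_ge0 R m k.
  have := Hdl _ g0; move: uk; rewrite gt_max => /andP[_ uk].
  rewrite distrC ger0_norm ?subr_ge0 ?(ltW kt)// => /(_ ltac:(lra)) hz.
  have h2 : a * `|Z (grid_point (mesh m) k) w| <= fine (H w).
    by apply: le_trans hk; have := expR_ge1Dx (a * `|Z (grid_point (mesh m) k) w|); lra.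
  have h3 : `|Z (grid_point (mesh m) k) w| <= fine (H w) / a by rewrite ler_pdivlMr// mulrC.
  have := lerB_dist (Z t w) (Z (grid_point (mesh m) k) w).
  by rewrite distrC; lra.
Qed.

Lemma payoff_increment m K w : good w ->
  y w (grid_point (mesh m) K.+1) - y w (grid_point (mesh m) K) =
  volatility (arm i) * X m K w - jump_mean * mesh m +
  \sum_(q < D m K w) Mk (count (D m) K w + q)%N w.
Proof.
move=> gw; have g0 := grid_point_ge0 R m K.
have gS : grid_point (mesh m) K <= grid_point (mesh m) K.+1 :> R.
  by rewrite grid_pointS lerDl ltW.
have nS := good_mono gw g0 gS.
have -> : \sum_(q < D m K w) Mk (count (D m) K w + q)%N w =
    \sum_(q < N i (grid_point (mesh m) K.+1) w) J i q w -
    \sum_(q < N i (grid_point (mesh m) K) w) J i q w.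
  rewrite -[in U in U - _](subnKC nS) big_split_ord /= addrAC subrr add0r.
  rewrite -/(count_increment N i (mesh m) K w) (count_grid m K gw).
  apply: eq_bigr => q _; apply: (mark_good gw (le_trans g0 gS)).
  by rewrite -[ltnRHS](subnKC nS) ltn_add2l.
rewrite /compensated_payoff /risky_payoff /continuous_part /payoff_rate /brownian_increment.
set a1 := Z _ w; set a2 := Z _ w; set S1 := \sum_(_ < _) _; set S2 := \sum_(_ < _) _.
rewrite !grid_pointS; ring.
Qed.

(** Given the past, the Brownian increment is centred and the jump sum has mean [mesh] times the
    jump mean, which the drift term removes. Positive and negative parts are treated separately
    because the block lemmas concern nonnegative functions. *)
Lemma increment_mean m K A : <<s history (X m) (D m) Mk K >> A ->
  Q.-integrable A (EFin \o (fun w => volatility (arm i) * X m K w - jump_mean * mesh m +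
    \sum_(q < D m K w) Mk (count (D m) K w + q)%N w)) /\
  (\int[Q]_(w in A) (volatility (arm i) * X m K w - jump_mean * mesh m +
    \sum_(q < D m K w) Mk (count (D m) K w + q)%N w)%:E = 0)%E.
Proof.
move=> sA; have [mX mD mJ _ _] := model' m.
have mA : measurable A.
  by apply: (smallest_sub _ (history_measurable mX mD mJ (K:=K))) sA;
    exact: sigma_algebra_measurable.
have [q Eq] : exists q, Q A = q%:E by exists (fine (Q A)); rewrite fineK// fin_num_measure.
pose pos (h : R) := Num.max h 0; pose neg (h : R) := Num.max (- h) 0.
have mpos : measurable_fun setT pos by exact: measurable_maxr.
have mneg : measurable_fun setT neg by apply: measurable_maxr => //; exact: measurableT_comp.
have pos0 h : 0 <= pos h by rewrite le_max lexx orbT.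
have neg0 h : 0 <= neg h by rewrite le_max lexx orbT.
have posneg h : h = pos h - neg h.
  by rewrite /pos /neg; case: (leP h 0) => h0; case: (leP (- h) 0) => h1; lra.
have [eX [HXp HXn]] := mean_pos_increment model (mesh0 m) K.
have tot := count_pmf_total arm i (mesh0 m).
have EXp := increment_step (model' m) HXp tot sA.
have EXn := increment_step (model' m) HXn tot sA.
have {}EXp : (\int[Q]_(w in A) (pos (X m K w))%:E = (eX * q)%:E)%E by rewrite EFinM -Eq.
have {}EXn : (\int[Q]_(w in A) (neg (X m K w))%:E = (eX * q)%:E)%E by rewrite EFinM -Eq.
have [iX IX] := integral_of_parts mA
  (measurable_funTS (measurableT_comp mpos (mX K)))
  (measurable_funTS (measurableT_comp mneg (mX K)))
  (fun w => pos0 _) (fun w => neg0 _) EXp EXn.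
have posH h : pos h <= `|h| by rewrite ge_max ler_norm normr_ge0.
have negH h : neg h <= `|h| by rewrite ge_max -normrN ler_norm normr_ge0.
have [Pp _ EPp] := jump_moment mpos pos0 posH.
have [Pn _ EPn] := jump_moment mneg neg0 negH.
have ECp := compound_mean mpos pos0 EPp sA; have ECn := compound_mean mneg neg0 EPn sA.
have {}ECp : (\int[Q]_(w in A) (\sum_(q0 < D m K w) pos (Mk (count (D m) K w + q0)%N w))%:E
    = (mesh m * Pp * q)%:E)%E by rewrite EFinM -Eq.
have {}ECn : (\int[Q]_(w in A) (\sum_(q0 < D m K w) neg (Mk (count (D m) K w + q0)%N w))%:E
    = (mesh m * Pn * q)%:E)%E by rewrite EFinM -Eq.
have [iC IC] := integral_of_parts mA
  (measurable_funTS (measurable_compound m K mpos))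
  (measurable_funTS (measurable_compound m K mneg))
  (fun w => sumr_ge0 _ (fun q _ => pos0 _)) (fun w => sumr_ge0 _ (fun q _ => neg0 _)) ECp ECn.
have Ejm : jump_mean = Pp - Pn.
  have [_ Ih] := integral_of_parts (mu := levy (arm i)) measurableT mpos mneg pos0 neg0 EPp EPn.
  rewrite /Rintegral (_ : (\int[levy (arm i)]_h h%:E = (Pp - Pn)%:E)%E)// -Ih.
  by apply: eq_integral => h _; rewrite -posneg.
pose c := jump_mean * mesh m.
have ic : Q.-integrable A (EFin \o cst c) by exact: finite_measure_integrable_cst.
pose F1 w := pos (X m K w) - neg (X m K w).
pose F2 w := \sum_(q0 < D m K w) pos (Mk (count (D m) K w + q0)%N w) -
  \sum_(q0 < D m K w) neg (Mk (count (D m) K w + q0)%N w).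
have FE w : volatility (arm i) * X m K w - jump_mean * mesh m +
    \sum_(q < D m K w) Mk (count (D m) K w + q)%N w =
    volatility (arm i) * F1 w - c + F2 w.
  rewrite /F1 -posneg /F2 -sumrB; congr (_ + _).
  by apply: eq_bigr => q0 _; rewrite -posneg.
have iZ : Q.-integrable A (fun w => (volatility (arm i))%:E * (F1 w)%:E)%E.
  exact: integrableZl.
have iB := integrableB mA iZ ic.
have iD := integrableD mA iB iC.
split.
  by apply: eq_integrable iD => // w _ /=; rewrite FE.
under eq_integral do rewrite FE.
transitivity (\int[Q]_(w in A) (((volatility (arm i))%:E * (F1 w)%:E - (EFin \o cst c) w)
   + (EFin \o F2) w))%E; first by apply: eq_integral.
rewrite integralD// integralB// integralZl//.
have Ec : (\int[Q]_(w in A) (EFin \o cst c) w = c%:E * Q A)%E.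
  by transitivity (\int[Q]_(w in A) (cst c%:E w))%E; [exact: eq_integral|exact: integral_cst].
rewrite [U in (_ * U)%E]IX [U in (_ + U)%E]IC Ec.
rewrite Eq -!EFinM -EFinB -EFinD /c Ejm; congr (_%:E); ring.
Qed.

End payoff_increments.

Lemma sum_alive d (T : measurableType d) (R : realType) (B : nat -> set T) (a : nat -> R)
    (K : nat) (w : T) :
  \sum_(k < K) \1_(alive B k) w * a k = \sum_(k < stop_index B K w) a k.
Proof.
elim: K => [|K IH]; first by rewrite !big_ord0.
rewrite big_ord_recr /= indicE; case: (boolP (w \in _)) => [wA|_]; last first.
  by rewrite mul0r addr0 IH.
by rewrite mul1r big_ord_recr /= IH stop_index_alive.
Qed.

Lemma discount_stop (R : realType) (r : R) (tau : \bar R) (t : R) : 0 < r -> (0 <= tau)%E ->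
  expR (- r * stop tau t) = Num.max (discount r tau) (expR (- r * t)).
Proof.
move=> r0; case: tau => [x x0|_|//] /=; last first.
  by rewrite stop_id ?leey// max_r// expR_ge0.
have [xt|tx] := leP x t.
  by rewrite (stop_ge (erefl _) xt) max_l// expRN_ler.
by rewrite stop_id ?lee_fin ?(ltW tx)// max_r// expRN_ler// ltW.
Qed.

Lemma max_lip (R : realDomainType) (a b e : R) :
  `|Num.max a e - Num.max b e| <= `|a - b|.
Proof.
have h1 := ler_norm (a - b); have h2 := ler_norm (b - a); rewrite distrC in h2.
by case: (leP a e) => ha; case: (leP b e) => hb;
  rewrite ler_norml; apply/andP; split; lra.
Qed.

(** * The mean of the stopped payoff *)

Section stopped_mean.
Context d (T : measurableType d) (R : realType) (P : probability T R).
Variables (arm : bool -> levy_arm R) (p0 : R) (theta : {RV P >-> bool})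
  (Z : R -> {RV P >-> R}) (N : bool -> R -> {RV P >-> nat})
  (J : bool -> nat -> {RV P >-> R}).
Hypothesis model : bandit_model arm p0 theta Z N J.
Hypothesis A3 : forall A : set (measurableTypeR R), measurable A ->
  (levy (arm false) A <= levy (arm true) A)%E.
Variables (i : bool) (kappa c r eta Phi x : R).
Hypothesis levyP : admissible_levy (arm i).
Hypotheses (r0 : 0 < r) (eta0 : 0 < eta) (x0 : 0 <= x) (x1 : x <= 1).
Hypothesis EPhi : (\int[levy (arm i)]_h (jump_ratio arm h `^ eta)%:E = Phi%:E)%E.
Hypothesis exponent0 : - r + eta ^+ 2 * kappa ^+ 2 / 2 + eta * c
  + (Phi - levy_mass (arm i)) = 0.
Local Notation Q := (restriction P (measurable_type_event theta i)).
Local Notation good w := (good_path arm i (fun t => Z t w) (fun t => N i t w)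
  (fun k => J i k w)).
Local Notation y w := (compensated_payoff arm i (fun t => Z t w) (fun t => N i t w)
  (fun k => J i k w)).
Local Notation hits := (hit arm Z N J i kappa c x).
Local Notation hd := (hit_discount arm Z N J i kappa c r x).
Local Notation cross w := (crossing_time arm kappa c (fun t => Z t w)
  (fun t => N i t w) (fun k => J i k w) x).
Local Notation X m := (brownian_increment Z (mesh m)).
Local Notation D m := (count_increment N i (mesh m)).
Local Notation Mk := (mark arm J i).
Local Notation f := (discount_density r).

Let ae_good : {ae Q, forall w, good w}.
Proof.
by apply: ae_restriction; apply: ae_imp (ae_good_path model A3 i) => w h _.
Qed.

(** The discount at k times the envelope on [k, k + 1] has mean of order exp(-r k + r (k + 1) / 2),
    a summable sequence; the series [A] dominates the discounted payoff at all horizons. *)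
Let total_envelope : exists (W : nat -> T -> R) (A : T -> \bar R),
  [/\ forall k w, 0 <= W k w, Q.-integrable setT A, {ae Q, forall w, A w \is a fin_num},
   {ae Q, forall w, forall k t, k%:R <= t <= k.+1%:R -> `|y w t| <= W k w} &
   forall w m, (\sum_(0 <= k < m) (f k%:R * (2 + 2 * r) * W k w)%:E <= A w)%E].
Proof.
have [C C0 HC] := payoff_envelope model A3 levyP r0.
have [W HW] := choice (fun k => HC k.+1).
pose a k := f k%:R * (2 + 2 * r).
have a0 k : 0 <= a k.
  by apply: mulr_ge0; [exact: discount_density_ge0|rewrite addr_ge0// mulr_ge0// ltW].
have mW k : measurable_fun setT (fun w => (a k * W k w)%:E).
  by have [mW _ _ _] := HW k; apply/measurable_EFinP; exact: measurable_funM.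
have aW0 k w : (0 <= (a k * W k w)%:E)%E.
  by have [_ W0 _ _] := HW k; rewrite lee_fin mulr_ge0.
pose A w := (\sum_(k <oo) (a k * W k w)%:E)%E.
have A0 w : (0 <= A w)%E by apply: nneseries_ge0 => k _ _.
have mA : measurable_fun setT A.
  by apply: ge0_emeasurable_sum => [k w _ _|k _]; [exact: aW0|exact: mW].
have iA : Q.-integrable setT A.
  apply/integrableP; split => //.
  rewrite (_ : (\int[Q]_w `|A w| = \int[Q]_w A w)%E); last first.
    by apply: eq_integral => w _; rewrite gee0_abs.
  rewrite /A integral_nneseries//.
  pose q := expR (- (r / 2)).
  have q1 : `|q| < 1 by rewrite ger0_norm ?expR_ge0// expR_lt1 oppr_lt0 divr_gt0.
  pose b := r * (2 + 2 * r) * C * expR (r / 2).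
  have b0 : 0 <= b.
    rewrite mulr_ge0 ?expR_ge0// mulr_ge0// mulr_ge0 ?(ltW r0)//.
    by rewrite addr_ge0// mulr_ge0// ltW.
  have cG := @is_cvg_geometric_series R b q q1.
  apply: (@le_lt_trans _ _ (\sum_(k <oo) (geometric b q k)%:E)%E).
    apply: lee_nneseries => [k _ _|k _]; first by apply: integral_ge0 => w _.
    have [mWk W0 iW _] := HW k.
    under eq_integral do rewrite EFinM.
    rewrite ge0_integralZl_EFin//; [|by move=> w _; rewrite lee_fin|exact/measurable_EFinP].
    apply: (@le_trans _ _ ((a k)%:E * (C * expR (r / 2 * k.+1%:R))%:E)%E).
      apply: lee_pmul => //; first by rewrite lee_fin; exact: a0.
      by apply: integral_ge0 => w _; rewrite lee_fin.
    rewrite -EFinM lee_fin /geometric /= /a /b /discount_density /q -expRM_natl.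
    rewrite (_ : _ * (C * _) = r * (2 + 2 * r) * C * (expR (- r * k%:R) *
      expR (r / 2 * k.+1%:R))); last by ring.
    rewrite -[leRHS]mulrA -!expRD le_eqVlt; apply/orP; left; apply/eqP.
    by congr (_ * expR _); rewrite -natr1; field.
  rewrite (_ : (\sum_(k <oo) (geometric b q k)%:E)%E =
    (limn (series (geometric b q)))%:E) ?ltry//.
  rewrite -EFin_lim//; apply/congr_lim/funext => n /=.
  by rewrite /series /= -sumEFin.
exists W, A; split => //.
- by move=> k w; have [_ W0 _ _] := HW k.
- by apply: ae_imp (integrable_ae measurableT iA) => w; apply.
- have : {ae Q, forall w, forall k t, 0 <= t <= k.+1%:R -> `|y w t| <= W k w}.
    by apply: ae_foralln => k; have [] := HW k.
  by apply: ae_imp => w h k t /andP[kt tk]; apply: h; rewrite tk andbT (le_trans _ kt).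
- by move=> w m; apply: nneseries_lim_ge => k _ _; exact: aW0.
Qed.

(** The discounted compensated payoff up to the first hit or L, as a martingale transform: the
    indicator of not having been stopped depends on the past only. *)
Let gridsum (m L : nat) (w : T) : R :=
  \sum_(k < L * 2 ^ m) \1_(alive (hits m 1) k) w *
    (f (grid_point (mesh m) k) *
     (y w (grid_point (mesh m) k.+1) - y w (grid_point (mesh m) k))).

Let gridsumE m L w : gridsum m L w = \sum_(k < stop_index (hits m 1) (L * 2 ^ m) w)
  f (grid_point (mesh m) k) *
    (y w (grid_point (mesh m) k.+1) - y w (grid_point (mesh m) k)).
Proof.
exact: (sum_alive _ (fun k => f (grid_point (mesh m) k) *
  (y w (grid_point (mesh m) k.+1) - y w (grid_point (mesh m) k)))).
Qed.

Let measurable_y t : measurable_fun setT (fun w => y w t).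
Proof.
apply: measurable_funB => //; apply: measurable_funD.
  by apply: measurable_funD => //; exact: measurable_funM.
by apply: (measurable_fun_nat_index (G := fun j w => \sum_(k < j) J i k w)) => // j;
  exact: measurable_sum.
Qed.

Let alive_hits m k : <<s history (X m) (D m) Mk k >> (alive (hits m 1) k).
Proof.
have [mX mD mJ _ _] := grid_block_model model i (mesh_gt0 R m).
by apply: alive_history => l lk; exact: (hit_history model A3).
Qed.

Let measurable_alive m k : measurable (alive (hits m 1) k).
Proof.
have [mX mD mJ _ _] := grid_block_model model i (mesh_gt0 R m).
by apply: (smallest_sub _ (history_measurable mX mD mJ (K:=k))) (@alive_hits m k);
  exact: sigma_algebra_measurable.
Qed.

Let measurable_gridsum m L : measurable_fun setT (gridsum m L).
Proof.
apply: measurable_sum => k; apply: measurable_funM; first exact: measurable_indic.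
by apply: measurable_funM => //; exact: measurable_funB.
Qed.

Let gridsum_mean m L : (\int[Q]_w (gridsum m L w)%:E = 0)%E.
Proof.
pose dl k w := volatility (arm i) * X m k w - (\int[levy (arm i)]_h h) * mesh m +
  \sum_(q < D m k w) Mk (count (D m) k w + q)%N w.
pose g K w := \sum_(k < K) \1_(alive (hits m 1) k) w * (f (grid_point (mesh m) k) * dl k w).
have key K : Q.-integrable setT (EFin \o g K) /\ (\int[Q]_w (g K w)%:E = 0)%E.
  elim: K => [|K [iK EK]].
    rewrite (_ : g 0%N = cst 0); last by apply/funext => w; rewrite /g big_ord0.
    split; first exact: finite_measure_integrable_cst.
    by rewrite integral0_eq.
  have [iA EA] := increment_mean model levyP (@alive_hits m K).
  have mA := @measurable_alive m K.
  pose h := ((EFin \o dl K) \_ (alive (hits m 1) K))%E.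
  have ih : Q.-integrable setT h by exact: (integrable_mkcond _ mA).1.
  have Eh : (\int[Q]_w h w = 0)%E by rewrite -integral_mkcond.
  have gE w : (g K.+1 w)%:E = ((g K w)%:E + (f (grid_point (mesh m) K))%:E * h w)%E.
    rewrite /g big_ord_recr /= EFinD; congr (_ + _)%E; rewrite /h patchE indicE.
    by case: ifP => _; rewrite ?mul1r ?mul0r ?mule0 ?EFinM.
  have ifh : Q.-integrable setT (fun w => (f (grid_point (mesh m) K))%:E * h w)%E.
    exact: integrableZl.
  split.
    by apply: eq_integrable (integrableD measurableT iK ifh) => // w _; rewrite /= gE.
  under eq_integral do rewrite gE.
  rewrite integralD//; rewrite integralZl// Eh mule0 adde0.
  exact: EK.
rewrite -(key (L * 2 ^ m)%N).2; apply: ae_eq_integral => //.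
- exact/measurable_EFinP.
- exact: (measurable_int _ (key (L * 2 ^ m)%N).1).
apply: ae_imp ae_good => w gw _; congr (_%:E); apply: eq_bigr => k _.
by rewrite (payoff_increment m k gw).
Qed.

(** Discounts are compared rather than times: the grid stopping time has discount max([hd], exp(-r
    L)), which converges to the discount of min(tau, L), and a logarithm recovers the time. The
    condition [L <= m] places L within the horizon of [hit_discount]. *)
Let first_hit_cvg w L : good w -> hd m 1 w @[m --> \oo] --> discount r (cross w) ->
  let s m := stop_index (hits m 1) (L * 2 ^ m) w in
  (forall m, (L <= m)%N -> stop (cross w) L%:R <= grid_point (mesh m) (s m)) /\
  grid_point (mesh m) (s m) @[m --> \oo] --> stop (cross w) L%:R.
Proof.
move=> gw cS s; set v := stop _ _; have tau0 := crossing_time_ge0 arm kappa c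
  (fun t => Z t w) (fun t => N i t w) (fun k => J i k w) x.
have Ev : expR (- r * v) = Num.max (discount r (cross w)) (expR (- r * L%:R)).
  exact: discount_stop.
have Es m : (L <= m)%N -> expR (- r * grid_point (mesh m) (s m)) =
    Num.max (hd m 1 w) (expR (- r * L%:R)).
  move=> Lm.
  have sL : grid_point (mesh m) (s m) <= L%:R :> R.
    rewrite -(mesh_mul R L m) /grid_point ler_wpM2r ?ler_nat ?stop_index_le//.
    by rewrite ltW// mesh_gt0.
  apply/eqP; rewrite eq_le ge_max le_max; apply/and3P; split.
  - case: (boolP (w \in alive (hits m 1) (L * 2 ^ m))) => [wA|wN].
      by rewrite /s stop_index_alive// /grid_point mesh_mul lexx orbT.
    apply/orP; left; apply: le_hit_discount; last exact: stop_index_hit wN.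
    by rewrite (leq_trans (stop_index_le _ _ _))// leq_pmul2r ?expn_gt0.
  - apply: hit_discount_le => [|k km hk]; first exact: expR_ge0.
    apply: expRN_ler => //; rewrite /grid_point ler_wpM2r ?ler_nat ?(ltW (mesh_gt0 _ _))//.
    rewrite leqNgt; apply/negP => /stop_index_alive_lt /(_ k (leqnn k)); exact.
  - exact: expRN_ler.
have hdle m : hd m 1 w <= discount r (cross w).
  apply: hit_discount_le => [|k km]; first exact: discount_ge0.
  rewrite /hit /= (ratio_walkE kappa c m k gw); apply: (discount_crossing_ge gw r0 x0).
  exact: grid_point_ge0.
split.
  move=> m Lm; have : expR (- r * grid_point (mesh m) (s m)) <= expR (- r * v).
    by rewrite Es// Ev ge_max !le_max hdle lexx orbT.
  by rewrite ler_expR !mulNr lerN2 ler_pM2l.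
have cm : Num.max (hd m 1 w) (expR (- r * L%:R)) @[m --> \oo] --> expR (- r * v).
  rewrite Ev; apply/cvgrPdist_lt => e e0; move/cvgrPdist_lt: cS => /(_ e e0).
  apply: filterS => m; apply: le_lt_trans; exact: max_lip.
have lnE (t : R) : t = - (ln (expR (- r * t)) / r).
  by rewrite expRK; field; exact: lt0r_neq0.
have H : - (ln (Num.max (hd (m + L)%N 1 w) (expR (- r * L%:R))) / r) @[m --> \oo]
    --> - (ln (expR (- r * v)) / r).
  apply: cvgN; apply: cvgM; last exact: cvg_cst.
  have cm' : Num.max (hd (m + L)%N 1 w) (expR (- r * L%:R)) @[m --> \oo] --> expR (- r * v).
    by rewrite (cvg_shiftn L (fun m => Num.max (hd m 1 w) (expR (- r * L%:R)))).
  by apply: (cvg_comp _ _ cm'); apply: continuous_ln; exact: expR_gt0.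
rewrite -lnE in H; rewrite -(cvg_shiftn L).
rewrite (_ : (fun m => grid_point (mesh (m + L)) (s (m + L)%N)) =
  fun m => - (ln (Num.max (hd (m + L)%N 1 w) (expR (- r * L%:R))) / r))//.
by apply/funext => m; rewrite [LHS]lnE Es ?leq_addl.
Qed.

(** Two limits preserve the zero mean of [gridsum]: the mesh tends to 0 at fixed horizon L,
    dominated through [abel_bound], and then L tends to infinity, dominated by the total
    envelope. *)
Lemma stopped_payoff_mean (s : R) : exists G S : T -> R,
  [/\ Q.-integrable setT (EFin \o G), (\int[Q]_w (G w)%:E = 0)%E,
   Q.-integrable setT (EFin \o S),
   (\int[Q]_w (S w)%:E = (x `^ eta)%:E * Q setT)%E &
   {ae Q, forall w, is_discounted_payoff r
     (fun t => risky_payoff arm i (fun t => Z t w) (fun t => N i t w) (fun k => J i k w)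
        (stop (cross w) t) + s * (t - stop (cross w) t))
     (G w + payoff_rate (arm i) * (1 - S w) + s * S w)}].
Proof.
have [S [mS iS SE cS ES]] := crossing_discount model A3 r0 eta0 x0 x1 EPhi exponent0.
have [W [A [W0 iA finA yW WA]]] := total_envelope.
pose I w := by_parts r (y w).
pose F L w := I w (stop (cross w) L%:R) - I w 0.
have tau0 w := crossing_time_ge0 arm kappa c
  (fun t => Z t w) (fun t => N i t w) (fun k => J i k w) x.
have step L : exists F' : T -> R, [/\ measurable_fun setT F', {ae Q, forall w, F' w = F L w} &
    (\int[Q]_w (F' w)%:E = 0)%E].
  have [C C0 /(_ L)[V [mV V0 iV yV]]] := payoff_envelope model A3 levyP r0.
  have iV' : Q.-integrable setT (fun w => (2 * r)%:E * (V w)%:E)%E.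
    apply: integrableZl => //; apply/integrableP; split; first exact/measurable_EFinP.
    rewrite (_ : (\int[Q]_w `|(V w)%:E| = \int[Q]_w (V w)%:E)%E); last first.
      by apply: eq_integral => w _; rewrite gee0_abs// lee_fin.
    by apply: (le_lt_trans iV); rewrite ltry.
  have dom : {ae Q, forall w, forall m, (`|gridsum m L w|%:E <= (2 * r)%:E * (V w)%:E)%E}.
    apply: ae_imp (ae_and ae_good yV) => w [gw yVw] m.
    rewrite -EFinM lee_fin gridsumE.
    have f0 : f (grid_point (mesh m) 0) = r by rewrite /f /grid_point mul0r mulr0 expR0 mulr1.
    rewrite -[U in 2 * U]f0.
    apply: (@abel_bound R (fun k => f (grid_point (mesh m) k))
      (fun k => y w (grid_point (mesh m) k))).
    - by move=> k; exact: discount_density_ge0.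
    - move=> k; apply: discount_density_ler => //.
      by rewrite grid_pointS lerDl ltW// mesh_gt0.
    - move=> k ks; apply: yVw; rewrite grid_point_ge0/= -(mesh_mul R L m) /grid_point.
      rewrite ler_wpM2r ?ler_nat ?(ltW (mesh_gt0 _ _))// (leq_trans ks)//.
      exact: stop_index_le.
  have cvgF : {ae Q, forall w, gridsum m L w @[m --> \oo] --> F L w}.
    apply: ae_imp (ae_and ae_good (ae_and SE cS)) => w [gw [SEw cSw]].
    rewrite SEw in cSw; have [h1 h2] := first_hit_cvg L gw cSw.
    have v0 : 0 <= stop (cross w) L%:R by exact: stop_ge0.
    rewrite (_ : (fun m => gridsum m L w) = fun m => \sum_(k < stop_index (hits m 1) (L * 2 ^ m) w)
      f (grid_point (mesh m) k) * (y w (grid_point (mesh m) k.+1) - y w (grid_point (mesh m) k))).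
      apply: (grid_sum_cvg r0 (compensated_primitive r0 gw) v0 _ h1 h2).
        by move=> m; exact: stop_index_le.
      rewrite -(cvg_shiftn L); apply: (compensated_right_cvg gw v0).
        by move=> m; apply: h1; rewrite leq_addl.
      by rewrite (cvg_shiftn L (fun m => grid_point (mesh m) (stop_index (hits m 1) (L * 2 ^ m) w))).
    by apply/funext => m; exact: gridsumE.
  have [F' [mF' F'E _ cF']] := dominated_ae (measurable_gridsum^~ L) iV' dom cvgF.
  exists F'; split => //; apply/esym.
  rewrite (_ : (fun m => _) = cst 0%E) in cF'; last first.
    by apply/funext => m; exact: gridsum_mean.
  exact: (cvg_unique _ (cvg_cst _) cF').
have [F' HF'] := choice step.
have F'F : {ae Q, forall w, forall L, F' L w = F L w}.
  by apply: ae_foralln => L; have [] := HF' L.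
have main : {ae Q, forall w, [/\ forall L, (`|F L w|%:E <= A w)%E & exists2 l,
    F L w @[L --> \oo] --> l & is_discounted_payoff r
     (fun t => risky_payoff arm i (fun t => Z t w) (fun t => N i t w) (fun k => J i k w)
        (stop (cross w) t) + s * (t - stop (cross w) t))
     (l + payoff_rate (arm i) * (1 - S w) + s * S w)]}.
  apply: ae_imp (ae_and (ae_and ae_good SE) (ae_and finA yW)) => w [[gw SEw] [fA yWw]].
  have WA' m : \sum_(0 <= k < m) (f k%:R * (2 + 2 * r) * W k w) <= fine (A w).
    by rewrite -lee_fin fineK// -sumEFin; exact: WA.
  split.
    move=> L; rewrite -(fineK fA) lee_fin.
    by apply: (compensated_primitive_bound r0 gw (W0^~ w) yWw WA'); exact: stop_ge0.
  rewrite SEw; have [l cl dl] := stopped_discounted_payoff r0 gw (W0^~ w) yWw WA' s (tau0 w).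
  by exists l.
have dF' : {ae Q, forall w, forall L, (`|F' L w|%:E <= A w)%E}.
  by apply: ae_imp (ae_and F'F main) => w [E [h _]] L; rewrite E.
have cF' : {ae Q, forall w, F' L w @[L --> \oo] --> limn (fun L => F L w)}.
  apply: ae_imp (ae_and F'F main) => w [E [_ [l cl _]]].
  by rewrite (_ : (fun L => F' L w) = (fun L => F L w)) ?(cvg_lim _ cl)//; apply/funext.
have mF' L : measurable_fun setT (F' L) by have [] := HF' L.
have [G [mG GE iG cG]] := dominated_ae mF' iA dF' cF'.
exists G, S; split => //.
- rewrite (_ : (fun L => _) = cst 0%E) in cG; last first.
    by apply/funext => L; have [] := HF' L.
  by apply/esym; exact: (cvg_unique _ (cvg_cst _) cG).
- apply: ae_imp (ae_and GE main) => w [-> [_ [l cl dl]]].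
  by rewrite (cvg_lim _ cl).
Qed.

End stopped_mean.

(** * Beliefs and the expected payoff *)

Section belief.
Context (R : realType) (arm : bool -> levy_arm R) (i : bool).
Hypothesis A2 : volatility (arm true) = volatility (arm false).
Hypothesis no_brownian : volatility (arm true) = 0 -> drift (arm true) = drift (arm false).

Definition drift_gap : R := (drift (arm true) - drift (arm false)) / volatility (arm true).

(** The drift of the log ratio of Low to High between jumps, when the realized type is [i]: the
    Brownian part contributes minus half the squared gap under High and plus half under Low. *)
Definition log_slope : R := (if i then - 1 else 1) * (drift_gap ^+ 2 / 2) +
  (levy_mass (arm true) - levy_mass (arm false)).

Variables (z : R -> R) (n : R -> nat) (j : nat -> R).
Hypothesis gp : good_path arm i z n j.

Lemma likelihood_ratio t :
  likelihood arm i z (arm true) t / likelihood arm i z (arm false) t =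
  (expR (log_drift drift_gap log_slope z t))^-1.
Proof.
rewrite /likelihood -!expRN -expRD /log_drift /log_slope /drift_gap /continuous_part.
congr expR; rewrite -A2 (_ : volatility (arm i) = volatility (arm true)); last first.
  by case: (i) => //; rewrite A2.
have [s0|s0] := eqVneq (volatility (arm true)) 0.
  by rewrite (no_brownian s0) s0 subrr !(expr0n, mulr0, mul0r, invr0, subr0) /=; case: (i); ring.
by case: (i); field.
Qed.

Variables (q0 p' : R).
Hypotheses (q0_itv : 0 < q0 <= 1) (p'_itv : 0 <= p' < 1).

Definition crossing_level : R := (1 - q0) / q0 * (p' / (1 - p')).

(** The belief is at most p' when its odds are at most p' / (1 - p'). In the cases of belief 1 the
    right side is false as well: q0 = 1 makes the level 0, and a jump of density 0 makes the ratio
    0. *)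
Lemma belief_le t : 0 <= t ->
  (belief arm i z n j q0 t <= p') =
  (1 <= crossing_level * left_ratio arm drift_gap log_slope z n j t).
Proof.
move=> t0; have /andP[q00 q01] := q0_itv; have /andP[p'0 p'1] := p'_itv.
have [m [E mn _ _]] := jumps_beforeE gp t0.
have dens k : (k < m)%N -> 0 <= density arm (j k) <= 1.
  move=> km; have : jumps_before n t k by rewrite E.
  by move=> [u /andP[u0 _] ku]; have [] := good_density gp u0 ku.
have jrE k : (k < m)%N -> jump_ratio arm (j k) = density arm (j k).
  by move=> /dens /andP[h1 h2]; exact: jump_ratioE.
rewrite (left_ratioE _ _ _ _ _ E) /belief /jump_factor.
case: asboolP => [[q1|[k]]|].
- rewrite /crossing_level q1 subrr !mul0r ler10.
  by apply/negbTE; rewrite -ltNge.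
- rewrite E /= => km dk.
  rewrite (bigD1 (Ordinal km))//= jrE// dk mul0r !mulr0 ler10.
  by apply/negbTE; rewrite -ltNge.
move=> /not_orP[/eqP q1 nd].
have q1' : 0 < 1 - q0 by rewrite subr_gt0 lt_neqAle q1.
have dens0 k : (k < m)%N -> 0 < density arm (j k).
  move=> km; have /andP[d0 _] := dens k km; rewrite lt0r d0 andbT.
  by apply/eqP => dk; apply: nd; exists k => //; rewrite E.
set L := expR _; have L0 : 0 < L by exact: expR_gt0.
pose F := \prod_(k < m) density arm (j k).
have F0 : 0 < F by apply: prodr_gt0 => k _; exact: dens0.
have -> : \prod_(k < m) jump_ratio arm (j k) = F.
  by apply: eq_bigr => k _; exact: jrE.
have -> : odds arm i z n j q0 t = q0 / (1 - q0) * L^-1 * F^-1.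
  by rewrite /odds likelihood_ratio E -fsbig_ord prodfV.
pose o := q0 / (1 - q0) * L^-1 * F^-1.
have o0 : 0 < o by rewrite !mulr_gt0 ?invr_gt0.
have oE : crossing_level * (L * F) = p' / (1 - p') / o.
  rewrite /crossing_level /o; field.
  have p1 : 0 < 1 - p' by rewrite subr_gt0.
  by rewrite ?(gt_eqF F0) ?(gt_eqF L0) ?(gt_eqF q00) ?(gt_eqF q1') ?(gt_eqF p1).
rewrite oE -/o ler_pdivlMr// mul1r ler_pdivrMr ?addr_gt0// ler_pdivlMr ?subr_gt0//.
by rewrite mulrDr mulr1 mulrBr mulr1 lerBlDr (mulrC o p').
Qed.

Lemma switch_timeE : switch_time arm i z n j q0 p' =
  crossing_time arm drift_gap log_slope z n j crossing_level.
Proof.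
rewrite /switch_time /crossing_time; congr (ereal_inf (image _ _)).
by apply/seteqP; split => t /= [t0]; rewrite belief_le// => h; split.
Qed.

Lemma crossing_level_itv : p' <= q0 -> 0 <= crossing_level <= 1.
Proof.
move=> pq; have /andP[q00 q01] := q0_itv; have /andP[p'0 p'1] := p'_itv.
have p1 : 0 < 1 - p' by rewrite subr_gt0.
apply/andP; split.
  by apply: mulr_ge0; apply: divr_ge0 => //; rewrite ?subr_ge0//; exact: ltW.
rewrite /crossing_level mulrACA -invfM ler_pdivrMr ?mulr_gt0// mul1r.
by rewrite mulrBl mulrBr mul1r mulr1 lerB.
Qed.

End belief.

Section exponents.
Context (R : realType) (arm : bool -> levy_arm R).
Hypothesis A3 : forall A : set (measurableTypeR R), measurable A ->
  (levy (arm false) A <= levy (arm true) A)%E.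
Variables (r alpha : R).
Hypotheses (alpha0 : 0 < alpha) (char0 : characteristic arm r alpha = 0).

(** Both cases reduce to the characteristic equation. The Brownian terms give (eta^2 - eta) / 2 at
    alpha + 1 for High and (eta^2 + eta) / 2 at alpha for Low, both equal to alpha (alpha + 1) /
    2. *)
Lemma martingale_exponent i : let eta := if i then alpha + 1 else alpha in
  exists2 Phi, (\int[levy (arm i)]_h (jump_ratio arm h `^ eta)%:E = Phi%:E)%E &
  - r + eta ^+ 2 * drift_gap arm ^+ 2 / 2 + eta * log_slope arm i
    + (Phi - levy_mass (arm i)) = 0.
Proof.
pose Phi := \int[levy (arm false)]_h (density arm h `^ alpha).
have EPhi : (\int[levy (arm false)]_h (jump_ratio arm h `^ alpha)%:E = Phi%:E)%E.
  rewrite -(integral_density_powR A3 alpha0) /Phi /Rintegral fineK//.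
  rewrite (integral_density_powR A3 alpha0); apply: integrable_fin_num => //.
  exact: (integrable_jump_ratio_powR A3 false (ltW alpha0)).
have C : Phi + alpha * (levy_mass (arm true) - levy_mass (arm false)) - levy_mass (arm false)
  + 2^-1 * (alpha + 1) * alpha * drift_gap arm ^+ 2 - r = 0 by exact: char0.
case: i => /=; exists Phi.
- by rewrite integral_jump_ratio_powR.
- by rewrite -[RHS]C /log_slope; field.
- exact: EPhi.
- by rewrite -[RHS]C /log_slope; field.
Qed.

End exponents.

Section restriction_integral.
Context d (T : measurableType d) (R : realType) (P : probability T R).
Variables (A : set T) (mA : measurable A).
Local Notation Q := (restriction P mA).

Lemma ae_of_restriction (Pr : T -> Prop) :
  {ae Q, forall w, Pr w} -> {ae P, forall w, A w -> Pr w}.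
Proof.
move=> [B [mB B0 sB]]; exists (B `&` A); split.
- exact: measurableI.
- by rewrite -(restrictionE P mA).
- move=> w /= h; apply: contrapT => h'; apply: h => Aw.
  by apply: contrapT => nPr; apply: h'; split => //; exact: sB.
Qed.

Lemma integral_restriction (f : T -> R) : Q.-integrable setT (EFin \o f) ->
  P.-integrable setT (EFin \o (fun w => f w * \1_A w)) /\
  (\int[P]_w (f w * \1_A w)%:E = \int[Q]_w (f w)%:E)%E.
Proof.
move=> fi; have mf : measurable_fun setT f by apply/measurable_EFinP; exact: measurable_int fi.
pose f1 w := Num.max (f w) 0; pose f2 w := Num.max (- f w) 0.
have m1 : measurable_fun setT f1 by exact: measurable_maxr.
have m2 : measurable_fun setT f2 by apply: measurable_maxr => //; exact: measurableT_comp.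
have f10 w : 0 <= f1 w by rewrite le_max lexx orbT.
have f20 w : 0 <= f2 w by rewrite le_max lexx orbT.
have fE w : f w = f1 w - f2 w.
  by rewrite /f1 /f2; case: (leP (f w) 0) => h0; case: (leP (- f w) 0) => h1; lra.
have fin (g : T -> R) : measurable_fun setT g -> (forall w, 0 <= g w) -> (forall w, g w <= `|f w|) ->
    exists a : R, (\int[Q]_w (g w)%:E = a%:E)%E.
  move=> mg g0 gf; exists (fine (\int[Q]_w (g w)%:E)); rewrite fineK//.
  rewrite ge0_fin_numE; last by apply: integral_ge0 => w _; rewrite lee_fin.
  have /integrableP[_] := fi; apply: le_lt_trans.
  apply: ge0_le_integral => //.
  - by move=> w _; rewrite lee_fin.
  - exact/measurable_EFinP.
  - by apply: measurableT_comp => //; exact/measurable_EFinP.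
  - by move=> w _; rewrite /= lee_fin.
have [a1 E1] : exists a1 : R, (\int[Q]_w (f1 w)%:E = a1%:E)%E.
  by apply: fin => // w; rewrite ge_max ler_norm normr_ge0.
have [a2 E2] : exists a2 : R, (\int[Q]_w (f2 w)%:E = a2%:E)%E.
  by apply: fin => // w; rewrite ge_max -normrN ler_norm normr_ge0.
have mi : measurable_fun setT (\1_A : T -> R) by exact: measurable_indic.
have i0 w : 0 <= \1_A w :> R by rewrite indicE.
have [_ EQ] := integral_of_parts measurableT m1 m2 f10 f20 E1 E2.
have F1 : (\int[P]_w (f1 w * \1_A w)%:E = a1%:E)%E by rewrite -ge0_integral_restriction.
have F2 : (\int[P]_w (f2 w * \1_A w)%:E = a2%:E)%E by rewrite -ge0_integral_restriction.
have [iP EP] := integral_of_parts measurableT (measurable_funM m1 mi) (measurable_funM m2 mi)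
  (fun w => mulr_ge0 (f10 w) (i0 w)) (fun w => mulr_ge0 (f20 w) (i0 w)) F1 F2.
have E w : f w * \1_A w = f1 w * \1_A w - f2 w * \1_A w by rewrite -mulrBl -fE.
split; first by apply: eq_integrable iP => // w _; rewrite /= E.
under eq_integral do rewrite E.
rewrite EP -EQ; apply: eq_integral => w _; by rewrite fE.
Qed.

End restriction_integral.

(** * The expected payoff under both types *)

Section expected_payoff.
Context d (T : measurableType d) (R : realType) (P : probability T R).
Variables (arm : bool -> levy_arm R) (r s p0 : R) (theta : {RV P >-> bool})
  (Z : R -> {RV P >-> R}) (N : bool -> R -> {RV P >-> nat})
  (J : bool -> nat -> {RV P >-> R}).
Hypotheses (r0 : 0 < r) (levyP : forall i, admissible_levy (arm i))
  (A2 : volatility (arm true) = volatility (arm false))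
  (A3 : forall A : set (measurableTypeR R), measurable A ->
     (levy (arm false) A <= levy (arm true) A)%E)
  (no_brownian : volatility (arm true) = 0 -> drift (arm true) = drift (arm false))
  (model : bandit_model arm p0 theta Z N J).
Local Notation Q i := (restriction P (measurable_type_event theta i)).
Local Notation good i w := (good_path arm i (fun t => Z t w) (fun t => N i t w)
  (fun k => J i k w)).

Let type_prob i : P (theta @^-1` [set i]) = (if i then p0 else 1 - p0)%:E.
Proof.
have [Pt _ _ _] := model; have {}Pt : P (theta @^-1` [set true]) = p0%:E by exact: Pt.
case: i => //.
rewrite (_ : theta @^-1` [set false] = ~` (theta @^-1` [set true])).
  rewrite probability_setC; last exact: measurable_type_event.
  by rewrite Pt.
by apply/seteqP; split => w /=; case: (theta w).
Qed.

Lemma immediate_switch q0 p' : 0 <= q0 -> q0 < p' -> p' <= 1 ->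
  is_expected_discounted_payoff P r (cutoff_process arm theta Z N J s q0 p') s.
Proof.
move=> q00 qp p'1; exists (cst s); split; last 2 first.
- exact: finite_measure_integrable_cst.
- by rewrite expectation_cst.
have ae_both : {ae P, forall w, forall i, good i w}.
  apply: ae_imp (ae_and (ae_good_path model A3 true) (ae_good_path model A3 false)).
  by move=> w [h1 h2] [].
apply: ae_imp ae_both => w /(_ (theta w)) gp; rewrite /cutoff_process.
move: gp; set i := theta w; set z := fun t => _; set n := fun t => _; set j := fun k => _.
move=> gp; have q1 : q0 < 1 by exact: lt_le_trans qp p'1.
have jb : jumps_before n 0 = set0.
  apply/seteqP; split => // k [u /andP[u0 u1]].
  by move: u1; rewrite ltNge u0.
have lik a : likelihood arm i z a 0 = 1.
  by rewrite /likelihood /continuous_part (good_z0 gp) !(mulr0, mul0r, addr0, subr0) expR0.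
have b0 : belief arm i z n j q0 0 = q0.
  rewrite /belief; case: asboolP => [[q1'|[k]]|_]; last 1 first.
  - rewrite /odds !lik jb fsbig_set0 invr1 !mulr1; field.
    by rewrite subrK oner_eq0 subr_eq0 eq_sym lt_eqF.
  - by move: q1; rewrite q1' ltxx.
  - by rewrite jb.
have st0 : switch_time arm i z n j q0 p' = 0%E.
  apply/eqP; rewrite eq_le switch_time_ge0 andbT.
  by apply: ereal_inf_lbound; exists 0 => //; split => //; rewrite b0 ltW.
have Y t : 0 <= t -> cutoff_payoff arm i z n j s q0 p' t = 0 * t + s * t.
  move=> t0; rewrite /cutoff_payoff /risky_time st0 min_r ?lee_fin//=.
  rewrite /risky_payoff /continuous_part (good_z0 gp) (good_n0 gp) big_ord0.
  by rewrite !mulr0 !add0r subr0 mul0r add0r.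
have [V ndV H] := primitive_lin 0 s (primitive_id r0) (primitive_id r0).
(* The payoff is s t for nonnegative times only, which is all that a primitive requires; the null
   term gives it the shape of [primitive_lin]. *)
have pY : stieltjes_primitive r (cutoff_payoff arm i z n j s q0 p')
    (fun t => 0 * (1 - expR (- r * t)) + s * (1 - expR (- r * t))).
  exists V => // B e e0; have [dl dl0 {}H] := H B e e0; exists dl => // u v v' c u0 uv vw wB uc cw wu.
  by rewrite !Y ?(le_trans u0)//; exact: H.
exists (fun b => (0 * (1 - expR (- r * b)) + s * (1 - expR (- r * b))) -
    (0 * (1 - expR (- r * 0)) + s * (1 - expR (- r * 0)))).
  by move=> b b_ge0; exact: (primitive_stieltjes pY b_ge0).
have cexp : expR (- r * t) @[t --> +oo%R] --> (0 : R).
  apply/cvgrPdist_lt => e e0; near=> t.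
  rewrite sub0r normrN ger0_norm ?expR_ge0// -(lnK e0) ltr_expR mulNr ltrNl.
  by rewrite mulrC -ltr_pdivrMr//; near: t; apply: nbhs_pinfty_gt; exact: num_real.
rewrite mulr0 expR0 subrr !mulr0 addr0.
rewrite [X in _ --> X](_ : s = 0 * (1 - 0) + s * (1 - 0) - 0); last by ring.
apply: cvgB; last exact: cvg_cst.
by apply: cvgD; apply: cvgM; try exact: cvg_cst; apply: cvgB => //; exact: cvg_cst.
Unshelve. all: by end_near. Qed.

Variable alpha : R.
Hypotheses (alpha0 : 0 < alpha) (char0 : characteristic arm r alpha = 0).
Variables (q0 p' : R).
Hypotheses (q0_itv : 0 < q0 <= 1) (p'_itv : 0 <= p' < 1) (p'q0 : p' <= q0).
Local Notation x := (crossing_level q0 p').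
Local Notation g := (payoff_rate \o arm).

Let eta (i : bool) := if i then alpha + 1 else alpha.

Let type_payoff i : exists H : T -> R, [/\ (Q i).-integrable setT (EFin \o H),
  (\int[Q i]_w (H w)%:E = ((g i + (s - g i) * x `^ eta i) * (if i then p0 else 1 - p0))%:E)%E &
  {ae P, forall w, theta w = i ->
    is_discounted_payoff r (cutoff_process arm theta Z N J s q0 p' w) (H w)}].
Proof.
have eta0 : 0 < eta i by rewrite /eta; case: (i) => //; rewrite addr_gt0.
have [Phi EPhi E0] := martingale_exponent A3 alpha0 char0 i.
have /andP[x0 x1] := crossing_level_itv q0_itv p'_itv p'q0.
have [G [S [iG EG iS ES aeG]]] :=
  stopped_payoff_mean model A3 (levyP i) r0 eta0 x0 x1 EPhi E0 s.
pose H w := G w + g i * (1 - S w) + s * S w.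
have HE w : (H w)%:E = ((G w)%:E + ((s - g i)%:E * (S w)%:E + (g i)%:E))%E.
  by rewrite -EFinM -!EFinD /H; congr (_%:E); ring.
have iS' : (Q i).-integrable setT (fun w => (s - g i)%:E * (S w)%:E)%E by exact: integrableZl.
have ic : (Q i).-integrable setT (EFin \o cst (g i)) by exact: finite_measure_integrable_cst.
have iSc := integrableD measurableT iS' ic; have iH := integrableD measurableT iG iSc.
exists H; split.
- by apply: eq_integrable iH => // w _; rewrite /= HE.
- under eq_integral do rewrite HE.
  have Qi : Q i setT = (if i then p0 else 1 - p0)%:E.
    by rewrite restrictionE setTI; exact: type_prob.
  have Ec : (\int[Q i]_w (EFin \o cst (g i)) w = (g i)%:E * Q i setT)%E.
    by transitivity (\int[Q i]_w (cst (g i)%:E w))%E; [exact: eq_integral|exact: integral_cst].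
  transitivity (0 + ((s - g i)%:E * ((x `^ eta i)%:E * Q i setT) + (g i)%:E * Q i setT))%E.
    by rewrite -EG -ES -Ec -integralZl// -integralD// -integralD.
  by rewrite add0e Qi -!EFinM -EFinD; congr (_%:E); ring.
- have aeg : {ae Q i, forall w, good i w}.
    by apply: ae_restriction; apply: ae_imp (ae_good_path model A3 i) => w h _.
  apply: ae_imp (ae_of_restriction (ae_and aeG aeg)) => w h ti.
  have [h1 gp] := h ti; move: h1.
  by rewrite -(switch_timeE A2 no_brownian gp q0_itv p'_itv) /cutoff_process ti.
Qed.

Lemma cutoff_expected_payoff :
  is_expected_discounted_payoff P r (cutoff_process arm theta Z N J s q0 p')
   ((s - payoff_rate (arm true)) * p0
        * ((1 - q0) / q0) `^ (alpha + 1) * (p' / (1 - p')) `^ (alpha + 1)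
      + (s - payoff_rate (arm false)) * (1 - p0)
        * ((1 - q0) / q0) `^ alpha * (p' / (1 - p')) `^ alpha
      + payoff_rate (arm true) * p0 + payoff_rate (arm false) * (1 - p0)).
Proof.
have [H1 [i1 E1 a1]] := type_payoff true; have [H2 [i2 E2 a2]] := type_payoff false.
have [iP1 EP1] := integral_restriction i1; have [iP2 EP2] := integral_restriction i2.
pose G w := H1 w * \1_(theta @^-1` [set true]) w + H2 w * \1_(theta @^-1` [set false]) w.
have iG := integrableD measurableT iP1 iP2.
exists G; split.
- apply: ae_imp (ae_and a1 a2) => w [h1 h2]; rewrite /G !indicE.
  case: (boolP (w \in theta @^-1` [set true])) => wt.
    rewrite memNset; last by move: wt; rewrite inE /= => ->.
    by rewrite mulr1 mulr0 addr0; apply: h1; move: wt; rewrite inE.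
  have tf : theta w = false by move: wt; rewrite notin_setE /=; case: (theta w).
  by rewrite mem_set// mulr0 mulr1 add0r; exact: h2.
- exact: eq_integrable iG.
rewrite unlock.
transitivity (\int[P]_w (H1 w * \1_(theta @^-1` [set true]) w)%:E +
  \int[P]_w (H2 w * \1_(theta @^-1` [set false]) w)%:E)%E.
  by rewrite -integralD.
rewrite EP1 EP2 E1 E2 -EFinD; congr (_%:E).
have /andP[q00 q01] := q0_itv; have /andP[p'0 p'1] := p'_itv.
have h1 : 0 <= (1 - q0) / q0 by rewrite divr_ge0 ?subr_ge0// ltW.
have h2 : 0 <= p' / (1 - p') by rewrite divr_ge0 ?subr_ge0// ltW.
rewrite /crossing_level /eta /= !(powRM _ h1 h2); ring.
Qed.

End expected_payoff.

(** * The exponent [alpha] *)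

(** The weighted inequality of arithmetic and geometric means for 1 and y, obtained from two tangent
    inequalities for exp. It is the source of convexity in the exponent. *)
Lemma powR_bernoulli (R : realType) (y t : R) : 0 <= y -> 0 < t <= 1 ->
  y `^ t <= 1 - t + t * y.
Proof.
move=> y0 /andP[t0 t1]; move: y0; rewrite le_eqVlt => /predU1P[<-|y0].
  by rewrite powR0 ?gt_eqF// mulr0 addr0 subr_ge0.
rewrite /powR gt_eqF// -{2}(lnK y0); set l := ln y; set m := expR (t * l).
have m0 : 0 < m by exact: expR_gt0.
have h1 : m * (1 - t * l) <= 1.
  have := expR_ge1Dx (- (t * l)); rewrite expRN -/m => h.
  have := ler_wpM2l (ltW m0) h; rewrite mulfV ?gt_eqF//.
have h2 : m * (1 + (l - t * l)) <= expR l.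
  have := ler_wpM2l (ltW m0) (expR_ge1Dx (l - t * l)).
  by rewrite [leRHS](_ : _ = expR l)// -expRD; congr expR; ring.
have h3 := ler_wpM2l (ltW t0) h2.
have t1' : 0 <= 1 - t by rewrite subr_ge0.
have h4 := ler_wpM2l t1' h1.
have -> : m = (1 - t) * (m * (1 - t * l)) + t * (m * (1 + (l - t * l))) by ring.
by apply: lerD => //; rewrite -[leRHS]mulr1.
Qed.

Section characteristic_root.
Context (R : realType) (arm : bool -> levy_arm R) (r s : R).
Hypotheses (r0 : 0 < r) (A1 : payoff_rate (arm false) < s /\ s < payoff_rate (arm true))
  (A3 : forall A : set (measurableTypeR R), measurable A ->
     (levy (arm false) A <= levy (arm true) A)%E)
  (no_brownian : volatility (arm true) = 0 -> drift (arm true) = drift (arm false)).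
Local Notation nu1 := (levy (arm true)).
Local Notation nu2 := (levy (arm false)).
Local Notation jr := (jump_ratio arm).
Local Notation lam2 := (levy_mass (arm false)).
Local Notation mass_gap := (levy_mass (arm true) - levy_mass (arm false)).

Let M (eta : R) : R := fine (\int[nu2]_h (jr h `^ eta)%:E).

Let ME eta : 0 < eta -> (\int[nu2]_h (jr h `^ eta)%:E = (M eta)%:E)%E.
Proof.
move=> e0; rewrite /M fineK//; apply: integrable_fin_num => //.
exact: (integrable_jump_ratio_powR A3 false (ltW e0)).
Qed.

Let characteristicE eta : 0 < eta -> characteristic arm r eta =
  M eta + eta * mass_gap - lam2 + 2^-1 * (eta + 1) * eta * drift_gap arm ^+ 2 - r.
Proof. by move=> e0; rewrite /characteristic /Rintegral integral_density_powR. Qed.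

Let M_le (u v a b : R) : 0 < u -> 0 < v -> 0 <= a -> 0 <= b ->
  (forall y, 0 <= y <= 1 -> y `^ u <= a + b * y `^ v) -> M u <= a * lam2 + b * M v.
Proof.
move=> u0 v0 a0 b0 H; have mjr := measurable_jump_ratio A3.
have mp e : measurable_fun setT (fun h => (jr h `^ e)%:E).
  by apply/measurable_EFinP; exact: (measurableT_comp (measurable_powR e) mjr).
have p0 e h : [set: measurableTypeR R] h -> (0 <= (jr h `^ e)%:E)%E.
  by rewrite lee_fin powR_ge0.
rewrite -lee_fin EFinD !EFinM -!ME// -levy_massE.
have mb : measurable_fun setT (fun h => b%:E * (jr h `^ v)%:E)%E.
  by apply: emeasurable_funM => //; exact: measurable_cst.
have pb h : [set: measurableTypeR R] h -> (0 <= b%:E * (jr h `^ v)%:E)%E.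
  by move=> ?; rewrite mule_ge0// p0.
have pa h : [set: measurableTypeR R] h -> (0 <= cst a%:E h)%E by rewrite lee_fin.
rewrite -integral_cst// -ge0_integralZl_EFin//; [|exact: (p0 v)|exact: mp].
rewrite -(ge0_integralD nu2 measurableT pa (measurable_cst _) pb mb).
have mab : measurable_fun setT (fun h => cst a%:E h + b%:E * (jr h `^ v)%:E)%E.
  exact: (emeasurable_funD (measurable_cst _) mb).
apply: ge0_le_integral => //; try exact: mab; try exact: p0; try exact: mp.
move=> h _; rewrite -EFinM -EFinD lee_fin; apply: H.
by rewrite jump_ratio_ge0 jump_ratio_le1.
Qed.

Let M_ge0 eta : 0 <= M eta.
Proof. by apply: fine_ge0; apply: integral_ge0 => h _; rewrite lee_fin powR_ge0. Qed.

Let M_le_mass u : 0 < u -> M u <= lam2.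
Proof.
move=> u0; rewrite -[leRHS]addr0 -(mul0r (M u)) -[lam2]mul1r.
by apply: M_le => // y /andP[y0 y1]; rewrite mul0r addr0 powR_le1// ltW.
Qed.

(** Convexity of the jump term along chords from 0, where the value is taken to be the total
    mass. *)
Let M_chord v t : 0 < v -> 0 < t <= 1 -> M (t * v) <= (1 - t) * lam2 + t * M v.
Proof.
move=> v0 /[dup] t01 /andP[t0 t1]; apply: M_le => //.
- exact: mulr_gt0.
- by rewrite subr_ge0.
- exact: ltW.
- move=> y /andP[y0 y1]; rewrite mulrC powRrM.
  exact: (powR_bernoulli (powR_ge0 y v) t01).
Qed.

Let M_anti u v : 0 < u -> u <= v -> M v <= M u.
Proof.
move=> u0 uv; rewrite -[leRHS]add0r -(mul0r lam2) -[M u]mul1r.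
apply: M_le => //; first exact: lt_le_trans uv.
move=> y /andP[y0 y1]; rewrite mul1r add0r.
have -> : v = u + (v - u) by ring.
rewrite powRD; last first.
  apply/implyP => /eqP h; have := lt_le_trans u0 uv.
  by rewrite (_ : v = 0) ?ltxx//; lra.
by rewrite ler_piMr ?powR_ge0// powR_le1// subr_ge0.
Qed.

Let M_lip u v : 0 < u -> u <= v -> M u - M v <= lam2 * ((v - u) / v).
Proof.
move=> u0 uv; have v0 := lt_le_trans u0 uv.
have t01 : 0 < u / v <= 1 by rewrite divr_gt0//= ler_pdivrMr// mul1r.
have := M_chord v0 t01; rewrite divfK ?gt_eqF// => h.
have -> : (v - u) / v = 1 - u / v by rewrite mulrBl mulfV ?gt_eqF.
have h2 : 0 <= (1 - u / v) * M v.
  by rewrite mulr_ge0// subr_ge0; case/andP: t01.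
by rewrite mulrC; lra.
Qed.

Let mass_gap_ge0 : 0 <= mass_gap.
Proof. by rewrite subr_ge0 -lee_fin -!levy_massE A3. Qed.

(** Equal masses and A3 force nu1 = nu2. By A1 the drifts then differ, hence there is a Brownian
    component and the drift gap is nonzero. *)
Let gap_gt0 : 0 < mass_gap \/ 0 < drift_gap arm ^+ 2.
Proof.
move: mass_gap_ge0; rewrite le_eqVlt => /predU1P[m0|]; last by left.
right; have eqm : nu1 setT = nu2 setT.
  by rewrite !levy_massE; congr EFin; apply/eqP; rewrite -subr_eq0 -m0.
have eqnu (A : set (measurableTypeR R)) : measurable A -> nu2 A = nu1 A.
  move=> mA; apply/eqP; rewrite eq_le A3//=.
  have mAC : measurable (~` A) by exact: measurableC.
  have add (nu : {finite_measure set (measurableTypeR R) -> \bar R}) :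
      nu setT = (nu A + nu (~` A))%E.
    by rewrite -measureU ?setICr// setUv.
  have := A3 mAC; have := eqm; rewrite !add.
  have f1 : nu1 A \is a fin_num by rewrite fin_num_measure.
  have f2 : nu2 A \is a fin_num by rewrite fin_num_measure.
  have f3 : nu1 (~` A) \is a fin_num by rewrite fin_num_measure.
  have f4 : nu2 (~` A) \is a fin_num by rewrite fin_num_measure.
  rewrite -(fineK f1) -(fineK f2) -(fineK f3) -(fineK f4) -!EFinD => -[].
  by rewrite !lee_fin; lra.
have eqI : \int[nu1]_h h = \int[nu2]_h h.
  rewrite /Rintegral; congr fine; apply: eq_measure_integral => A mA _.
  by first [exact: (eqnu _ mA)|exact: (esym (eqnu _ mA))].
have dn : drift (arm true) != drift (arm false).
  apply/eqP => de; case: A1 => h1 h2; have := lt_trans h1 h2.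
  by rewrite /payoff_rate eqI de ltxx.
have vn : volatility (arm true) != 0.
  by apply/eqP => /no_brownian /eqP; rewrite (negbTE dn).
by rewrite exprn_even_gt0//= mulf_neq0 ?invr_eq0 ?subr_eq0.
Qed.

Lemma characteristic_root : exists! alpha : R, 0 < alpha /\ characteristic arm r alpha = 0.
Proof.
pose k2 := drift_gap arm ^+ 2; have k20 : 0 <= k2 by exact: sqr_ge0.
have l0 : 0 <= lam2 by exact: levy_mass_ge0.
pose poly eta := eta * mass_gap - lam2 + 2^-1 * (eta + 1) * eta * k2 - r.
have FE eta : 0 < eta -> characteristic arm r eta = M eta + poly eta.
  by move=> e0; rewrite characteristicE// /poly !addrA.
have g0 := mass_gap_ge0.
(* By convexity f(t b) <= - (1 - t) r + t f(b) for 0 < t < 1, so two positive roots would give 0 <=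
   - (1 - t) r. *)
have uniq a b : 0 < a -> a < b -> characteristic arm r a = 0 ->
    characteristic arm r b = 0 -> False.
  move=> a0 ab; have b0 := lt_trans a0 ab; rewrite !FE//.
  pose t := a / b; have t0 : 0 < t by rewrite divr_gt0.
  have t1 : t < 1 by rewrite ltr_pdivrMr// mul1r.
  have aE : a = t * b by rewrite divfK// gt_eqF.
  have := @M_chord b t b0; rewrite t0 (ltW t1) -aE => /(_ isT) h Fa Fb.
  have Mb : M b = - poly b by apply/eqP; rewrite -addr_eq0 Fb.
  rewrite Mb in h.
  have h2 : poly (t * b) <= (1 - t) * (- lam2 - r) + t * poly b.
    rewrite /poly -subr_ge0 (_ : _ - _ = 2^-1 * k2 * b ^+ 2 * t * (1 - t)); last by field.
    apply: mulr_ge0; last by rewrite subr_ge0 ltW.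
    apply: mulr_ge0; last exact: ltW.
    by apply: mulr_ge0; [exact: mulr_ge0|exact: sqr_ge0].
  have h3 : 0 < (1 - t) * r by rewrite mulr_gt0// subr_gt0.
  by move: Fa; rewrite {2}aE => Fa; lra.
(* A point so close to 0 that the terms linear and quadratic in it stay below r. *)
pose a := Num.min 1 (r / (2 * (mass_gap + k2 + 1))).
have den0 : 0 < mass_gap + k2 + 1 by rewrite ltr_wpDl// addr_ge0.
have a0 : 0 < a by rewrite lt_min ltr01 divr_gt0// mulr_gt0.
have Fa : M a + poly a < 0.
  have ha1 : a <= 1 by rewrite ge_min lexx.
  have ha2 : a * (2 * (mass_gap + k2 + 1)) <= r.
    by rewrite -ler_pdivlMr ?mulr_gt0// ge_min lexx orbT.
  have h := M_le_mass a0; rewrite /poly.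
  have : 2^-1 * (a + 1) * a * k2 <= a * k2.
    rewrite -subr_ge0 (_ : _ - _ = 2^-1 * (a * k2) * (1 - a)); last by field.
    apply: mulr_ge0; last by rewrite subr_ge0.
    by apply: mulr_ge0 => //; apply: mulr_ge0 => //; exact: ltW.
  have : 0 <= a * k2 by rewrite mulr_ge0// ltW.
  have : 0 <= a * mass_gap by rewrite mulr_ge0// ltW.
  lra.
have [b ab Fb] : exists2 b, a <= b & 0 < M b + poly b.
  have [gap|gap] := gap_gt0.
    pose b := (lam2 + r + 1) / mass_gap.
    have b0 : 0 < b by rewrite divr_gt0// addr_gt0// ltr_wpDl.
    have key c : b <= c -> 0 < M c + poly c.
      move=> bc; have c0 := lt_le_trans b0 bc; have := M_ge0 c.
      have : lam2 + r + 1 <= c * mass_gap by rewrite -ler_pdivrMr.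
      have : 0 <= 2^-1 * (c + 1) * c * k2.
        by rewrite mulr_ge0// !mulr_ge0 ?invr_ge0 ?addr_ge0 ?(ltW c0).
      rewrite /poly; lra.
    by exists (a + b); [rewrite lerDl ltW|apply: key; rewrite lerDr ltW].
  pose b := 2 * (lam2 + r + 1) / k2.
  have b0 : 0 < b by rewrite divr_gt0// mulr_gt0// addr_gt0// ltr_wpDl.
  have key c : b <= c -> 0 < M c + poly c.
    move=> bc; have c0 := lt_le_trans b0 bc; have := M_ge0 c.
    have : 2 * (lam2 + r + 1) <= c * k2 by rewrite -ler_pdivrMr.
    have : 0 <= c * mass_gap by rewrite mulr_ge0// ltW.
    have : 0 <= c * (c * k2) by rewrite mulr_ge0 ?(ltW c0)// mulr_ge0 ?(ltW c0).
    rewrite /poly; lra.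
  by exists (a + b); [rewrite lerDl ltW|apply: key; rewrite lerDr ltW].
(* Frozen below [a], the jump term is Lipschitz on the whole line, so the intermediate value theorem
   applies on [a, b]. *)
pose Mt eta := M (Num.max eta a).
have Mt_lip u v : `|Mt u - Mt v| <= lam2 / a * `|u - v|.
  wlog uv : u v / u <= v.
    by move=> H; have [/H//|/ltW/H] := leP u v; rewrite distrC [in leRHS]distrC.
  have ua : a <= Num.max u a by rewrite le_max lexx orbT.
  have uva : Num.max u a <= Num.max v a.
    by rewrite ge_max !le_max uv lexx orbT.
  have u0 := lt_le_trans a0 ua.
  rewrite [leLHS]ger0_norm; last by rewrite subr_ge0; exact: (M_anti u0 uva).
  apply: (le_trans (M_lip u0 uva)); rewrite -mulrA ler_wpM2l//.
  have hd : Num.max v a - Num.max u a <= `|u - v|.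
    by apply: (le_trans (ler_norm _)); apply: le_trans (max_lip _ _ _) _; rewrite distrC.
  rewrite mulrC ler_pM ?invr_ge0 ?subr_ge0 ?(ltW (lt_le_trans u0 uva))//.
  by rewrite lef_pV2 ?posrE// ?(lt_le_trans u0 uva)// (le_trans ua uva).
have cMt : continuous Mt.
  move=> u; apply/cvgrPdist_lt => e e0.
  have K0 : 0 < lam2 / a + 1 by rewrite ltr_wpDl// divr_ge0// ltW.
  exists (e / (lam2 / a + 1)); first by rewrite /= divr_gt0.
  move=> v /= uv; apply: (le_lt_trans (Mt_lip u v)).
  rewrite ltr_pdivlMr// in uv; apply: le_lt_trans uv.
  by rewrite mulrDr mulr1 mulrC lerDl.
pose F eta := Mt eta + poly eta.
have cF : continuous F.
  move=> u; apply: cvgD; first exact: cMt.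
  rewrite /poly; apply: cvgB; last exact: cvg_cst.
  apply: cvgD; first by apply: cvgB; [apply: cvgM; [exact: cvg_id|exact: cvg_cst]|exact: cvg_cst].
  apply: cvgM; last exact: cvg_cst.
  apply: cvgM; last exact: cvg_id.
  by apply: cvgM; [exact: cvg_cst|apply: cvgD; [exact: cvg_id|exact: cvg_cst]].
have Fge eta : a <= eta -> F eta = M eta + poly eta.
  by move=> h; rewrite /F /Mt max_l.
have [al] : exists2 al, al \in `[a, b] & F al = 0.
  apply: IVT => //; first exact: continuous_subspaceT.
  rewrite !Fge//; apply/andP; split; first by rewrite ge_min (ltW Fa).
  by rewrite le_max (ltW Fb) orbT.
rewrite in_itv /= => /andP[aal _] Fal; have al0 := lt_le_trans a0 aal.
have root : characteristic arm r al = 0 by rewrite FE// -Fge.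
exists al; split => // be [be0 rbe].
have [lt|lt|//] := ltgtP al be.
- by have := uniq _ _ al0 lt root rbe.
- by have := uniq _ _ be0 lt rbe root.
Qed.

End characteristic_root.

Theorem theorem2p5 (R : realType) (arm : bool -> levy_arm R) (s r : R)
  (r_gt0 : 0 < r)
  (levyP : forall i, admissible_levy (arm i))
  (A1 : payoff_rate (arm false) < s /\ s < payoff_rate (arm true))
  (A2 : volatility (arm true) = volatility (arm false))
  (A3 : forall A : set (measurableTypeR R), measurable A ->
     (levy (arm false) A <= levy (arm true) A)%E)
  (no_brownian : volatility (arm true) = 0 ->
     drift (arm true) = drift (arm false)) :
  (exists! alpha : R, 0 < alpha /\ characteristic arm r alpha = 0) /\
  forall alpha : R, 0 < alpha -> characteristic arm r alpha = 0 ->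
  forall (d : measure_display) (T : measurableType d) (P : probability T R)
    (theta : {RV P >-> bool}) (Z : R -> {RV P >-> R})
    (N : bool -> R -> {RV P >-> nat}) (J : bool -> nat -> {RV P >-> R})
    (p0 q0 p' : R),
  0 <= p0 <= 1 -> 0 <= q0 <= 1 -> 0 <= p' <= 1 ->
  bandit_model arm p0 theta Z N J ->
  (p' <= q0 -> 0 < q0 -> p' < 1 ->
   is_expected_discounted_payoff P r (cutoff_process arm theta Z N J s q0 p')
     ((s - payoff_rate (arm true)) * p0
        * ((1 - q0) / q0) `^ (alpha + 1) * (p' / (1 - p')) `^ (alpha + 1)
      + (s - payoff_rate (arm false)) * (1 - p0)
        * ((1 - q0) / q0) `^ alpha * (p' / (1 - p')) `^ alpha
      + payoff_rate (arm true) * p0 + payoff_rate (arm false) * (1 - p0)))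
  /\
  (q0 < p' ->
   is_expected_discounted_payoff P r (cutoff_process arm theta Z N J s q0 p') s).
Proof.
split; first exact: (characteristic_root r_gt0 A1 A3 no_brownian).
move=> alpha alpha0 char0 d T P theta Z N J p0 q0 p' _ /andP[q00 q01] /andP[p'0 p'1] model.
split=> [pq q0_gt0 p'_lt1|qp].
  apply: (cutoff_expected_payoff s r_gt0 levyP A2 A3 no_brownian model alpha0 char0) => //.
    by rewrite q0_gt0.
  by rewrite p'0.
exact: (immediate_switch s r_gt0 A3 model q00 qp p'1).
Qed.
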